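(* Let $\tfrac12\le\beta\le1$ and assume $r^\alpha\in L_K^{\beta}(L^2_{p^\alpha})$. Let $a\ge4$, let $t_0\ge(2+4C^2a)^{\frac{2\beta+1}{2\beta}}$, write $\bar t=t+t_0$, and run the OLRE iteration with $\eta_t=a\,\bar t^{-\frac{2\beta}{2\beta+1}}$ and $\lambda_t=\frac1a\,\bar t^{-\frac{1}{2\beta+1}}$. Then for all $t\in\mathbb N$ and all $\delta\in(0,1)$, with probability at least $1-\delta$, \[ \|f_t-r^\alpha\|_{L^2_{p^\alpha}}\le\frac{C_1}{\bar t}+\Big(C_2a^{-\beta}+C_3\sqrt a\log\tfrac2\delta\Big)\Big(\frac1{\bar t}\Big)^{\frac{\beta}{2\beta+1}}+\Big(C_4a^{5/2}+C_5a^{7/2}\sqrt{\log\bar t}\Big)\log^2\!\big(\tfrac2\delta\big)\Big(\frac1{\bar t}\Big)^{\frac{4\beta-1}{4\beta+2}}, \] where $C_1=\frac{2t_0}{\alpha}$, $C_2=\frac{5\beta+1}{\beta(1+\beta)}\|L_K^{-\beta}r^\alpha\|_{L^2_{p^\alpha}}$, $C_3=\frac{16C}{\alpha}$, $C_4=\frac{32C^3}{\alpha}$, $C_5=\frac{8C^3(10C+3)}{\alpha}$.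
   Context: Let $\mathcal X\subset\mathbb R^d$ and let $p,q$ be probability densities on $\mathcal X$ (w.r.t. Lebesgue measure) with the support of $q$ contained in that of $p$. Fix $\alpha\in(0,1)$, set $p^\alpha=(1-\alpha)p+\alpha q$ and $r^\alpha=q/p^\alpha$ (so $0\le r^\alpha\le1/\alpha$). Assume $p^\alpha$ has full support on $\mathcal X$. Let $\mathcal H$ be a reproducing kernel Hilbert space of real functions on $\mathcal X$ with continuous symmetric positive semidefinite kernel $K$, with $\sup_{x\in\mathcal X}\sqrt{K(x,x)}\le C<\infty$. $L^2_{p^\alpha}$ denotes the space of (classes of) functions square integrable w.r.t. $p^\alpha(x)dx$. $L_K:L^2_{p^\alpha}\to L^2_{p^\alpha}$ is the integral operator $(L_Kf)(s)=\int K(s,x)f(x)p^\alpha(x)\,dx$; it is self-adjoint, positive, trace class, with an orthonormal eigensystem $(\mu_k,\psi_k)$, $\mu_k>0$ decreasing. For $\beta\in\mathbb R$, $L_K^\beta(\sum_kc_k\psi_k)=\sum_kc_k\mu_k^\beta\psi_k$. ''$r^\alpha\in L_K^\beta(L^2_{p^\alpha})$'' means $r^\alpha=L_K^\beta g$ for some $g\in L^2_{p^\alpha}$, and $\|L_K^{-\beta}r^\alpha\|_{L^2_{p^\alpha}}:=\|g\|_{L^2_{p^\alpha}}$. Data: pairs $(x_t,x'_t)$, $t=1,2,\dots$, i.i.d. in $t$, with $x_t\sim p$ and $x'_t\sim q$. OLRE iteration: given positive sequences $(\eta_t),(\lambda_t)$, set $f_0=0$ and $f_t=(1-\eta_t\lambda_t)f_{t-1}-\eta_t\big[(1-\alpha)f_{t-1}(x_t)K(x_t,\cdot)+(\alpha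 f_{t-1}(x'_t)-1)K(x'_t,\cdot)\big]$. *)

(* Defs.v *)
From HB Require Import structures.
From mathcomp Require Import all_boot all_order all_algebra.
From mathcomp Require Import all_classical all_reals all_analysis.
Set Implicit Arguments. Unset Strict Implicit. Unset Printing Implicit Defensive.
Import Order.TTheory GRing.Theory Num.Theory.
Import numFieldNormedType.Exports.
Local Open Scope classical_set_scope.
Local Open Scope ring_scope.

Definition Rd (R : realType) (d : nat) := g_sigma_algebraType (@open 'rV[R]_d).

Section Defs.
Variables (R : realType) (d : nat).
Local Notation T := (Rd R d).

Definition box (a b : 'I_d -> R) : set T :=
  [set x | forall i, a i <= x ord0 i <= b i].

(* lam is (the Borel restriction of) Lebesgue measure on R^d: the measure of
   every box is the product of its side lengths (this determines lam). *)
Definition is_lebesgue (lam : {measure set T -> \bar R}) :=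
  forall a b, (forall i, a i <= b i) -> lam (box a b) = (\prod_i (b i - a i))%:E.

Variables (lam : {measure set T -> \bar R}) (X : set T).

Definition is_density (p : T -> R) :=
  measurable_fun X p /\ (forall x, X x -> 0 <= p x) /\
  (\int[lam]_(x in X) (p x)%:E = 1)%E.

Definition dsupport (h : T -> R) : set T :=
  [set x | X x /\ forall U : set 'rV[R]_d, open U -> U x ->
     (0 < \int[lam]_(y in U `&` X) (h y)%:E)%E].

Variable w : T -> R. (* the weight p^alpha; L^2_{p^alpha} = L^2(X, w dlam) *)

Definition inL2 (f : T -> R) :=
  measurable_fun X f /\ (\int[lam]_(x in X) (f x ^+ 2 * w x)%:E < +oo)%E.

Definition ip (f g : T -> R) := Rintegral lam X (fun x => f x * g x * w x).
Definition l2norm (f : T -> R) :=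
  Num.sqrt (fine (\int[lam]_(x in X) (f x ^+ 2 * w x)%:E)).

(* ||f - g||_{L^2_{p^alpha}} <= B, stated in \bar R (for B >= 0 this is
   exactly the inequality between the norm and B) *)
Definition l2dist_le (f g : T -> R) (B : R) :=
  (\int[lam]_(x in X) ((f x - g x) ^+ 2 * w x)%:E <= (B ^+ 2)%:E)%E.

Definition L2_lim (u : nat -> T -> R) (F : T -> R) :=
  (fun n => (\int[lam]_(x in X) ((F x - u n x) ^+ 2 * w x)%:E)%E) @ \oo --> 0%E.

Variable K : T -> T -> R.

Definition LK (f : T -> R) : T -> R :=
  fun s => Rintegral lam X (fun x => K s x * f x * w x).

Definition eigensystem (mu : nat -> R) (psi : nat -> T -> R) :=
  [/\ forall k, inL2 (psi k),
      forall i j, ip (psi i) (psi j) = (i == j)%:R,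
      forall k, 0 <= mu k,
      forall k, mu k.+1 <= mu k &
      forall f, inL2 f ->
        L2_lim (fun n y => \sum_(k < n) mu k * ip f (psi k) * psi k y) (LK f)].

Definition is_LK_pow (mu : nat -> R) (psi : nat -> T -> R) (beta : R)
    (g F : T -> R) :=
  L2_lim (fun n y => \sum_(k < n) powR (mu k) beta * ip g (psi k) * psi k y) F.

Definition mercer_kernel :=
  [/\ {within X `*` X, continuous (fun z : 'rV[R]_d * 'rV[R]_d => K z.1 z.2)},
      (forall x y, X x -> X y -> K x y = K y x) &
      (forall n (xs : 'I_n -> T) (c : 'I_n -> R), (forall i, X (xs i)) ->
         0 <= \sum_i \sum_j c i * c j * K (xs i) (xs j))].

(* The OLRE iteration; the data pair (x_t, x'_t) used at step t = s+1 is
   z s (zero-indexed data sequence). *)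
Fixpoint olre (alpha : R) (eta lamb : nat -> R) (z : nat -> T * T) (t : nat)
    : T -> R :=
  match t with
  | 0 => fun _ => 0
  | s.+1 =>
    let f := olre alpha eta lamb z s in
    let x := (z s).1 in let x' := (z s).2 in
    fun y => (1 - eta t * lamb t) * f y
             - eta t * ((1 - alpha) * f x * K x y + (alpha * f x' - 1) * K x' y)
  end.
End Defs.

Definition iid_seq (R : realType) (dO dU : measure_display)
    (O : measurableType dO) (U : measurableType dU)
    (P : probability O R) (Z : nat -> O -> U) :=
  [/\ forall n, measurable_fun setT (Z n),
      forall (I : seq nat) (A : nat -> set U), uniq I ->
        (forall i, measurable (A i)) ->
        fine (P (\bigcap_(i in [set` I]) (Z i @^-1` A i)))
          = \prod_(i <- I) fine (P (Z i @^-1` A i)) &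
      forall n (A : set U), measurable A ->
        P (Z n @^-1` A) = P (Z 0 @^-1` A)].

(* Main.v *)
Require Import Defs.
From HB Require Import structures.
From mathcomp Require Import all_boot all_order all_algebra.
From mathcomp Require Import all_classical all_reals all_analysis.
From mathcomp Require Import measurable_realfun ring lra.
Import Order.TTheory GRing.Theory Num.Theory.
Import numFieldNormedType.Exports.
Local Open Scope classical_set_scope.
Local Open Scope ring_scope.
Set Implicit Arguments.
Unset Strict Implicit.
Unset Printing Implicit Defensive.

(* The kernel is replaced by its n-th Mercer truncation, and n tends to infinity at the end.
   Local averages of the kernel operator, which exist because p^alpha charges every
   neighbourhood of every point of X, identify the features Phi_k = L_K psi_k / sqrt mu_k; they
   give sum Phi_k^2 <= C^2 and sum_(k<n) Phi_k(x) Phi_k(y) -> K(x,y) for all x, y in X.  Hence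
   the truncated iterates converge pointwise to f_t, and a bound that holds with probability
   1 - delta for each n passes to the limit on the limsup of the events, by Fatou's lemma.

   The truncated iteration runs in R^n.  Its coordinates are compared with the solution of the
   averaged recursion, whose error is t0 / (b_t sqrt alpha) + O(lambda_t^beta), where
   b_t = t + t0 (this is tb t, and lambda_t = 1 / (eta_t b_t)).  The difference at time T,
   measured in L^2, is the sum of two martingales:
   - the noise of the averaged path, whose increments are bounded and whose conditional
     variance is summable because the products of (1 - 1/b_i - eta_i mu_k) are at most
     (b_j / b_T) / (1 + mu_k (eta_(j+1) + ... + eta_T)): a Bernstein bound;
   - the multiplicative noise, whose increments are bounded by the difference process itself:
     an Azuma bound along the quadratic variation, which is controlled in turn by an exponential
     moment of the RKHS norm of the difference.
   All exponential moments are taken of sqrt (4 + |S|^2) for vectors S, so that the bounds do not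
   depend on n, and they give the factors log (2/delta) and log^2 (2/delta). *)

(** * Exponential and logarithmic estimates *)

(** The noise of the stochastic gradient grows with the iterate, so its increments have no useful
    deterministic bound. Around the averaged path they do, because that path is deterministic and
    its RKHS norm is at most of order [1/sqrt lambda_T]. What remains is linear in the deviation
    from this path, and a rough control of the deviation suffices there, since it enters only
    through a quadratic variation with small weights. The variance of the main noise is at most a
    multiple of the deterministic error; the arithmetic-geometric inequality then gives back part of
    it to that error. The gauge [sqrt (4 + |S|^2)] is 1-Lipschitz and dominates the norm, so its
    exponential moments give tails of the norm. It depends on [|S|^2] alone, so one step involves
    only an inner product and a square. The 4 keeps it above 2, which controls the second-order
    term. The square of the logarithm appears because the multiplicative noise is scaled by a
    quadratic variation that is itself controlled only up to a logarithm. *)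

Section ExpBounds.
Context {R : realType}.
Implicit Types x y c w p D X Y : R.

(** Squaring the bound at [x] and collecting powers of [x] gives the condition on the new
    coefficient [c']. Repeated doubling carries a bound near 0 to a fixed interval. *)
Lemma expR_double_quad c c' x : 0 <= 1 + x + c * x ^+ 2 ->
  1 + 2 * c + 2 * c * x + c ^+ 2 * x ^+ 2 <= 4 * c' ->
  expR x <= 1 + x + c * x ^+ 2 ->
  expR (2 * x) <= 1 + 2 * x + c' * (2 * x) ^+ 2.
Proof.
move=> h0 hc hx.
have -> : expR (2 * x) = expR x ^+ 2 by rewrite expRM_natl.
apply: (@le_trans _ _ ((1 + x + c * x ^+ 2) ^+ 2)).
  by rewrite ler_sqr ?nnegrE // expR_ge0.
have := sqr_ge0 x => hx2.
have -> : (1 + x + c * x ^+ 2) ^+ 2 =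
  1 + 2 * x + (1 + 2 * c + 2 * c * x + c ^+ 2 * x ^+ 2) * x ^+ 2 by ring.
have := ler_wpM2r hx2 hc; nra.
Qed.

(** At [w / 16] the inequality [exp (- z) >= 1 - z] yields the coefficient 11/10; four doublings
    turn it into 17/20, 3/4, 4/5 and 1. The range 5/4 is what the gauge needs: a linear part at most
    1 plus a curvature part at most 1/4. *)
Lemma expR_le_quad w : `|w| <= 5 / 4 -> expR w <= 1 + w + w ^+ 2.
Proof.
rewrite ler_norml => /andP[w1 w2].
have h0 : expR (w / 16) <= 1 + w / 16 + (11 / 10) * (w / 16) ^+ 2.
  have e1 := expR_ge1Dx (- (w / 16)).
  have e2 : expR (w / 16) * expR (- (w / 16)) = 1.
    by rewrite expRxMexpNx_1.
  have e3 := expR_gt0 (w / 16).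
  have h : expR (w / 16) * (1 - w / 16) <= 1.
    by rewrite -[leRHS]e2 ler_wpM2l // ltW.
  set z := w / 16 in e1 e2 e3 h *.
  have z1 : z <= 5 / 64 by rewrite /z; lra.
  have z0 : - (5 / 64) <= z by rewrite /z; lra.
  rewrite -(@ler_pM2r _ (1 - z)); last lra.
  apply: (le_trans h).
  have := sqr_ge0 z => hz2.
  have -> : (1 + z + 11 / 10 * z ^+ 2) * (1 - z) =
    1 + z ^+ 2 * (1 / 10 - 11 / 10 * z) by field.
  rewrite lerDl mulr_ge0 //; lra.
have h1 : expR (2 * (w / 16)) <= 1 + 2 * (w / 16) + (17 / 20) * (2 * (w / 16)) ^+ 2.
  apply: (expR_double_quad _ _ h0); nra.
have h2 : expR (2 * (2 * (w / 16))) <= 1 + 2 * (2 * (w / 16)) + (3 / 4) * (2 * (2 * (w / 16))) ^+ 2.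
  apply: (expR_double_quad _ _ h1); nra.
have h3 : expR (2 * (2 * (2 * (w / 16)))) <= 1 + 2 * (2 * (2 * (w / 16))) + (4 / 5) * (2 * (2 * (2 * (w / 16)))) ^+ 2.
  apply: (expR_double_quad _ _ h2); nra.
have h4 : expR (2 * (2 * (2 * (2 * (w / 16))))) <= 1 + 2 * (2 * (2 * (2 * (w / 16)))) + 1 * (2 * (2 * (2 * (2 * (w / 16))))) ^+ 2.
  apply: (expR_double_quad _ _ h3); nra.
move: h4; have -> : 2 * (2 * (2 * (2 * (w / 16)))) = w by field.
by rewrite mul1r.
Qed.

(** The linear term averages out for a centred [x], and no smallness of [x] is required; this is
    what an Azuma-type step needs. *)
Lemma expR_le_id_expR_sqr x : expR x <= x + expR (x ^+ 2).
Proof.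
have [x1|x1] := lerP `|x| 1.
  have := @expR_le_quad x; have := expR_ge1Dx (x ^+ 2).
  move=> h1 h2; have : `|x| <= 5 / 4 by lra.
  move=> /h2; lra.
have [x0|x0] := lerP 0 x.
  have -> : expR x <= x + expR (x ^+ 2) = true => //.
  have x2 : x <= x ^+ 2 by move: x1; rewrite ger0_norm //; nra.
  have : expR x <= expR (x ^+ 2) by rewrite ler_expR.
  lra.
move: x1; rewrite ltr0_norm // => x1.
have h1 : expR x <= 1 by rewrite -expR0 ler_expR ltW.
have h2 := expR_ge1Dx (x ^+ 2).
nra.
Qed.

(** The tangent of the square root at [4 + X]. Here [X] is the old squared norm, [p] the inner
    product with the increment and [D2] a bound for the squared increment. *)
Lemma sqrt_shift_le X Y p D2 : 0 <= X -> 0 <= Y -> Y <= X + 2 * p + D2 ->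
  Num.sqrt (4 + Y) <= Num.sqrt (4 + X) + (p / Num.sqrt (4 + X) + D2 / (2 * Num.sqrt (4 + X))).
Proof.
move=> X0 Y0 hY; set h := Num.sqrt (4 + X).
have h2 : h ^+ 2 = 4 + X by rewrite sqr_sqrtr //; lra.
have h0 : 0 < h by rewrite sqrtr_gt0; lra.
have -> : h + (p / h + D2 / (2 * h)) = (h ^+ 2 + (h ^+ 2 + 2 * p + D2)) / (2 * h).
  by field; rewrite gt_eqF.
rewrite ler_pdivlMr; last lra.
set s := Num.sqrt (4 + Y).
have s0 : 0 <= s by exact: sqrtr_ge0.
have : s ^+ 2 = 4 + Y by rewrite sqr_sqrtr //; lra.
have := sqr_ge0 (s - h); nra.
Qed.

Lemma sqrt4D_ge2 X : 0 <= X -> 2 <= Num.sqrt (4 + X).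
Proof.
move=> X0; have -> : (2 : R) = Num.sqrt (2 ^+ 2) by rewrite sqrtr_sqr ger0_norm.
by rewrite ler_wsqrtr //; lra.
Qed.

(** The gradient of the gauge has norm at most 1; the hypothesis on [p] is Cauchy-Schwarz. *)
Lemma ratio_sqrt4D_le X p D : 0 <= X -> 0 <= D -> p ^+ 2 <= X * D ^+ 2 ->
  `|p / Num.sqrt (4 + X)| <= D.
Proof.
move=> X0 D0 hp; have h2 := sqrt4D_ge2 X0; set h := Num.sqrt (4 + X) in h2 *.
have hh : h ^+ 2 = 4 + X by rewrite sqr_sqrtr //; lra.
have h0 : 0 < h by lra.
rewrite normf_div (gtr0_norm h0) ler_pdivrMr //.
rewrite -ler_sqr ?nnegrE ?normr_ge0 //; last by rewrite mulr_ge0 // ltW.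
rewrite real_normK ?num_real //; apply: (le_trans hp).
rewrite exprMn hh mulrC ler_wpM2l ?sqr_ge0 //; lra.
Qed.

(* The square root is concave, which linearises the norm after one step; then expand exp to second order. *)
Lemma expR_sqrt_bernstein X Y p D : 0 <= X -> 0 <= Y -> 0 <= D <= 1 ->
  p ^+ 2 <= X * D ^+ 2 -> Y <= X + 2 * p + D ^+ 2 ->
  expR (Num.sqrt (4 + Y)) <=
  expR (Num.sqrt (4 + X)) * (1 + p / Num.sqrt (4 + X) + 2 * D ^+ 2).
Proof.
move=> X0 Y0 /andP[D0 D1] hp hY.
have hs := sqrt_shift_le X0 Y0 hY.
have := ratio_sqrt4D_le X0 D0 hp; have := sqrt4D_ge2 X0.
set h := Num.sqrt (4 + X) in hs * => h2; set u := p / h in hs *.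
rewrite ler_norml => /andP[u1 u2].
set e := D ^+ 2 / (2 * h) in hs.
have D2 := sqr_ge0 D.
have e0 : 0 <= e by rewrite /e divr_ge0 //; lra.
have e1 : e <= D ^+ 2 / 4.
  rewrite /e ler_pdivrMr; last lra.
  by rewrite mulrAC ler_pdivlMr //; nra.
apply: (@le_trans _ _ (expR (h + (u + e)))); first by rewrite ler_expR.
rewrite expRD ler_wpM2l ?expR_ge0 //.
have hD : D ^+ 2 <= D by nra.
have w1 : `|u + e| <= 5 / 4 by rewrite ler_norml; apply/andP; split; lra.
apply: (le_trans (expR_le_quad w1)).
have q1 : 0 <= 5 / 4 * D - (u + e) by lra.
have q2 : 0 <= 5 / 4 * D + (u + e) by lra.
have := mulr_ge0 q1 q2.
have -> : (5 / 4 * D - (u + e)) * (5 / 4 * D + (u + e)) =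
  25 / 16 * D ^+ 2 - (u + e) ^+ 2 by field.
lra.
Qed.

(** The linearisation is that of the Bernstein version, but [expR_le_id_expR_sqr] replaces the
    quadratic expansion, so [c] may be arbitrarily large. *)
Lemma expR_sqrt_azuma X Y p c : 0 <= X -> 0 <= Y -> 0 <= c ->
  p ^+ 2 <= X * c ^+ 2 -> Y <= X + 2 * p + c ^+ 2 ->
  expR (Num.sqrt (4 + Y)) <=
  expR (Num.sqrt (4 + X)) * (expR (c ^+ 2 / 4) * (p / Num.sqrt (4 + X) + expR (c ^+ 2))).
Proof.
move=> X0 Y0 c0 hp hY.
have hs := sqrt_shift_le X0 Y0 hY.
have := ratio_sqrt4D_le X0 c0 hp; have := sqrt4D_ge2 X0.
set h := Num.sqrt (4 + X) in hs * => h2; set u := p / h in hs *.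
move=> u1; set e := c ^+ 2 / (2 * h) in hs.
have c2 := sqr_ge0 c.
have e1 : e <= c ^+ 2 / 4.
  rewrite /e ler_pdivrMr; last lra.
  by rewrite mulrAC ler_pdivlMr //; nra.
apply: (@le_trans _ _ (expR (h + (u + c ^+ 2 / 4)))).
  by rewrite ler_expR; lra.
rewrite expRD ler_wpM2l ?expR_ge0 // addrC expRD ler_wpM2l ?expR_ge0 //.
apply: (le_trans (expR_le_id_expR_sqr u)); rewrite lerD2l ler_expR.
by rewrite -[leLHS]real_normK ?num_real // ler_sqr.
Qed.

(* A tangent line of the convex function [s |-> exp (sqrt (4 + s))]. *)
Lemma expR_sqrt_tangent X Y : 0 <= X -> 0 <= Y ->
  expR (Num.sqrt (4 + X)) + expR (Num.sqrt (4 + X)) / (2 * Num.sqrt (4 + X)) * (Y - X)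
  <= expR (Num.sqrt (4 + Y)).
Proof.
move=> X0 Y0; have := sqrt4D_ge2 X0; have := sqrt4D_ge2 Y0.
have := @sqr_sqrtr _ (4 + X); have := @sqr_sqrtr _ (4 + Y).
set h := Num.sqrt (4 + X); set k := Num.sqrt (4 + Y) => hk hh k2 h2.
have {}hk : k ^+ 2 = 4 + Y by apply: hk; lra.
have {}hh : h ^+ 2 = 4 + X by apply: hh; lra.
have -> : Y - X = (k - h) * (k + h) by nra.
have h0 : h != 0 by rewrite gt_eqF //; lra.
have -> : expR h + expR h / (2 * h) * ((k - h) * (k + h)) =
  expR h * (1 + (k - h) + (k - h) ^+ 2 / (2 * h)) by field.
have -> : k = h + (k - h) by lra.
rewrite [X in _ <= X]expRD; have -> : h + (k - h) - h = k - h by lra.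
rewrite ler_wpM2l ?expR_ge0 //.
set u := k - h.
have u2 := sqr_ge0 u.
have q : u ^+ 2 / (2 * h) <= u ^+ 2 / 4.
  rewrite ler_pdivrMr; last lra.
  by rewrite mulrAC ler_pdivlMr //; nra.
have hu : - u <= h - 2 by rewrite /u; lra.
have [un|un] := lerP (- 2) u.
  have -> : expR u = expR (u / 2) ^+ 2.
    by rewrite -expRM_natl; congr expR; field.
  have e := expR_ge1Dx (u / 2).
  apply: (@le_trans _ _ ((1 + u / 2) ^+ 2)); first nra.
  by rewrite ler_sqr ?nnegrE ?expR_ge0 //; lra.
have q2 : u ^+ 2 / (2 * h) <= - u / 2.
  rewrite ler_pdivrMr; last lra.
  nra.
have := expR_ge0 u; lra.
Qed.

(** [exp (2/3)] is the 16th power of [exp (1/24) <= 24/23]; four squarings with rounded fractions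
    stay below 2. The constant is the lower bound for [ln (2 / delta)] that later absorbs additive
    constants. *)
Lemma ln2_ge : 2 / 3 <= ln 2 :> R.
Proof.
rewrite -[leLHS]expRK ler_ln ?posrE ?expR_gt0 //.
have e2 : expR (1 / 24) * expR (- (1 / 24)) = 1 :> R by rewrite expRxMexpNx_1.
have e3 := @expR_gt0 R (1 / 24); have e1 := @expR_ge1Dx R (- (1 / 24)).
set z : R := expR (1 / 24) in e2 e3 *.
have z1 : z <= 24 / 23 by nra.
have -> : expR (2 / 3) = z ^+ 16 :> R.
  by rewrite -expRM_natl; congr expR; field.
have z2 : z ^+ 2 <= 49 / 45 by nra.
have z20 := sqr_ge0 z.
have z4 : (z ^+ 2) ^+ 2 <= 51 / 43 by nra.
have z40 := sqr_ge0 (z ^+ 2).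
have z8 : ((z ^+ 2) ^+ 2) ^+ 2 <= 38 / 27 by nra.
have z80 := sqr_ge0 ((z ^+ 2) ^+ 2).
have : (((z ^+ 2) ^+ 2) ^+ 2) ^+ 2 <= 2 by nra.
by rewrite -!exprM.
Qed.

Lemma ln_ge_1Bx_inv x : 0 < x -> 1 - x^-1 <= ln x.
Proof.
move=> x0; have := @le_ln1Dx R (x^-1 - 1).
rewrite addrCA subrr addr0 lnV ?posrE // => h.
have : - 1 < x^-1 - 1 by rewrite -subr_gt0 opprK addrNK invr_gt0.
by move=> /h; lra.
Qed.

Lemma ln1D_le_sqrt x : 0 <= x -> ln (1 + x) <= 2 * Num.sqrt x.
Proof.
move=> x0; have s0 := sqrtr_ge0 x; have s2 := sqr_sqrtr x0.
have := @le_ln1Dx R (Num.sqrt x).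
have -> : - 1 < Num.sqrt x by lra.
move=> /(_ isT) h.
have : ln (1 + x) <= ln ((1 + Num.sqrt x) ^+ 2).
  rewrite ler_ln ?posrE; [nra|lra|].
  by rewrite exprn_gt0 //; lra.
rewrite lnXn; last lra.
by rewrite mulr2n => ?; lra.
Qed.

End ExpBounds.

(** * Independent samples and supermartingales *)

(** Cylinder events of the first [t] samples. They form a pi-system, so Dynkin's theorem extends
    independence to the sigma-algebra they generate, which plays the role of a filtration. *)
Definition past {O : Type} {dU} {U : measurableType dU} (Z : nat -> O -> U)
    (t : nat) : set (set O) :=
  [set B | exists2 A : nat -> set U, (forall i, measurable (A i)) &
     B = \bigcap_(i in [set` iota 0 t]) Z i @^-1` A i].

Section Independence.
Context {R : realType} {dO dU : measure_display}.
Context {O : measurableType dO} {U : measurableType dU}.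
Variables (P : probability O R) (nu : probability U R) (Z : nat -> O -> U).
Hypothesis mZ : forall n, measurable_fun setT (Z n).
Hypothesis indepZ : forall (I : seq nat) (A : nat -> set U), uniq I ->
  (forall i, measurable (A i)) ->
  fine (P (\bigcap_(i in [set` I]) (Z i @^-1` A i)))
    = \prod_(i <- I) fine (P (Z i @^-1` A i)).
Hypothesis lawZ : forall n A, measurable A -> P (Z n @^-1` A) = nu A.

Local Notation Ot t := (g_sigma_algebraType (past Z t)).

Lemma measurable_preim n A : measurable A -> measurable (Z n @^-1` A).
Proof. by move=> mA; rewrite -[X in measurable X]setTI; exact: mZ. Qed.

Lemma measurable_past t B : past Z t B -> measurable B.
Proof.
move=> [A mA ->]; apply: bigcap_measurableType => i _; exact: measurable_preim.
Qed.

Lemma setI_closed_past t : setI_closed (past Z t).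
Proof.
move=> _ _ [A mA ->] [B mB ->]; exists (fun i => A i `&` B i).
  by move=> i; exact: measurableI.
rewrite -bigcapI; apply: eq_bigcapr => i _; by rewrite preimage_setI.
Qed.

Lemma measurable_Ot t B : <<s past Z t >> B -> measurable B.
Proof.
move: B; apply: smallest_sub; last exact: measurable_past.
exact: sigma_algebra_measurable.
Qed.

Lemma indep_setC t (S : set O) (C : set U) : measurable S -> measurable C ->
  P (S `&` Z t @^-1` C) = (P S * nu C)%E ->
  P (~` S `&` Z t @^-1` C) = (P (~` S) * nu C)%E.
Proof.
move=> mS mC hS; have mZC := measurable_preim t mC.
have mSt : measurable (S `&` Z t @^-1` C) by exact: measurableI.
have -> : ~` S `&` Z t @^-1` C = Z t @^-1` C `\` (S `&` Z t @^-1` C).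
  apply/seteqP; split => o /=.
    by case=> h1 h2; split => //; case=> h3 _; apply: h1.
  by case=> h1 h2; split => // h3; apply: h2.
rewrite measureD //; last by rewrite ltey_eq fin_num_measure.
have -> : Z t @^-1` C `&` (S `&` Z t @^-1` C) = S `&` Z t @^-1` C.
  by apply/seteqP; split => o /=; [case=> ? [] | case].
transitivity (nu C - P S * nu C)%E.
  by congr (_ - _)%E; [exact: lawZ | exact: hS].
transitivity ((1%:E - P S) * nu C)%E; last by rewrite probability_setC.
have /fineK <- : P S \is a fin_num by rewrite fin_num_measure.
have /fineK <- : nu C \is a fin_num by rewrite fin_num_measure.
by rewrite -?EFinB -?EFinM -?EFinB -?EFinM; congr EFin; ring.
Qed.

Lemma indep_bigcup t (F : nat -> set O) (C : set U) :
  (forall n, measurable (F n)) -> measurable C -> trivIset setT F ->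
  (forall n, P (F n `&` Z t @^-1` C) = (P (F n) * nu C)%E) ->
  P (\bigcup_k F k `&` Z t @^-1` C) = (P (\bigcup_k F k) * nu C)%E.
Proof.
move=> mF mC tF hF; have mZC := measurable_preim t mC.
rewrite setI_bigcupl measure_bigcup //; last first.
- exact: trivIset_setIr.
- by move=> i _; exact: measurableI.
have fC : (fine (nu C))%:E = nu C by rewrite fineK ?fin_num_measure.
rewrite measure_bigcup // -fC muleC -nneseriesZl //.
apply: eq_eseriesr => i _; rewrite fC muleC; exact: hF.
Qed.

Lemma past_indep t B C : measurable C -> <<s past Z t >> B ->
  P (B `&` Z t @^-1` C) = (P B * nu C)%E.
Proof.
move=> mC; have mZC := measurable_preim t mC.
have finP A : measurable A -> P A \is a fin_num.
  by move=> mA; rewrite fin_num_measure.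
apply: (@dynkin_induction _ (Ot t) (past Z t)
  (fun B => P (B `&` Z t @^-1` C) = (P B * nu C)%E)) => //.
- exact: setI_closed_past.
- by rewrite setTI probability_setT mul1e lawZ.
- move=> _ [A mA ->].
  (* Putting [C] at coordinate [t] makes the intersection a cylinder over [t + 1] samples, to which
     the product formula applies. *)
  pose A' i := if i == t then C else A i.
  have mA' i : measurable (A' i) by rewrite /A'; case: ifP.
  have eqA : \bigcap_(i in [set` iota 0 t]) Z i @^-1` A i =
             \bigcap_(i in [set` iota 0 t]) Z i @^-1` A' i.
    apply: eq_bigcapr => i /=; rewrite mem_iota /= add0n /A' => it.
    by rewrite (ltn_eqF it).
  have eqI : (\bigcap_(i in [set` iota 0 t]) Z i @^-1` A' i) `&` Z t @^-1` C =
     \bigcap_(i in [set` iota 0 t.+1]) Z i @^-1` A' i.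
    have -> : Z t @^-1` C = Z t @^-1` A' t by rewrite /A' eqxx.
    rewrite -addn1 iotaD /= add0n; apply/seteqP; split.
      move=> o [h1 h2] i /=.
      by rewrite mem_cat inE => /orP[hi|/eqP ->] //; exact: h1.
    move=> o h.
    by split => [i /= hi|]; apply: h; rewrite /= mem_cat ?hi // inE eqxx orbT.
  rewrite eqA eqI -(lawZ t mC).
  have m1 : measurable (\bigcap_(i in [set` iota 0 t.+1]) Z i @^-1` A' i).
    by apply: measurable_past; exists A'.
  have m0 : measurable (\bigcap_(i in [set` iota 0 t]) Z i @^-1` A' i).
    by apply: measurable_past; exists A'.
  have fE B' : measurable B' -> P B' = (fine (P B'))%:E by move=> /finP /fineK.
  rewrite (fE _ m1) (fE _ m0) (fE _ mZC) -EFinM; congr EFin.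
  rewrite !indepZ ?iota_uniq // -addn1 iotaD big_cat /= big_seq1 add0n.
  have -> : A' t = C by rewrite /A' eqxx.
  by [].
- by move=> S mS hS; exact: indep_setC (measurable_Ot mS) mC hS.
- move=> F mF tF hF; apply: indep_bigcup => // n; exact: measurable_Ot (mF n).
Qed.

(** The identity into the coarser sigma-algebra: it makes the pair (past, new sample) a random
    variable whose law can be compared with a product measure. *)
Let idO t : O -> Ot t := fun o => o.

Lemma measurable_idO t : measurable_fun setT (@idO t).
Proof. by move=> _ B mB; rewrite setTI; exact: measurable_Ot mB. Qed.

Lemma measurable_past_proj t i : (i < t)%N -> @measurable_fun _ _ (Ot t) U setT (Z i).
Proof.
move=> it _ B mB; rewrite setTI; apply: sub_sigma_algebra.
exists (fun l => if l == i then B else setT); first by move=> l; case: ifP.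
apply/seteqP; split => o /=.
  by move=> Bo l _; rewrite /preimage /=; case: eqP => // ->.
by move=> /(_ i) /=; rewrite mem_iota it eqxx => /(_ isT).
Qed.

(** Independence identifies the law of (past, [Z t]) with a product measure, and Tonelli integrates
    the new sample first. This replaces conditional expectation. *)
Lemma ge0_integral_past t (F : Ot t * U -> \bar R) :
  @measurable_fun _ _ (Ot t * U)%type (\bar R) setT F -> (forall x, 0 <= F x)%E ->
  (\int[P]_o F (o, Z t o) = \int[P]_o \int[nu]_u F (o, u))%E.
Proof.
move=> mF F0.
pose i0 : {mfun O >-> Ot t} :=
  HB.pack (@idO t) (isMeasurableFun.Build _ _ _ _ _ (@measurable_idO t)).
pose j (o : O) : Ot t * U := (o, Z t o).
have mj : measurable_fun setT j.
  by apply: measurable_fun_pair; [exact: measurable_idO | exact: mZ].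
pose j0 : {mfun O >-> (Ot t * U)%type} :=
  HB.pack j (isMeasurableFun.Build _ _ _ _ _ mj).
transitivity (\int[distribution P j0]_x F x)%E.
  by rewrite ge0_integral_distribution.
transitivity (\int[distribution P i0 \x nu]_x F x)%E.
  apply: eq_measure_integral => A mA _; apply/esym.
  apply: product_measure_unique => // B C mB mC.
  rewrite /distribution /pushforward /=.
  rewrite -(past_indep mC mB); congr (P _).
rewrite fubini_tonelli1 // ge0_integral_distribution //.
- exact: measurable_fun_fubini_tonelli_F.
- by move=> o; apply: integral_ge0 => u _.
Qed.

(** A supermartingale argument that integrates out the last sample first. [H j o u] is [F j.+1] with
    the new sample [u] separated from the past [o]; its measurability over [Ot j * U] expresses
    adaptedness. *)
Lemma iter_expectation_le (T : nat) (F : nat -> O -> R) (H : nat -> O -> U -> R)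
    (b : nat -> R) (c : R) :
  (forall j, (j < T)%N -> @measurable_fun _ _ (Ot j * U)%type R setT (fun x => H j x.1 x.2)) ->
  (forall j, (j <= T)%N -> measurable_fun setT (F j)) ->
  (forall j o, (j < T)%N -> F j.+1 o = H j o (Z j o)) ->
  (forall j o u, 0 <= H j o u) -> (forall j o, 0 <= F j o) -> (forall j, 0 <= b j) ->
  (forall j o, (j < T)%N -> (\int[nu]_u (H j o u)%:E <= (b j * F j o)%:E)%E) ->
  (forall o, F 0 o <= c) ->
  (\int[P]_o (F T o)%:E <= (c * \prod_(j < T) b j)%:E)%E.
Proof.
elim: T => [|T IH] mH mF FH H0 F0 b0 hH Fc.
  rewrite big_ord0 mulr1; apply: (@le_trans _ _ (\int[P]_o c%:E)%E).
    apply: ge0_le_integral => //.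
    - by move=> o _; rewrite lee_fin.
    - by apply/measurable_EFinP; exact: mF.
    - by move=> o _; rewrite lee_fin.
  rewrite integral_cst // [X in (_ * X)%E](_ : _ = 1%E) ?mule1 //.
  exact: probability_setT.
have -> : (\int[P]_o (F T.+1 o)%:E = \int[P]_o \int[nu]_u (H T o u)%:E)%E.
  under eq_integral => o _ do rewrite FH //.
  rewrite (@ge0_integral_past T (fun x => (H T x.1 x.2)%:E)) //.
  - by apply/measurable_EFinP; exact: mH.
  - by move=> x; rewrite lee_fin.
apply: (@le_trans _ _ (\int[P]_o ((b T)%:E * (F T o)%:E))%E).
  apply: ge0_le_integral => //.
  - by move=> o _; apply: integral_ge0 => u _; rewrite lee_fin.
  - have := @measurable_fun_fubini_tonelli_F _ _ (Ot T) U R nu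
      (fun x => (H T x.1 x.2)%:E).
    rewrite /fubini_F /= => hm; move=> _ B mB; rewrite setTI.
    have := hm _ _ measurableT B mB; rewrite setTI => hm'.
    apply: (@measurable_Ot T); apply: hm'.
    + by apply/measurable_EFinP; exact: mH.
    + by move=> x; rewrite lee_fin.
  - by apply/measurable_EFinP; apply: measurable_funM => //; exact: mF.
  - by move=> o _; rewrite -EFinM; exact: hH.
rewrite ge0_integralZl ?lee_fin //; last first.
- by move=> o _; rewrite lee_fin.
- by apply/measurable_EFinP; exact: mF.
rewrite big_ord_recr /= mulrA mulrC EFinM lee_wpmul2l ?lee_fin //.
apply: IH => //.
- by move=> j jT; exact: mH (ltnW jT).
- by move=> j jT; exact: mF (leqW jT).
- by move=> j o jT; exact: FH (ltnW jT).
- by move=> j o jT; exact: hH (ltnW jT).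
Qed.

End Independence.

Lemma prod_expR {R : realType} (T : nat) (f : nat -> R) :
  \prod_(i < T) expR (f i) = expR (\sum_(i < T) f i).
Proof.
elim: T => [|T IH]; first by rewrite !big_ord0 expR0.
by rewrite !big_ord_recr /= IH expRD.
Qed.

Lemma markov_tail {R : realType} {d} {O : measurableType d} (P : probability O R)
    (F : O -> R) (c M : R) :
  measurable_fun setT F -> (forall o, 0 <= F o) -> 0 < c ->
  (\int[P]_o (F o)%:E <= M%:E)%E ->
  measurable [set o | c < F o] /\ (P [set o | (c < F o)%R] <= (M / c)%:E)%E.
Proof.
move=> mF F0 c0 hM.
have mA : measurable [set o | c < F o].
  rewrite -[X in measurable X]setTI.
  have := mF measurableT `]c, +oo[%classic (measurable_itv _).
  by congr measurable; apply/seteqP; split => o /=; rewrite in_itv /= andbT.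
split => //.
have h : (c%:E * P [set o | (c < F o)%R] <= M%:E)%E.
  apply: (le_trans _ hM).
  rewrite -[X in (_ * P X)%E]setIT -integral_indic // -ge0_integralZl //; last first.
  - exact: ltW.
  - by apply/measurable_EFinP.
  apply: ge0_le_integral => //.
  - by move=> o _; rewrite mule_ge0 // lee_fin ltW.
  - by apply/measurable_EFinP; apply: measurable_funM.
  - exact/measurable_EFinP.
  - move=> o _; rewrite -EFinM lee_fin indicE; case: (boolP (o \in _)) => [|_].
      by rewrite inE /= mulr1 => /ltW.
    by rewrite mulr0.
by rewrite EFinM muleC lee_pdivlMl.
Qed.

(** * Exponential moments of one step *)

Section Euclid.
Context {R : realType} {n : nat}.
Implicit Types u v : 'I_n -> R.

Lemma sqr_sum_mul_le u v :
  (\sum_i u i * v i) ^+ 2 <= (\sum_i u i ^+ 2) * (\sum_i v i ^+ 2).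
Proof.
set A := \sum_i u i ^+ 2; set B := \sum_i u i * v i; set C := \sum_i v i ^+ 2.
have A0 : 0 <= A by apply: sumr_ge0 => i _; exact: sqr_ge0.
have C0 : 0 <= C by apply: sumr_ge0 => i _; exact: sqr_ge0.
have h x y : 0 <= x ^+ 2 * A - 2 * x * y * B + y ^+ 2 * C.
  have -> : x ^+ 2 * A - 2 * x * y * B + y ^+ 2 * C = \sum_i (x * u i - y * v i) ^+ 2.
    rewrite !mulr_sumr -sumrB -big_split /=; apply: eq_bigr => i _; ring.
  by apply: sumr_ge0 => i _; exact: sqr_ge0.
have [C1|C1] := eqVneq C 0.
  have [B0|B0] := eqVneq B 0; first by rewrite B0 C1 expr0n mulr0.
  (* If [C = 0] the form is affine in [y], and this [y] gives it the value -1. *)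
  have := h 1 ((A + 1) / (2 * B)); rewrite C1.
  have -> : 1 ^+ 2 * A - 2 * 1 * ((A + 1) / (2 * B)) * B + ((A + 1) / (2 * B)) ^+ 2 * 0 = - 1.
    by field.
  lra.
have Cp : 0 < C by rewrite lt0r C1.
have := h C B.
have -> : C ^+ 2 * A - 2 * C * B * B + B ^+ 2 * C = C * (A * C - B ^+ 2) by ring.
by rewrite pmulr_rge0 // subr_ge0.
Qed.

Definition enorm u := Num.sqrt (\sum_i u i ^+ 2).

Lemma sqr_enorm u : enorm u ^+ 2 = \sum_i u i ^+ 2.
Proof. by rewrite sqr_sqrtr // sumr_ge0 // => i _; exact: sqr_ge0. Qed.

Lemma enorm_ge0 u : 0 <= enorm u. Proof. exact: sqrtr_ge0. Qed.

Lemma dot_le_enorm u v : `|\sum_i u i * v i| <= enorm u * enorm v.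
Proof.
rewrite -ler_sqr ?nnegrE ?normr_ge0 ?mulr_ge0 ?enorm_ge0 //.
by rewrite real_normK ?num_real // exprMn !sqr_enorm sqr_sum_mul_le.
Qed.

Lemma enormD u v : enorm (fun i => u i + v i) <= enorm u + enorm v.
Proof.
rewrite -ler_sqr ?nnegrE ?addr_ge0 ?enorm_ge0 // sqr_enorm.
have -> : \sum_i (u i + v i) ^+ 2 =
   \sum_i u i ^+ 2 + 2 * (\sum_i u i * v i) + \sum_i v i ^+ 2.
  by rewrite mulr_sumr -!big_split /=; apply: eq_bigr => i _; ring.
rewrite -!sqr_enorm; have := ler_norm (\sum_i u i * v i); have := dot_le_enorm u v.
nra.
Qed.

Lemma enormZ c u : 0 <= c -> enorm (fun i => c * u i) = c * enorm u.
Proof.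
move=> c0; rewrite /enorm; under eq_bigr do rewrite exprMn.
by rewrite -mulr_sumr sqrtrM ?sqr_ge0 // sqrtr_sqr ger0_norm.
Qed.

Lemma ler_enorm u v : (forall i, `|u i| <= `|v i|) -> enorm u <= enorm v.
Proof.
move=> h; rewrite /enorm ler_wsqrtr // ler_sum // => i _.
by rewrite -real_normK ?num_real // -[leRHS]real_normK ?num_real // ler_sqr ?nnegrE.
Qed.

Lemma enorm_le u c : 0 <= c -> \sum_i u i ^+ 2 <= c ^+ 2 -> enorm u <= c.
Proof.
by move=> c0 h; rewrite -ler_sqr ?nnegrE ?enorm_ge0 // sqr_enorm.
Qed.

End Euclid.

Section BoundedExpectation.
Context {R : realType} {dU : measure_display} {U : measurableType dU}.
Variable nu : probability U R.
Implicit Types f g h : U -> R.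

(** An algebra of functions that are all integrable for a probability, so that linearity of the
    expectation needs no separate integrability proofs. *)
Definition bmeas f := measurable_fun setT f /\ exists M, forall u, `|f u| <= M.

Lemma bmeas_cst c : bmeas (fun=> c).
Proof. by split => //; exists `|c|. Qed.

Lemma bmeasD f g : bmeas f -> bmeas g -> bmeas (fun u => f u + g u).
Proof.
move=> [mf [M hM]] [mg [N hN]]; split; first exact: measurable_funD.
by exists (M + N) => u; rewrite (le_trans (ler_normD _ _)) // lerD.
Qed.

Lemma bmeasM f g : bmeas f -> bmeas g -> bmeas (fun u => f u * g u).
Proof.
move=> [mf [M hM]] [mg [N hN]]; split; first exact: measurable_funM.
by exists (M * N) => u; rewrite normrM ler_pM.
Qed.

Lemma bmeasZ c f : bmeas f -> bmeas (fun u => c * f u).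
Proof. by apply: bmeasM; exact: bmeas_cst. Qed.

Lemma bmeasB f g : bmeas f -> bmeas g -> bmeas (fun u => f u - g u).
Proof.
move=> bf bg; have := bmeasD bf (bmeasZ (-1) bg).
by congr bmeas; apply/funext => u; rewrite mulN1r.
Qed.

Lemma bmeasX f k : bmeas f -> bmeas (fun u => f u ^+ k).
Proof.
move=> bf; elim: k => [|k IH].
  by have := bmeas_cst 1; congr bmeas; apply/funext => u; rewrite expr0.
by have := bmeasM bf IH; congr bmeas; apply/funext => u; rewrite exprS.
Qed.

Lemma bmeas_sum n (f : 'I_n -> U -> R) : (forall i, bmeas (f i)) ->
  bmeas (fun u => \sum_i f i u).
Proof.
move=> bf; elim: n f bf => [|n IH] f bf.
  by have := bmeas_cst 0; congr bmeas; apply/funext => u; rewrite big_ord0.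
have := bmeasD (IH (fun i => f (widen_ord (leqnSn n) i)) (fun i => bf _)) (bf ord_max).
by congr bmeas; apply/funext => u; rewrite big_ord_recr.
Qed.

Lemma bmeas_integrable f : bmeas f -> nu.-integrable setT (EFin \o f).
Proof.
move=> [mf [M hM]]; apply: measurable_bounded_integrable => //.
  by rewrite (le_lt_trans (probability_le1 _ _)) // ltry.
exists M; split; first exact: num_real.
by move=> x Mx y _ /=; rewrite (le_trans (hM y)) // ltW.
Qed.

Local Notation E f := (\int[nu]_u (f u)).

Lemma expect_cst c : E (fun=> c) = c.
Proof.
rewrite Rintegral_cst // [X in fine X](_ : _ = 1%E) ?mulr1 //.
exact: probability_setT.
Qed.

Lemma expectD f g : bmeas f -> bmeas g -> E (fun u => f u + g u) = E f + E g.
Proof. by move=> bf bg; rewrite RintegralD //; exact: bmeas_integrable. Qed.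

Lemma expectB f g : bmeas f -> bmeas g -> E (fun u => f u - g u) = E f - E g.
Proof. by move=> bf bg; rewrite RintegralB //; exact: bmeas_integrable. Qed.

Lemma expectZ c f : bmeas f -> E (fun u => c * f u) = c * E f.
Proof. by move=> bf; rewrite RintegralZl //; exact: bmeas_integrable. Qed.

Lemma expect_sum n (f : 'I_n -> U -> R) : (forall i, bmeas (f i)) ->
  E (fun u => \sum_i f i u) = \sum_i E (f i).
Proof.
move=> bf; elim: n f bf => [|n IH] f bf.
  rewrite big_ord0 -[RHS](expect_cst 0); apply: eq_Rintegral => u _.
  by rewrite big_ord0.
rewrite big_ord_recr /= -IH // -expectD //; last exact: bmeas_sum.
by apply: eq_Rintegral => u _; rewrite big_ord_recr.
Qed.

Lemma ler_expect f g : bmeas f -> bmeas g -> (forall u, f u <= g u) -> E f <= E g.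
Proof.
move=> bf bg h; apply: le_Rintegral => //; exact: bmeas_integrable.
Qed.

Lemma expect_ge0 f : (forall u, 0 <= f u) -> 0 <= E f.
Proof. by move=> h; apply: Rintegral_ge0. Qed.

Lemma integral_le_expect h g : measurable_fun setT h -> (forall u, 0 <= h u) ->
  bmeas g -> (forall u, h u <= g u) ->
  (\int[nu]_u (h u)%:E <= (E g)%:E)%E.
Proof.
move=> mh h0 bg hg; rewrite /Rintegral fineK; last first.
  by apply: integrable_fin_num => //; exact: bmeas_integrable.
apply: ge0_le_integral => //.
- by move=> u _; rewrite lee_fin.
- exact/measurable_EFinP.
- by case: bg => mg _; exact/measurable_EFinP.
- by move=> u _; rewrite lee_fin.
Qed.

Context {n : nat}.
Implicit Types (x : 'I_n -> R) (X : U -> 'I_n -> R).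

Lemma expect_dot x X : (forall i, bmeas (X ^~ i)) -> (forall i, E (X ^~ i) = 0) ->
  E (fun u => \sum_i x i * X u i) = 0.
Proof.
move=> bX X0; rewrite expect_sum; last by move=> i; exact: bmeasZ.
by apply: big1 => i _; rewrite expectZ // X0 mulr0.
Qed.

Lemma bmeas_sqsum X : (forall i, bmeas (X ^~ i)) -> bmeas (fun u => \sum_i X u i ^+ 2).
Proof. by move=> bX; apply: bmeas_sum => i; exact: (bmeasX 2 (bX i)). Qed.

Lemma bmeas_dot x X : (forall i, bmeas (X ^~ i)) -> bmeas (fun u => \sum_i x i * X u i).
Proof. by move=> bX; apply: bmeas_sum => i; exact: bmeasZ. Qed.

(* [k] absorbs the square of the step, which enters with weight 1 or 2. *)
Lemma bernstein_step (k : R) x X (Y : U -> R) :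
  1 <= k -> (forall i, bmeas (X ^~ i)) -> (forall i, E (X ^~ i) = 0) ->
  measurable_fun setT Y -> (forall u, 0 <= Y u) ->
  (forall u, k * \sum_i X u i ^+ 2 <= 1) ->
  (forall u, Y u <= \sum_i x i ^+ 2 + 2 * (\sum_i x i * X u i) + k * \sum_i X u i ^+ 2) ->
  (\int[nu]_u (expR (Num.sqrt (4 + Y u)))%:E <=
   (expR (Num.sqrt (4 + \sum_i x i ^+ 2)) *
     (1 + 2 * k * E (fun u => \sum_i X u i ^+ 2)))%:E)%E.
Proof.
move=> k1 bX X0 mY Y0 Xk hY; set N := \sum_i x i ^+ 2; set h := Num.sqrt (4 + N).
have N0 : 0 <= N by apply: sumr_ge0 => i _; exact: sqr_ge0.
pose S u := \sum_i X u i ^+ 2; pose p u := \sum_i x i * X u i.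
have S0 u : 0 <= S u by apply: sumr_ge0 => i _; exact: sqr_ge0.
have bS : bmeas S by exact: bmeas_sqsum.
have bp : bmeas p by exact: bmeas_dot.
pose g u := expR h * (1 + (h^-1 * p u + (2 * k) * S u)).
have bg : bmeas g.
  apply: bmeasZ; apply: bmeasD; first exact: bmeas_cst.
  by apply: bmeasD; exact: bmeasZ.
have -> : expR h * (1 + 2 * k * E (fun u => \sum_i X u i ^+ 2)) = E g.
  have Ep : E p = 0 by exact: expect_dot.
  rewrite /g expectZ; last first.
    apply: bmeasD; first exact: bmeas_cst.
    by apply: bmeasD; exact: bmeasZ.
  rewrite expectD; [|exact: bmeas_cst|by apply: bmeasD; exact: bmeasZ].
  rewrite expect_cst expectD; [|exact: bmeasZ|exact: bmeasZ].
  by rewrite !expectZ // Ep mulr0 add0r.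
apply: integral_le_expect => //.
  apply: measurableT_comp => //; apply: (measurableT_comp (continuous_measurable_fun _)).
    exact: sqrt_continuous.
  exact: measurable_funD.
move=> u; have kS0 : 0 <= k * S u by rewrite mulr_ge0 //; lra.
(* The increment size is taken pointwise in [u], so that its expectation is a variance and not a
   worst case. *)
have D2 : Num.sqrt (k * S u) ^+ 2 = k * S u by rewrite sqr_sqrtr.
apply: le_trans (@expR_sqrt_bernstein R N (Y u) (p u) (Num.sqrt (k * S u)) _ _ _ _ _) _ => //.
- rewrite sqrtr_ge0 /= -(@ler_pXn2r _ 2) ?nnegrE ?sqrtr_ge0 // D2 expr1n; exact: Xk.
- rewrite D2 (le_trans (sqr_sum_mul_le _ _)) // -/N -/(S u) ler_wpM2l //.
  by have := S0 u; nra.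
- by rewrite D2; exact: hY.
rewrite D2 /g ler_wpM2l ?expR_ge0 // [p u / _]mulrC; lra.
Qed.

(** There is no size restriction on [c]: for the multiplicative noise it is a function of the past,
    and the resulting factor is compensated instead of being bounded. *)
Lemma azuma_step (c : R) x X (Y : U -> R) :
  0 <= c -> (forall i, bmeas (X ^~ i)) -> (forall i, E (X ^~ i) = 0) ->
  measurable_fun setT Y -> (forall u, 0 <= Y u) ->
  (forall u, \sum_i X u i ^+ 2 <= c ^+ 2) ->
  (forall u, Y u <= \sum_i x i ^+ 2 + 2 * (\sum_i x i * X u i) + \sum_i X u i ^+ 2) ->
  (\int[nu]_u (expR (Num.sqrt (4 + Y u)))%:E <=
   (expR (Num.sqrt (4 + \sum_i x i ^+ 2)) * expR (5 / 4 * c ^+ 2))%:E)%E.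
Proof.
move=> c0 bX X0 mY Y0 Xc hY; set N := \sum_i x i ^+ 2; set h := Num.sqrt (4 + N).
have N0 : 0 <= N by apply: sumr_ge0 => i _; exact: sqr_ge0.
pose p u := \sum_i x i * X u i.
have bp : bmeas p by exact: bmeas_dot.
pose g u := (expR h * expR (c ^+ 2 / 4)) * (h^-1 * p u + expR (c ^+ 2)).
have bg : bmeas g.
  by apply: bmeasZ; apply: bmeasD; [exact: bmeasZ|exact: bmeas_cst].
have -> : expR h * expR (5 / 4 * c ^+ 2) = E g.
  have Ep : E p = 0 by exact: expect_dot.
  rewrite /g expectZ; last by apply: bmeasD; [exact: bmeasZ|exact: bmeas_cst].
  rewrite expectD; [|exact: bmeasZ|exact: bmeas_cst].
  rewrite expect_cst expectZ // Ep mulr0 add0r -!expRD; congr expR.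
  by field.
apply: integral_le_expect => //.
  apply: measurableT_comp => //; apply: (measurableT_comp (continuous_measurable_fun _)).
    exact: sqrt_continuous.
  exact: measurable_funD.
move=> u.
apply: le_trans (@expR_sqrt_azuma R N (Y u) (p u) c _ _ _ _ _) _ => //.
- by rewrite (le_trans (sqr_sum_mul_le _ _)) // ler_wpM2l.
- by rewrite (le_trans (hY u)) // lerD2l.
by rewrite /g -mulrA [p u / _]mulrC.
Qed.

End BoundedExpectation.

(** * The stochastic gradient *)

Section Centering.
Context {R : realType} {dU : measure_display} {U : measurableType dU}.
Variable nu : probability U R.
Local Notation E f := (\int[nu]_u (f u)).

Lemma sqr_expect_le (f : U -> R) : bmeas f -> (E f) ^+ 2 <= E (fun u => f u ^+ 2).
Proof.
move=> bf; have bf2 := bmeasX 2 bf; set e := E f.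
have : 0 <= E (fun u => (f u - e) ^+ 2) by apply: expect_ge0 => u; exact: sqr_ge0.
have -> : E (fun u => (f u - e) ^+ 2) = E (fun u => (f u ^+ 2 + (- 2 * e) * f u) + e ^+ 2).
  by apply: eq_Rintegral => u _; ring.
rewrite expectD; [|by apply: bmeasD => //; exact: bmeasZ|exact: bmeas_cst].
rewrite expect_cst expectD // ?expectZ //; last exact: bmeasZ.
by rewrite -/e; lra.
Qed.

Lemma expect_sqr_center_le (f : U -> R) : bmeas f ->
  E (fun u => (f u - E f) ^+ 2) <= E (fun u => f u ^+ 2).
Proof.
move=> bf; have bf2 := bmeasX 2 bf; set e := E f.
have -> : E (fun u => (f u - e) ^+ 2) = E (fun u => (f u ^+ 2 + (- 2 * e) * f u) + e ^+ 2).
  by apply: eq_Rintegral => u _; ring.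
rewrite expectD; [|by apply: bmeasD => //; exact: bmeasZ|exact: bmeas_cst].
rewrite expect_cst expectD // ?expectZ //; last exact: bmeasZ.
by rewrite -/e; have := sqr_ge0 e; lra.
Qed.

Context {n : nat}.
Variable X : U -> 'I_n -> R.
Hypothesis bX : forall i, bmeas (X ^~ i).

Lemma expect_sqsum_center_le :
  E (fun u => \sum_i (X u i - E (X ^~ i)) ^+ 2) <= E (fun u => \sum_i X u i ^+ 2).
Proof.
rewrite !expect_sum; first by apply: ler_sum => i _; exact: expect_sqr_center_le.
- by move=> i; exact: bmeasX.
- by move=> i; apply: bmeasX; apply: bmeasB => //; exact: bmeas_cst.
Qed.

Lemma sqsum_expect_le c : (forall u, \sum_i X u i ^+ 2 <= c) ->
  \sum_i (E (X ^~ i)) ^+ 2 <= c.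
Proof.
move=> hc; apply: (@le_trans _ _ (E (fun u => \sum_i X u i ^+ 2))).
  rewrite expect_sum; first by apply: ler_sum => i _; exact: sqr_expect_le.
  by move=> i; exact: bmeasX.
rewrite -[leRHS](expect_cst nu c); apply: ler_expect => //.
- exact: bmeas_sqsum.
- exact: bmeas_cst.
Qed.

(** From [(x - e)^2 <= 2 x^2 + 2 e^2] and Jensen for the mean; this is the origin of the factors 4
    in the increment bounds. *)
Lemma sqsum_center_le c : (forall u, \sum_i X u i ^+ 2 <= c) ->
  forall u, \sum_i (X u i - E (X ^~ i)) ^+ 2 <= 4 * c.
Proof.
move=> hc u; apply: (@le_trans _ _ (\sum_i (2 * X u i ^+ 2 + 2 * E (X ^~ i) ^+ 2))).
  apply: ler_sum => i _; have := sqr_ge0 (X u i + E (X ^~ i)).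
  move: (X u i) (E (X ^~ i)) => x e; nra.
rewrite big_split /= -!mulr_sumr; have := hc u; have := sqsum_expect_le hc; lra.
Qed.

Lemma expect_center i : E (fun u => X u i - E (X ^~ i)) = 0.
Proof. by rewrite expectB ?expect_cst ?subrr //; exact: bmeas_cst. Qed.

Lemma bmeas_center i : bmeas (fun u => X u i - E (X ^~ i)).
Proof. by apply: bmeasB => //; exact: bmeas_cst. Qed.

End Centering.

Section Noise.
Context {R : realType} {n : nat} {dU : measure_display} {U : measurableType dU}.
Variable nu : probability U R.
Variables (phi1 phi2 : 'I_n -> U -> R) (alpha C : R).
Local Notation E f := (\int[nu]_u (f u)).
Implicit Types (v s w : 'I_n -> R) (u : U).

(* The stochastic gradient in feature coordinates. *)
Definition zeta v u k : R :=
  (1 - alpha) * (\sum_i v i * phi1 i u) * phi1 k u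
  + (alpha * (\sum_i v i * phi2 i u) - 1) * phi2 k u.

Definition zlin s u k : R :=
  (1 - alpha) * (\sum_i s i * phi1 i u) * phi1 k u
  + alpha * (\sum_i s i * phi2 i u) * phi2 k u.

Definition xi v u k : R := zeta v u k - E (zeta v ^~ k).

Hypothesis alpha01 : 0 < alpha < 1.
Hypothesis C0 : 0 < C.
Hypothesis mphi1 : forall i, measurable_fun setT (phi1 i).
Hypothesis mphi2 : forall i, measurable_fun setT (phi2 i).
Hypothesis phi1C : forall u, \sum_i phi1 i u ^+ 2 <= C ^+ 2.
Hypothesis phi2C : forall u, \sum_i phi2 i u ^+ 2 <= C ^+ 2.

Lemma coord_bound (f : 'I_n -> R) : \sum_i f i ^+ 2 <= C ^+ 2 -> forall i, `|f i| <= C.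
Proof.
move=> hf i; rewrite -ler_sqr ?nnegrE ?normr_ge0 ?(ltW C0) // real_normK ?num_real //.
apply: (le_trans _ hf); rewrite (bigD1 i) //= lerDl sumr_ge0 // => j _; exact: sqr_ge0.
Qed.

Lemma bphi1 i : bmeas (phi1 i).
Proof. by split => //; exists C => u; exact: coord_bound (phi1C u) i. Qed.

Lemma bphi2 i : bmeas (phi2 i).
Proof. by split => //; exists C => u; exact: coord_bound (phi2C u) i. Qed.

Lemma bmeas_zeta v k : bmeas (zeta v ^~ k).
Proof.
apply: bmeasD; apply: bmeasM; try exact: bphi1; try exact: bphi2.
  by apply: bmeasZ; apply: bmeas_sum => i; apply: bmeasZ; exact: bphi1.
apply: bmeasB; last exact: bmeas_cst.
by apply: bmeasZ; apply: bmeas_sum => i; apply: bmeasZ; exact: bphi2.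
Qed.

Lemma zetaD v s u k : zeta (fun i => v i + s i) u k = zeta v u k + zlin s u k.
Proof.
rewrite /zeta /zlin.
have -> : \sum_i (v i + s i) * phi1 i u = \sum_i v i * phi1 i u + \sum_i s i * phi1 i u.
  by rewrite -big_split /=; apply: eq_bigr => i _; ring.
have -> : \sum_i (v i + s i) * phi2 i u = \sum_i v i * phi2 i u + \sum_i s i * phi2 i u.
  by rewrite -big_split /=; apply: eq_bigr => i _; ring.
ring.
Qed.

Lemma bmeas_zlin s k : bmeas (zlin s ^~ k).
Proof.
have := bmeasB (bmeas_zeta s k) (bmeas_zeta (fun=> 0) k).
congr bmeas; apply/funext => u.
have -> : zeta s u k = zeta (fun i => 0 + s i) u k by congr (zeta _ u k); apply/funext => i; rewrite add0r.
by rewrite zetaD addrAC subrr add0r.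
Qed.

(** Convexity of the square with weights [1 - alpha] and [alpha], in each coordinate; no cross term
    between the two samples survives. *)
Lemma sqsum_conv_le w (x y : R) u :
  \sum_k (w k * ((1 - alpha) * x * phi1 k u + alpha * y * phi2 k u)) ^+ 2 <=
  (1 - alpha) * (x ^+ 2 * \sum_k (w k * phi1 k u) ^+ 2)
  + alpha * (y ^+ 2 * \sum_k (w k * phi2 k u) ^+ 2).
Proof.
have /andP[a0 a1] := alpha01.
rewrite !mulr_sumr -big_split /=; apply: ler_sum => k _.
set p := w k * phi1 k u; set q := w k * phi2 k u.
have -> : w k * ((1 - alpha) * x * phi1 k u + alpha * y * phi2 k u) =
  (1 - alpha) * (x * p) + alpha * (y * q) by rewrite /p /q; ring.
rewrite -!exprMn; set X := x * p; set Y := y * q.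
have : 0 <= (1 - alpha) * alpha * (X - Y) ^+ 2.
  by apply: mulr_ge0; [apply: mulr_ge0; lra | exact: sqr_ge0].
nra.
Qed.

(** Writing [alpha * y - 1] as [alpha * (y - 1 / alpha)] turns the gradient into a convex
    combination of the contributions of the two samples. *)
Lemma zeta_conv w v u :
  \sum_k (w k * zeta v u k) ^+ 2 <=
  (1 - alpha) * ((\sum_i v i * phi1 i u) ^+ 2 * \sum_k (w k * phi1 k u) ^+ 2)
  + alpha * ((\sum_i v i * phi2 i u - alpha^-1) ^+ 2 * \sum_k (w k * phi2 k u) ^+ 2).
Proof.
have /andP[a0 a1] := alpha01.
apply: (le_trans _ (sqsum_conv_le _ _ _ _)); rewrite le_eqVlt; apply/orP; left; apply/eqP.
apply: eq_bigr => k _; congr (_ ^+ 2); congr (_ * _); rewrite /zeta; field.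
by rewrite gt_eqF.
Qed.

Lemma wsqsum_le (f : 'I_n -> R) w q : \sum_i f i ^+ 2 <= C ^+ 2 ->
  0 <= q -> (forall k, w k ^+ 2 <= q) -> \sum_k (w k * f k) ^+ 2 <= q * C ^+ 2.
Proof.
move=> hf q0 hw; apply: (@le_trans _ _ (\sum_k q * f k ^+ 2)).
  by apply: ler_sum => k _; rewrite exprMn ler_wpM2r ?sqr_ge0.
by rewrite -mulr_sumr ler_wpM2l.
Qed.

Lemma sqr_dot_le (f : 'I_n -> R) v : \sum_i f i ^+ 2 <= C ^+ 2 ->
  (\sum_i v i * f i) ^+ 2 <= C ^+ 2 * \sum_i v i ^+ 2.
Proof.
move=> hf; apply: (le_trans (sqr_sum_mul_le _ _)); rewrite mulrC ler_wpM2r //.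
by apply: sumr_ge0 => i _; exact: sqr_ge0.
Qed.

Lemma zlin_sqsum_le w q s u : 0 <= q -> (forall k, w k ^+ 2 <= q) ->
  \sum_k (w k * zlin s u k) ^+ 2 <= q * C ^+ 4 * \sum_i s i ^+ 2.
Proof.
move=> q0 hw; have /andP[a0 a1] := alpha01.
apply: (le_trans (sqsum_conv_le _ _ _ _)).
have h1 := wsqsum_le (phi1C u) q0 hw; have h2 := wsqsum_le (phi2C u) q0 hw.
have k1 := sqr_dot_le s (phi1C u); have k2 := sqr_dot_le s (phi2C u).
have l1 : (\sum_i s i * phi1 i u) ^+ 2 * (\sum_k (w k * phi1 k u) ^+ 2) <=
  q * C ^+ 4 * \sum_i s i ^+ 2.
  have -> : q * C ^+ 4 * \sum_i s i ^+ 2 = (C ^+ 2 * \sum_i s i ^+ 2) * (q * C ^+ 2) by ring.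
  by apply: ler_pM => //; [exact: sqr_ge0|apply: sumr_ge0 => k _; exact: sqr_ge0].
have l2 : (\sum_i s i * phi2 i u) ^+ 2 * (\sum_k (w k * phi2 k u) ^+ 2) <=
  q * C ^+ 4 * \sum_i s i ^+ 2.
  have -> : q * C ^+ 4 * \sum_i s i ^+ 2 = (C ^+ 2 * \sum_i s i ^+ 2) * (q * C ^+ 2) by ring.
  by apply: ler_pM => //; [exact: sqr_ge0|apply: sumr_ge0 => k _; exact: sqr_ge0].
nra.
Qed.

(** [zlin] applies a positive operator of norm at most [C^2], a convex combination of two rank-one
    operators, and such an [A] satisfies [A^2 <= C^2 A]. *)
Lemma zlin_sqsum_dot_le s u :
  \sum_k zlin s u k ^+ 2 <= C ^+ 2 * \sum_k s k * zlin s u k.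
Proof.
have /andP[a0 a1] := alpha01.
have := sqsum_conv_le (fun=> 1) (\sum_i s i * phi1 i u) (\sum_i s i * phi2 i u) u.
under eq_bigr do rewrite mul1r.
under [\sum_(k < n) (1 * phi1 k u) ^+ 2]eq_bigr do rewrite mul1r.
under [\sum_(k < n) (1 * phi2 k u) ^+ 2]eq_bigr do rewrite mul1r.
set x := \sum_i s i * phi1 i u; set y := \sum_i s i * phi2 i u => h.
apply: (le_trans h).
have -> : \sum_k s k * zlin s u k = (1 - alpha) * x ^+ 2 + alpha * y ^+ 2.
  rewrite !expr2 {2}/x {2}/y !mulr_sumr -big_split /=; apply: eq_bigr => k _.
  rewrite /zlin -/x -/y; ring.
have := ler_wpM2l (sqr_ge0 x) (phi1C u); have := ler_wpM2l (sqr_ge0 y) (phi2C u).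
set p := x ^+ 2 * _; set q := y ^+ 2 * _; nra.
Qed.

(** Both evaluations are at most [N], so the coefficients are at most [(1 - alpha) N] and
    [alpha N + 1]; they add up to [N + 1] without a factor [1 / alpha]. *)
Lemma zeta_sqsum_le w q v u N : 0 <= q -> (forall k, w k ^+ 2 <= q) ->
  0 <= N -> C * enorm v <= N ->
  \sum_k (w k * zeta v u k) ^+ 2 <= q * (C * (N + 1)) ^+ 2.
Proof.
move=> q0 hw N0 hN; have /andP[a0 a1] := alpha01.
have dN f : \sum_i f i ^+ 2 <= C ^+ 2 -> `|\sum_i v i * f i| <= N.
  move=> hf; apply: (le_trans _ hN); apply: (le_trans (dot_le_enorm _ _)).
  by rewrite mulrC ler_wpM2r ?enorm_ge0 //; apply: enorm_le => //; rewrite ltW.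
have := dN _ (phi1C u); have := dN _ (phi2C u).
rewrite !ler_norml => /andP[y1 y2] /andP[x1 x2].
rewrite /zeta; set x := \sum_i v i * phi1 i u in x1 x2 *.
set y := \sum_i v i * phi2 i u in y1 y2 *.
have -> : \sum_k (w k * ((1 - alpha) * x * phi1 k u + (alpha * y - 1) * phi2 k u)) ^+ 2 =
  \sum_k ((1 - alpha) * x * (w k * phi1 k u) + (alpha * y - 1) * (w k * phi2 k u)) ^+ 2.
  by apply: eq_bigr => k _; congr (_ ^+ 2); ring.
rewrite -sqr_enorm.
have h1 : enorm (fun k => w k * phi1 k u) <= Num.sqrt q * C.
  apply: enorm_le; first by rewrite mulr_ge0 ?sqrtr_ge0 // ltW.
  by rewrite exprMn sqr_sqrtr //; exact: wsqsum_le.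
have h2 : enorm (fun k => w k * phi2 k u) <= Num.sqrt q * C.
  apply: enorm_le; first by rewrite mulr_ge0 ?sqrtr_ge0 // ltW.
  by rewrite exprMn sqr_sqrtr //; exact: wsqsum_le.
have enZ c (f : 'I_n -> R) : enorm (fun k => c * f k) = `|c| * enorm f.
  rewrite -enormZ //; apply/eqP; rewrite eq_le; apply/andP; split; apply: ler_enorm => k.
    by rewrite !normrM normr_id.
  by rewrite !normrM normr_id.
have -> : q * (C * (N + 1)) ^+ 2 = (Num.sqrt q * C * (N + 1)) ^+ 2.
  by rewrite !exprMn sqr_sqrtr //; ring.
rewrite ler_sqr ?nnegrE ?enorm_ge0 //; last first.
  by rewrite !mulr_ge0 ?sqrtr_ge0 ?(ltW C0) //; lra.
apply: (le_trans (enormD _ _)); rewrite !enZ.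
have n1 : `|(1 - alpha) * x| <= (1 - alpha) * N.
  by rewrite ler_norml; apply/andP; split; nra.
have n2 : `|alpha * y - 1| <= alpha * N + 1.
  by rewrite ler_norml; apply/andP; split; nra.
set S := Num.sqrt q * C in h1 h2 *.
have S0 : 0 <= S by rewrite mulr_ge0 ?sqrtr_ge0 // ltW.
apply: (@le_trans _ _ ((1 - alpha) * N * S + (alpha * N + 1) * S)).
  by apply: lerD; apply: ler_pM => //; exact: enorm_ge0.
lra.
Qed.

End Noise.

(** * The mean recursion *)

Section Schedule.
Context {R : realType}.
Variables (t0 C : R) (eta L : nat -> R).
Implicit Types (mu r g : R) (j i T : nat).

Definition bt j : R := j%:R + t0.

(** The factor of the averaged step in an eigendirection; the term [1 / b_j] is the regularisation
    [eta_j lambda_j]. *)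
Definition decay mu j : R := 1 - (bt j)^-1 - eta j * mu.

(** The relative error of the averaged path (see [meanE]): it starts at 1, is contracted by each
    step, and the regularisation feeds in [1 / b_j]. *)
Fixpoint bias mu j : R :=
  if j is i.+1 then decay mu i.+1 * bias mu i + (bt i.+1)^-1 else 1.

(** [r] is a coordinate in the orthonormal system of [L^2] and [mean] one in the feature system;
    [sqrt mu] converts between them. *)
Fixpoint mean mu r j : R :=
  if j is i.+1 then decay mu i.+1 * mean mu r i + eta i.+1 * (Num.sqrt mu * r) else 0.

Definition rho mu T j : R := \prod_(j <= i < T) decay mu i.+1.

Definition tail T j : R := \sum_(j <= i < T) eta i.+1.

(** The value of [mu / (1 + mu s)] at the largest admissible eigenvalue [mu = C^2]; this function
    increases with [mu]. *)
Definition weight T j : R := C ^+ 2 / (1 + C ^+ 2 * tail T j).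

Hypothesis t0_ge2 : 2 <= t0.
Hypothesis C0 : 0 < C.
Hypothesis eta0 : forall j, 0 < eta j.
Hypothesis eta_dec : forall j, eta j.+1 <= eta j.
Hypothesis eta_bt : forall j, eta j * bt j <= eta j.+1 * bt j.+1.
Hypothesis etaC : forall j, eta j * C ^+ 2 <= 1 / 4.
(** The discrete form of: the sum of the steps is at most [3 eta_T b_T]. It holds for power
    schedules whose exponent is at most 2/3. *)
Hypothesis eta_sum : forall j, 3 * (eta j * bt j) + eta j.+1 <= 3 * (eta j.+1 * bt j.+1).
Hypothesis L0 : forall j, 0 < L j.
Hypothesis L_dec : forall j, L j.+1 <= L j.
(** [L] stands for [lambda^beta]. It may not decay faster than about [b^(-1/3)], so that the
    contraction by [1 - 1/b] leaves a margin of [2/3] over [b]. *)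
Hypothesis L_step : forall j,
  L j * (1 - (bt j.+1)^-1) <= L j.+1 * (1 - 2 / 3 * (bt j.+1)^-1).

Lemma btS j : bt j.+1 = bt j + 1.
Proof. by rewrite /bt -natr1; ring. Qed.

Lemma bt_ge2 j : 2 <= bt j.
Proof. rewrite /bt; have h := ler0n R j; have h2 := t0_ge2; lra. Qed.

Lemma bt_gt0 j : 0 < bt j.
Proof. by have := bt_ge2 j; lra. Qed.

Lemma bt_ge0 j : 0 <= bt j.
Proof. by rewrite ltW // bt_gt0. Qed.

Lemma eta_ge0 j : 0 <= eta j.
Proof. by rewrite ltW. Qed.

Lemma bt_neq0 j : bt j != 0.
Proof. by rewrite gt_eqF // bt_gt0. Qed.

Lemma invbt_ge0 j : 0 <= (bt j)^-1.
Proof. by rewrite invr_ge0 ltW // bt_gt0. Qed.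

Lemma invbt_le j : (bt j)^-1 <= 1 / 2.
Proof.
by rewrite div1r lef_pV2 ?posrE ?bt_gt0 // bt_ge2.
Qed.

Lemma bt_frac j : 1 - (bt j.+1)^-1 = bt j / bt j.+1.
Proof.
by have := bt_neq0 j.+1; rewrite btS => h; field.
Qed.

Lemma eta_bt_mono i j : (i <= j)%N -> eta i * bt i <= eta j * bt j.
Proof.
move=> ij; rewrite -(subnKC ij); elim: (j - i)%N => [|k IH]; first by rewrite addn0.
by rewrite addnS (le_trans IH).
Qed.

Section Rate.
Variable mu : R.
Hypothesis mu0 : 0 <= mu.
Hypothesis muC : mu <= C ^+ 2.

Lemma etamu_ge0 j : 0 <= eta j * mu.
Proof. by rewrite mulr_ge0 // ltW. Qed.

Lemma etamu_le j : eta j * mu <= 1 / 4.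
Proof. by apply: le_trans (etaC j); rewrite ler_wpM2l // ltW. Qed.

Lemma decay_ge0 j : 0 <= decay mu j.
Proof. by rewrite /decay; have := invbt_le j; have := etamu_le j; lra. Qed.

Lemma decay_le1 j : decay mu j <= 1.
Proof. by rewrite /decay; have := invbt_ge0 j; have := etamu_ge0 j; lra. Qed.

Lemma bias_ge0 j : 0 <= bias mu j.
Proof.
elim: j => [|j IH] /=; first exact: ler01.
by rewrite addr_ge0 ?mulr_ge0 ?decay_ge0 ?invbt_ge0.
Qed.

Lemma bias_le1 j : bias mu j <= 1.
Proof.
elim: j => [|j IH] /=; first exact: lexx.
have := decay_ge0 j.+1; have := etamu_ge0 j.+1; have := bias_ge0 j.
rewrite /decay; nra.
Qed.

(** The first term is the initial error under pure regularisation. For the second, [L_step] shows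
    that one step lowers [3/2 L] by [L / b + 3/2 eta mu L] relative to its new value, which is
    exactly the bound for the input [p / b] given by the hypothesis on [p]. This fixes the constants
    3/2 and 2/3. *)
Lemma bias_mul_le (p : R) j : 0 <= p ->
  (forall i, p <= L i * (1 + 3 / 2 * (eta i * bt i) * mu)) ->
  bias mu j * p <= t0 / bt j * p + 3 / 2 * L j.
Proof.
have t2 := t0_ge2; move=> p0 hp; elim: j => [|j IH].
  rewrite /= mul1r /bt add0r divff ?mul1r; last by rewrite gt_eqF //; lra.
  by have := L0 0; lra.
rewrite /=.
have d0 := decay_ge0 j.+1.
have h1 := ler_wpM2l d0 IH.
have h2 : decay mu j.+1 * (t0 / bt j * p) <= t0 / bt j.+1 * p.
  have -> : t0 / bt j.+1 * p = (1 - (bt j.+1)^-1) * (t0 / bt j * p).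
    rewrite bt_frac; have := bt_neq0 j; have := bt_neq0 j.+1 => u w; field.
    by rewrite u w.
  rewrite ler_wpM2r //; last by rewrite /decay; have := etamu_ge0 j.+1; lra.
  by rewrite mulr_ge0 // divr_ge0 // ?bt_ge0 //; lra.
have h3 : decay mu j.+1 * L j <= L j.+1 * (1 - 2 / 3 * (bt j.+1)^-1) - eta j.+1 * mu * L j.+1.
  have -> : decay mu j.+1 * L j = L j * (1 - (bt j.+1)^-1) - eta j.+1 * mu * L j.
    by rewrite /decay; ring.
  have := L_step j; have := ler_wpM2l (etamu_ge0 j.+1) (L_dec j); lra.
have h4 : (bt j.+1)^-1 * p <= L j.+1 * ((bt j.+1)^-1 + 3 / 2 * (eta j.+1 * mu)).
  have := ler_wpM2l (invbt_ge0 j.+1) (hp j.+1).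
  have -> : (bt j.+1)^-1 * (L j.+1 * (1 + 3 / 2 * (eta j.+1 * bt j.+1) * mu)) =
     L j.+1 * ((bt j.+1)^-1 + 3 / 2 * (eta j.+1 * mu)).
    by have := bt_neq0 j.+1 => u; field.
  by [].
have -> : (decay mu j.+1 * bias mu j + (bt j.+1)^-1) * p =
  decay mu j.+1 * (bias mu j * p) + (bt j.+1)^-1 * p by ring.
lra.
Qed.

Lemma meanE r j : Num.sqrt mu * mean mu r j - r = - (bias mu j * r).
Proof.
elim: j => [|j IH] /=; first by rewrite mulr0 mul1r sub0r.
have s2 : Num.sqrt mu ^+ 2 = mu by rewrite sqr_sqrtr.
have -> : Num.sqrt mu * (decay mu j.+1 * mean mu r j + eta j.+1 * (Num.sqrt mu * r)) - r
  = decay mu j.+1 * (Num.sqrt mu * mean mu r j - r) + decay mu j.+1 * r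
    + eta j.+1 * Num.sqrt mu ^+ 2 * r - r by ring.
by rewrite IH s2 /decay; ring.
Qed.

(** The invariant [|mean| <= K |r|] with [K = 1 / sqrt lambda_T] is kept because the new input
    [eta sqrt mu] is at most [(1/b + eta mu) K]; after multiplication by [K] this follows from
    [s K <= 1 + (s K)^2] with [s = sqrt mu]. *)
Lemma mean_le r T j : (j <= T)%N ->
  `|mean mu r j| <= Num.sqrt (eta T * bt T) * `|r|.
Proof.
set K := Num.sqrt (eta T * bt T).
have eT : 0 < eta T * bt T by rewrite mulr_gt0 ?bt_gt0.
have K2 : K ^+ 2 = eta T * bt T by rewrite sqr_sqrtr // ltW.
have K0 : 0 < K by rewrite sqrtr_gt0.
elim: j => [|j IH] jT /=; first by rewrite normr0 mulr_ge0 // ltW.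
have {}IH := IH (ltnW jT).
have s0 := sqrtr_ge0 mu; have s2 := sqr_sqrtr mu0; set s := Num.sqrt mu in s0 s2 *.
rewrite (le_trans (ler_normD _ _)) // !normrM (ger0_norm (decay_ge0 _)).
rewrite (gtr0_norm (eta0 _)) (ger0_norm s0).
apply: (@le_trans _ _ (decay mu j.+1 * (K * `|r|) + eta j.+1 * (s * `|r|))).
  by rewrite lerD2r ler_wpM2l // decay_ge0.
rewrite mulrA [eta _ * _]mulrA -mulrDl ler_wpM2r //.
have eb : eta j.+1 * bt j.+1 <= K ^+ 2 by rewrite K2; exact: eta_bt_mono.
have b0 := bt_gt0 j.+1; have e0 := eta0 j.+1.
have h : eta j.+1 <= (bt j.+1)^-1 * K ^+ 2.
  by rewrite -ler_pdivrMl ?invr_gt0 // invrK mulrC.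
suff : eta j.+1 * s <= ((bt j.+1)^-1 + eta j.+1 * s ^+ 2) * K.
  by rewrite s2 /decay; lra.
have h1 : eta j.+1 * s * K <= eta j.+1 + eta j.+1 * s ^+ 2 * K ^+ 2.
  have -> : eta j.+1 * s * K = eta j.+1 * (s * K) by ring.
  have -> : eta j.+1 + eta j.+1 * s ^+ 2 * K ^+ 2 = eta j.+1 * (1 + (s * K) ^+ 2) by ring.
  rewrite ler_pM2l //; have := sqr_ge0 (s * K - 1); nra.
rewrite -(ler_pM2r K0); apply: (le_trans h1).
have -> : ((bt j.+1)^-1 + eta j.+1 * s ^+ 2) * K * K =
  (bt j.+1)^-1 * K ^+ 2 + eta j.+1 * s ^+ 2 * K ^+ 2 by ring.
by rewrite lerD2r.
Qed.

Lemma rhoS T j : (j <= T)%N -> rho mu T.+1 j = rho mu T j * decay mu T.+1.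
Proof. by move=> jT; rewrite /rho big_nat_recr. Qed.

Lemma rho_rec T j : (j < T)%N -> rho mu T j = decay mu j.+1 * rho mu T j.+1.
Proof. by move=> jT; rewrite /rho big_ltn. Qed.

Lemma rhoTT T : rho mu T T = 1.
Proof. by rewrite /rho big_geq. Qed.

Lemma tail_ge0 T j : 0 <= tail T j.
Proof. by apply: sumr_ge0 => i _; rewrite ltW. Qed.

Lemma rho_ge0 T j : 0 <= rho mu T j.
Proof. by apply: prodr_ge0 => i _; exact: decay_ge0. Qed.

(** Each factor is at most [(1 - 1/b_i) / (1 + eta_i mu)]. The first parts telescope to [b_j / b_T],
    and the product of the [1 + eta_i mu] is at least one plus the sum. *)
Lemma rho_le T j : (j <= T)%N ->
  rho mu T j <= bt j / bt T * (1 + mu * tail T j)^-1.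
Proof.
move=> jT; rewrite -(subnKC jT); elim: (T - j)%N => [|k IH].
  rewrite addn0 rhoTT /tail big_geq // mulr0 addr0 invr1 divff ?bt_neq0 //.
  by rewrite mulr1.
rewrite addnS rhoS ?leq_addr //; set S := (j + k)%N in IH *.
have -> : tail S.+1 j = tail S j + eta S.+1 by rewrite /tail big_nat_recr ?leq_addr.
set s := tail S j in IH *; have s0 : 0 <= s := tail_ge0 S j.
have e0 := eta0 S.+1; have em := etamu_ge0 S.+1; have em4 := etamu_le S.+1.
have hd : decay mu S.+1 <= bt S / bt S.+1 * (1 + eta S.+1 * mu)^-1.
  rewrite -bt_frac ler_pdivlMr; last lra.
  have := invbt_ge0 S.+1; rewrite /decay; nra.
have bS := bt_neq0 S; have bS1 := bt_neq0 S.+1; have bj := bt_gt0 j.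
apply: (le_trans (ler_pM (rho_ge0 _ _) (decay_ge0 _) IH hd)).
have p1 : 0 < 1 + mu * s by have := mulr_ge0 mu0 s0; lra.
have p2 : 0 < 1 + eta S.+1 * mu by lra.
have p3 : 0 < 1 + mu * (s + eta S.+1) by rewrite mulrDr; have := mulr_ge0 mu0 s0; lra.
have -> : bt j / bt S * (1 + mu * s)^-1 * (bt S / bt S.+1 * (1 + eta S.+1 * mu)^-1) =
  bt j / bt S.+1 * ((1 + mu * s) * (1 + eta S.+1 * mu))^-1.
  by field; rewrite bS bS1 !gt_eqF.
rewrite ler_wpM2l ?divr_ge0 ?bt_ge0 // lef_pV2 ?posrE //; last exact: mulr_gt0.
have := mulr_ge0 (mulr_ge0 mu0 s0) em; nra.
Qed.

Lemma weight_ge0 T j : 0 <= weight T j.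
Proof.
have c2 := sqr_ge0 C; rewrite /weight divr_ge0 //.
by have := mulr_ge0 c2 (tail_ge0 T j); lra.
Qed.

(** [mu / (1 + mu s)^2 <= C^2 / (1 + C^2 s)] for [mu <= C^2]: the factor [mu] cancels one power of
    the denominator, and the bound no longer depends on the eigenvalue. *)
Lemma gain_le T j : (j <= T)%N ->
  (eta j * rho mu T j * Num.sqrt mu) ^+ 2 <= eta j ^+ 2 * (bt j / bt T) ^+ 2 * weight T j.
Proof.
move=> jT; have := rho_le jT; have := rho_ge0 T j.
set s := tail T j; have s0 : 0 <= s := tail_ge0 T j.
have ms := mulr_ge0 mu0 s0.
set x := bt j / bt T; have x0 : 0 <= x by rewrite divr_ge0 ?bt_ge0.
move=> r0 hr; clearbody x.
rewrite !exprMn sqr_sqrtr // -[leRHS]mulrA -[leLHS]mulrA ler_wpM2l ?sqr_ge0 //.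
have p1 : 0 < 1 + mu * s by lra.
apply: (@le_trans _ _ ((x * (1 + mu * s)^-1) ^+ 2 * mu)).
  by rewrite ler_wpM2r // ler_sqr ?nnegrE ?mulr_ge0 ?invr_ge0 ?(ltW p1).
rewrite exprMn -mulrA ler_wpM2l ?sqr_ge0 // /weight -/s.
have cs := mulr_ge0 (sqr_ge0 C) s0.
rewrite ler_pdivlMr; last lra.
have -> : (1 + mu * s)^-1 ^+ 2 * mu * (1 + C ^+ 2 * s) =
  mu * (1 + C ^+ 2 * s) / (1 + mu * s) ^+ 2.
  by have := gt_eqF p1 => /negbT u; field.
rewrite ler_pdivrMr ?exprn_gt0 //.
have c1 := mulr_ge0 (sqr_ge0 C) ms; have c2 := mulr_ge0 c1 ms; have := muC.
lra.
Qed.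

(** The total weight of noise that does not vanish near the target; it costs only [eta_T mu], with
    no logarithm. In the induction [(1 - 1/b) eta_T <= eta_(T+1)] pays for the old terms, and the
    loss [eta_(T+1) mu * eta_T mu] pays for the new square. *)
Lemma gain_sqsum_le T :
  \sum_(i < T) (eta i.+1 * rho mu T i.+1 * mu) ^+ 2 <= eta T * mu.
Proof.
elim: T => [|T IH]; first by rewrite big_ord0 etamu_ge0.
rewrite big_ord_recr /= rhoTT mulr1.
have -> : \sum_(i < T) (eta i.+1 * rho mu T.+1 i.+1 * mu) ^+ 2 =
  decay mu T.+1 ^+ 2 * \sum_(i < T) (eta i.+1 * rho mu T i.+1 * mu) ^+ 2.
  rewrite mulr_sumr; apply: eq_bigr => i _.
  by rewrite rhoS // [in LHS]exprMn; ring.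
have d0 := decay_ge0 T.+1; have d1 := decay_le1 T.+1.
have h1 := ler_wpM2l (sqr_ge0 (decay mu T.+1)) IH.
have h2 : decay mu T.+1 ^+ 2 <= decay mu T.+1 by nra.
have h3 := ler_wpM2r (etamu_ge0 T) h2.
have h4 : decay mu T.+1 * (eta T * mu) <= eta T.+1 * mu - eta T.+1 * mu * (eta T * mu).
  have : (1 - (bt T.+1)^-1) * eta T <= eta T.+1.
    rewrite bt_frac mulrAC ler_pdivrMr ?bt_gt0 // mulrC; exact: eta_bt.
  move=> /(ler_wpM2r mu0); rewrite /decay; lra.
have := ler_wpM2l (etamu_ge0 T.+1) (ler_wpM2r mu0 (eta_dec T)).
have -> : (eta T.+1 * mu) ^+ 2 = eta T.+1 * mu * (eta T.+1 * mu) by ring.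
lra.
Qed.

End Rate.

(** A telescoping sum of logarithms: passing from [tail T i.+1] to [tail T i] multiplies
    [1 + C^2 tail] by [1 + x] with [x = eta * weight <= 1/4], and there [ln (1 + x) >= 4/5 x]. *)
Lemma sum_weight_le T :
  \sum_(i < T) eta i.+1 * weight T i.+1 <= 5 / 4 * ln (1 + C ^+ 2 * tail T 0).
Proof.
pose f i := ln (1 + C ^+ 2 * tail T i).
have pos i : 0 < 1 + C ^+ 2 * tail T i.
  have := mulr_ge0 (sqr_ge0 C) (tail_ge0 T i); lra.
have fT : f T = 0 by rewrite /f /tail big_geq // mulr0 addr0 ln1.
have -> : ln (1 + C ^+ 2 * tail T 0) = \sum_(i < T) (f i - f i.+1).
  rewrite -[LHS]subr0 -[X in _ - X = _]fT -/(f 0%N).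
  have := telescope_sumr f (leq0n T); rewrite big_mkord => h.
  have -> : \sum_(i < T) (f i - f i.+1) = - \sum_(i < T) (f i.+1 - f i).
    by rewrite -sumrN; apply: eq_bigr => i _; rewrite opprB.
  by rewrite h opprB.
rewrite mulr_sumr; apply: ler_sum => i _.
have tE : tail T i = eta i.+1 + tail T i.+1 by rewrite /tail big_ltn.
set p := 1 + C ^+ 2 * tail T i.+1.
have p0 : 0 < p := pos i.+1.
have p1 : 1 <= p by rewrite /p; have := mulr_ge0 (sqr_ge0 C) (tail_ge0 T i.+1); lra.
set x := eta i.+1 * weight T i.+1.
have x0 : 0 <= x by rewrite mulr_ge0 ?weight_ge0 // ltW.
have x4 : x <= 1 / 4.
  rewrite /x /weight mulrA ler_pdivrMr // -/p; have := etaC i.+1; lra.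
have fE : f i = ln (p * (1 + x)).
  have -> : p * (1 + x) = p + C ^+ 2 * eta i.+1.
    by rewrite /x /weight -/p; have := gt_eqF p0 => /negbT u; field.
  by rewrite /f tE /p; congr ln; ring.
rewrite fE lnM ?posrE //; last lra.
have := @ln_ge_1Bx_inv R (1 + x); have -> : 0 < 1 + x by lra.
move=> /(_ isT); rewrite /f -/p.
have : (1 + x)^-1 <= 1 - 4 / 5 * x.
  rewrite -[leLHS]mul1r ler_pdivrMr; [nra|lra].
lra.
Qed.

Lemma tail0_le T : tail T 0 <= 3 * (eta T * bt T).
Proof.
elim: T => [|T IH].
  rewrite /tail big_geq //; have := mulr_gt0 (eta0 0) (bt_gt0 0); lra.
rewrite /tail big_nat_recr //= -/(tail T 0); have := eta_sum T; lra.
Qed.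

(** A crude companion of [tail0_le], good enough inside a logarithm; [ln (bt T)] in the final bound
    comes from here. *)
Lemma tail0_le_bt T : 1 + C ^+ 2 * tail T 0 <= bt T.
Proof.
have : C ^+ 2 * tail T 0 <= T%:R / 4.
  elim: T => [|T IH]; first by rewrite /tail big_geq // mulr0 mul0r.
  rewrite /tail big_nat_recr //= -/(tail T 0) mulrDr -natr1.
  have := etaC T.+1; rewrite mulrC; lra.
by rewrite /bt; have := ler0n R T; have := t0_ge2; lra.
Qed.

(** Shifts the index from the step [i + 1] to the error before it; 3/2 bounds [b_(i+1) / b_i] since
    [b_i >= 2]. *)
Lemma step_ratio_le T i : (i < T)%N ->
  eta i.+1 * (bt i.+1 / bt T) ^+ 2 <= 3 / 2 * eta T * (bt i / bt T).
Proof.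
move=> iT; have h1 := eta_bt_mono iT; have b0 := bt_gt0 T.
have h2 : bt i.+1 <= 3 / 2 * bt i by rewrite btS; have := bt_ge2 i; lra.
have -> : eta i.+1 * (bt i.+1 / bt T) ^+ 2 = (eta i.+1 * bt i.+1) / bt T * (bt i.+1 / bt T).
  by have := bt_neq0 T => u; field.
have -> : 3 / 2 * eta T * (bt i / bt T) = eta T * (3 / 2 * bt i / bt T) by ring.
apply: ler_pM.
- by rewrite !mulr_ge0 ?invr_ge0 ?bt_ge0 ?eta_ge0.
- by rewrite divr_ge0 ?bt_ge0.
- by rewrite ler_pdivrMr.
- by rewrite ler_pM2r ?invr_gt0.
Qed.

Lemma bt_L_mono i j : (i <= j)%N -> bt i * L i <= bt j * L j.
Proof.
move=> ij; rewrite -(subnKC ij); elim: (j - i)%N => [|k IH]; first by rewrite addn0.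
rewrite addnS (le_trans IH) //; set m := (i + k)%N.
have := L_step m; rewrite bt_frac => h.
have b0 := bt_gt0 m.+1; have := ler_wpM2r (ltW b0) h.
have -> : L m * (bt m / bt m.+1) * bt m.+1 = bt m * L m.
  by have := bt_neq0 m.+1 => u; field.
move/le_trans; apply.
have -> : L m.+1 * (1 - 2 / 3 * (bt m.+1)^-1) * bt m.+1 = bt m.+1 * L m.+1 - 2 / 3 * L m.+1.
  by have := bt_neq0 m.+1 => u; field.
have := L0 m.+1; lra.
Qed.

Lemma sum_ratio_sqr_le T :
  \sum_(i < T) (bt i.+1 / bt T * eta i.+1) ^+ 2 <= eta T ^+ 2 * bt T.
Proof.
apply: (@le_trans _ _ (\sum_(i < T) eta T ^+ 2)).
  apply: ler_sum => i _; rewrite ler_sqr ?nnegrE; last 2 first.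
  - by rewrite mulr_ge0 ?divr_ge0 ?bt_ge0 ?eta_ge0.
  - by rewrite ltW.
  rewrite mulrAC ler_pdivrMr ?bt_gt0 // mulrC; exact: eta_bt_mono.
by rewrite sumr_const card_ord -mulr_natr ler_wpM2l ?sqr_ge0 // /bt; have := t0_ge2; lra.
Qed.

(* [e] is an upper bound for the deterministic error such that [bt * e] increases. *)
Lemma sum_bias_gain_le (e : nat -> R) T :
  (forall i, (i < T)%N -> 0 <= e i) ->
  (forall i, (i < T)%N -> bt i * e i <= bt T * e T) ->
  \sum_(i < T) eta i.+1 ^+ 2 * (bt i.+1 / bt T) ^+ 2 * weight T i.+1 * e i <=
  15 / 8 * eta T * ln (1 + C ^+ 2 * tail T 0) * e T.
Proof.
move=> e0 he.
(* For [T = 0] nothing is assumed about the sign of [e T]; for [T > 0] it follows from the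
   monotonicity of [bt * e] starting at 0. *)
have [->|T0] := posnP T.
  rewrite big_ord0 /tail big_geq // mulr0 addr0 ln1 mulr0 mul0r; exact: lexx.
have b0 := bt_gt0 T.
have eT0 : 0 <= e T.
  have := le_trans (mulr_ge0 (bt_ge0 0) (e0 _ T0)) (he _ T0).
  by rewrite pmulr_rge0.
apply: (@le_trans _ _ (\sum_(i < T) (3 / 2 * eta T * e T) * (eta i.+1 * weight T i.+1))).
  apply: ler_sum => i _.
  have -> : eta i.+1 ^+ 2 * (bt i.+1 / bt T) ^+ 2 * weight T i.+1 * e i =
    (eta i.+1 * (bt i.+1 / bt T) ^+ 2 * e i) * (eta i.+1 * weight T i.+1) by ring.
  apply: ler_wpM2r; first by rewrite mulr_ge0 ?weight_ge0 ?eta_ge0.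
  apply: (@le_trans _ _ (3 / 2 * eta T * (bt i / bt T) * e i)).
    by apply: ler_wpM2r; [exact: e0 | exact: step_ratio_le].
  have -> : 3 / 2 * eta T * (bt i / bt T) * e i = 3 / 2 * eta T * (bt i * e i / bt T) by ring.
  rewrite ler_wpM2l //; first by have := eta0 T; lra.
  by rewrite ler_pdivrMr // [e T * _]mulrC he.
rewrite -mulr_sumr.
have k0 : 0 <= 3 / 2 * eta T * e T by rewrite mulr_ge0 //; have := eta0 T; lra.
have := ler_wpM2l k0 (sum_weight_le T); lra.
Qed.

(** The instance [e_i = eta_i^2 b_i], which is the order of the squared RKHS norm of the deviation
    up to [C^2 / alpha]. *)
Lemma sum_azuma_le T :
  \sum_(i < T) eta i.+1 ^+ 2 * (bt i.+1 / bt T) ^+ 2 * weight T i.+1 * (eta i ^+ 2 * bt i) <=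
  15 / 8 * eta T ^+ 3 * bt T * ln (1 + C ^+ 2 * tail T 0).
Proof.
have := @sum_bias_gain_le (fun i => eta i ^+ 2 * bt i) T.
have h1 i : (i < T)%N -> 0 <= eta i ^+ 2 * bt i.
  by move=> _; rewrite mulr_ge0 ?sqr_ge0 // ltW // bt_gt0.
have h2 i : (i < T)%N -> bt i * (eta i ^+ 2 * bt i) <= bt T * (eta T ^+ 2 * bt T).
  move=> iT.
  have sqE j : bt j * (eta j ^+ 2 * bt j) = (eta j * bt j) ^+ 2 by ring.
  rewrite !sqE ler_sqr ?nnegrE ?mulr_ge0 ?bt_ge0 ?eta_ge0 //.
  exact: eta_bt_mono (ltnW iT).
move=> /(_ h1 h2) h; apply: (le_trans h); lra.
Qed.

End Schedule.

(** * Tail bound for a finite-dimensional iteration *)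

Section Processes.
Context {R : realType} {n : nat} {dU : measure_display} {U : measurableType dU}.
Variable nu : probability U R.
Variables (phi1 phi2 : 'I_n -> U -> R) (alpha C t0 : R) (eta L : nat -> R).
Variables (mu rr : 'I_n -> R) (tau : R).
Local Notation E f := (\int[nu]_u (f u)).
Local Notation bt := (bt t0).
Local Notation zeta := (zeta phi1 phi2 alpha).
Local Notation zlin := (zlin phi1 phi2 alpha).
Local Notation xi := (xi nu phi1 phi2 alpha).
Implicit Types (z : nat -> U) (v s w : 'I_n -> R) (u : U).

Fixpoint iter z j : 'I_n -> R :=
  if j is i.+1 then
    fun k => (1 - (bt i.+1)^-1) * iter z i k - eta i.+1 * zeta (iter z i) (z i) k
  else fun=> 0.

Definition vbar j k := mean t0 eta (mu k) (rr k) j.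

Definition dev z j k := iter z j k - vbar j k.

(** The factor with which the noise of step [i + 1] (sample [z i]) reaches the error at time [T],
    measured in [L^2]. *)
Definition gain T i k := eta i.+1 * rho t0 eta (mu k) T i.+1 * Num.sqrt (mu k).

(** The horizon [T] is fixed and [j] is the running time, so the weights are deterministic and this
    is a martingale in [j]. *)
Definition main_noise T z j k := \sum_(i < j) - (gain T i k * xi (vbar i) (z i) k).

Definition mult_noise T z j k :=
  \sum_(i < j) - (gain T i k * (zlin (dev z i) (z i) k - E (zlin (dev z i) ^~ k))).

Definition gain2 T i := eta i.+1 ^+ 2 * (bt i.+1 / bt T) ^+ 2 * weight C eta T i.+1.

(** Each summand is a bound for the squared increment of [mult_noise], known before the sample
    [z i]; 4 comes from centring. *)
Definition qvar T z j := \sum_(i < j) 4 * C ^+ 4 * gain2 T i * \sum_k dev z i k ^+ 2.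

(** A sup-norm bound for the averaged path: [C] times its RKHS norm, which is at most the [L^2] norm
    of the ratio over [sqrt lambda_T]. *)
Definition supf T := C * (Num.sqrt (alpha^-1) * Num.sqrt (eta T * bt T)).

Definition dist2 i := \sum_k (Num.sqrt (mu k) * vbar i k - rr k) ^+ 2.

Definition mainvar T := \sum_(i < T)
  (C ^+ 2 * gain2 T i * (dist2 i + tau ^+ 2) + (4 * alpha ^+ 2)^-1 * \sum_k gain T i k ^+ 2 * mu k).

Arguments dev : simpl never.
Arguments vbar : simpl never.

Hypothesis alpha01 : 0 < alpha < 1.
Hypothesis C0 : 0 < C.
Hypothesis mphi1 : forall i, measurable_fun setT (phi1 i).
Hypothesis mphi2 : forall i, measurable_fun setT (phi2 i).
Hypothesis phi1C : forall u, \sum_i phi1 i u ^+ 2 <= C ^+ 2.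
Hypothesis phi2C : forall u, \sum_i phi2 i u ^+ 2 <= C ^+ 2.
Hypothesis t0_ge2 : 2 <= t0.
Hypothesis eta0 : forall j, 0 < eta j.
Hypothesis eta_dec : forall j, eta j.+1 <= eta j.
Hypothesis eta_bt : forall j, eta j * bt j <= eta j.+1 * bt j.+1.
Hypothesis etaC : forall j, eta j * C ^+ 2 <= 1 / 4.
Hypothesis mu0 : forall k, 0 <= mu k.
Hypothesis muC : \sum_k mu k <= C ^+ 2.
Hypothesis rr_le : \sum_k rr k ^+ 2 + tau ^+ 2 <= alpha^-1.
Hypothesis mean_zeta : forall v k,
  E (zeta v ^~ k) = mu k * v k - Num.sqrt (mu k) * rr k.
Hypothesis var_zeta : forall v w (q : R), 0 <= q -> (forall k, w k ^+ 2 <= q) ->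
  E (fun u => \sum_k (w k * zeta v u k) ^+ 2) <=
  C ^+ 2 * q * (\sum_k (Num.sqrt (mu k) * v k - rr k) ^+ 2 + tau ^+ 2)
  + (4 * alpha ^+ 2)^-1 * \sum_k w k ^+ 2 * mu k.
Hypothesis var_zeta1 : forall v,
  E (fun u => \sum_k zeta v u k ^+ 2) <=
  C ^+ 2 * (alpha^-1 + \sum_k (Num.sqrt (mu k) * v k - rr k) ^+ 2 - \sum_k rr k ^+ 2).

Lemma mu_le k : mu k <= C ^+ 2.
Proof.
by apply: le_trans muC; rewrite (bigD1 k) //= lerDl sumr_ge0.
Qed.

Lemma vbarS i k :
  vbar i.+1 k = (1 - (bt i.+1)^-1) * vbar i k - eta i.+1 * E (zeta (vbar i) ^~ k).
Proof. by rewrite mean_zeta /vbar /= /decay; ring. Qed.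

Lemma zeta_iter z i u k :
  zeta (iter z i) u k = zeta (vbar i) u k + zlin (dev z i) u k.
Proof.
rewrite -zetaD; congr (zeta _ u k); apply/funext => l; rewrite /dev; ring.
Qed.

Lemma devS z i k : dev z i.+1 k = (1 - (bt i.+1)^-1) * dev z i k
  - eta i.+1 * (zlin (dev z i) (z i) k + xi (vbar i) (z i) k).
Proof.
rewrite {1}/dev /= vbarS zeta_iter /xi /dev; ring.
Qed.

Lemma expect_zlin s k : E (zlin s ^~ k) = mu k * s k.
Proof.
have h : E (zeta (fun i => 0 + s i) ^~ k) = E (zeta (fun=> 0) ^~ k) + E (zlin s ^~ k).
  rewrite -expectD.
  - by apply: eq_Rintegral => u _; rewrite zetaD.
  - exact: (bmeas_zeta alpha C0).
  - exact: (bmeas_zlin alpha C0).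
by move: h; rewrite !mean_zeta; lra.
Qed.

(* The final error splits into two martingales evaluated at time [T]. *)
Lemma dev_split T z j k : (j <= T)%N ->
  rho t0 eta (mu k) T j * (Num.sqrt (mu k) * dev z j k) =
  main_noise T z j k + mult_noise T z j k.
Proof.
elim: j => [|j IH] jT.
  by rewrite /main_noise /mult_noise !big_ord0 /dev /vbar /= subr0 !mulr0 addr0.
rewrite /main_noise /mult_noise !big_ord_recr /= -/(main_noise T z j k) -/(mult_noise T z j k).
rewrite addrACA -IH ?(ltnW jT) // (rho_rec _ _ _ jT) devS /gain expect_zlin /decay; ring.
Qed.

Lemma dev_final T z k :
  Num.sqrt (mu k) * dev z T k = main_noise T z T k + mult_noise T z T k.
Proof. by rewrite -dev_split // rhoTT mul1r. Qed.

Lemma alphaV_ge1 : 1 <= alpha^-1.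
Proof. by have /andP[a0 a1] := alpha01; rewrite invf_ge1 // ltW. Qed.

(** The averaged path never moves away from the target beyond the initial distance, because [bias]
    stays in the unit interval. *)
Lemma dist2_le i : dist2 i <= \sum_k rr k ^+ 2.
Proof.
apply: ler_sum => k _; rewrite meanE // sqrrN exprMn -[leRHS]mul1r ler_wpM2r ?sqr_ge0 //.
rewrite exprn_ile1 //; [exact: bias_ge0 (mu_le k) i|exact: bias_le1 (mu_le k) i].
Qed.

Lemma supf_ge0 T : 0 <= supf T.
Proof. by rewrite /supf !mulr_ge0 ?sqrtr_ge0 // ltW. Qed.

Lemma supf_bound T i : (i <= T)%N -> C * enorm (vbar i) <= supf T.
Proof.
move=> iT; rewrite /supf ler_pM2l //.
apply: enorm_le; first by rewrite mulr_ge0 ?sqrtr_ge0.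
have e0 : 0 <= eta T * bt T by rewrite mulr_ge0 ?bt_ge0 // ltW.
have a0 : 0 <= alpha^-1 by have := alphaV_ge1; lra.
rewrite exprMn !sqr_sqrtr //.
apply: (@le_trans _ _ (\sum_k (eta T * bt T) * rr k ^+ 2)).
  apply: ler_sum => k _.
  have := @mean_le R t0 C eta t0_ge2 eta0 eta_bt etaC (mu k) (mu0 k) (mu_le k) (rr k) T i iT.
  rewrite -/(vbar i k) => h.
  rewrite -[leLHS]real_normK ?num_real // -[rr k ^+ 2]real_normK ?num_real //.
  rewrite -[X in X * _](@sqr_sqrtr _ (eta T * bt T)) // -exprMn ler_sqr ?nnegrE //.
rewrite -mulr_sumr mulrC ler_wpM2r //.
by apply: le_trans rr_le; rewrite lerDl sqr_ge0.
Qed.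

Lemma gain2_ge0 T i : 0 <= gain2 T i.
Proof. by rewrite /gain2 mulr_ge0 ?weight_ge0 // mulr_ge0 // sqr_ge0. Qed.

Lemma gain_sqr_le T i k : (i < T)%N -> gain T i k ^+ 2 <= gain2 T i.
Proof. by move=> iT; exact: gain_le (mu_le k) _ _ iT. Qed.

Lemma weight_le T i : weight C eta T i <= C ^+ 2.
Proof.
rewrite /weight; have h : 0 <= C ^+ 2 * tail eta T i.
  by rewrite mulr_ge0 ?sqr_ge0 // tail_ge0.
rewrite ler_pdivrMr; last lra.
by have := ler_wpM2l (sqr_ge0 C) h; lra.
Qed.

Lemma ratio_eta_le T i : (i < T)%N -> 0 <= bt i.+1 / bt T * eta i.+1 <= eta T.
Proof.
move=> iT; rewrite mulr_ge0 ?divr_ge0 ?bt_ge0 ?(ltW (eta0 _)) //=.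
rewrite mulrAC ler_pdivrMr ?bt_gt0 // mulrC; exact: eta_bt_mono.
Qed.

Lemma gain2_le T i : (i < T)%N -> gain2 T i <= (eta T * C) ^+ 2.
Proof.
move=> iT; have /andP[h0 h1] := ratio_eta_le iT.
have a : eta i.+1 ^+ 2 * (bt i.+1 / bt T) ^+ 2 <= eta T ^+ 2.
  by rewrite -exprMn mulrC ler_sqr ?nnegrE // ltW.
rewrite /gain2 [leRHS]exprMn; apply: (ler_pM _ _ a (weight_le _ _)).
  exact: mulr_ge0 (sqr_ge0 _) (sqr_ge0 _).
exact: weight_ge0.
Qed.

Lemma bmeas_xi v k : bmeas (xi v ^~ k).
Proof.
by apply: bmeasB; [exact: (bmeas_zeta alpha C0)|exact: bmeas_cst].
Qed.

Lemma expect_xi v k : E (xi v ^~ k) = 0.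
Proof. exact: (expect_center nu (fun k => bmeas_zeta alpha C0 mphi1 mphi2 phi1C phi2C v k)). Qed.

Section Weighted.
Variables (w : 'I_n -> R) (q : R).
Hypotheses (q0 : 0 <= q) (wq : forall k, w k ^+ 2 <= q).

Let bwz v k : bmeas (fun u => w k * zeta v u k).
Proof. by apply: bmeasZ; exact: (bmeas_zeta alpha C0). Qed.

Let wxiE v u k : w k * xi v u k = w k * zeta v u k - E (fun u => w k * zeta v u k).
Proof.
rewrite expectZ; last exact: (bmeas_zeta alpha C0).
by rewrite /xi mulrBr.
Qed.

Lemma wxi_sqsum_le T i u : (i <= T)%N ->
  \sum_k (w k * xi (vbar i) u k) ^+ 2 <= 4 * (q * (C * (supf T + 1)) ^+ 2).
Proof.
move=> iT; under eq_bigr do rewrite wxiE.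
apply: (sqsum_center_le nu (bwz (vbar i))) => u'.
by apply: (zeta_sqsum_le alpha01 C0) => //; [exact: supf_ge0|exact: supf_bound].
Qed.

Lemma expect_wxi_le v :
  E (fun u => \sum_k (w k * xi v u k) ^+ 2) <= E (fun u => \sum_k (w k * zeta v u k) ^+ 2).
Proof.
apply: le_trans (expect_sqsum_center_le nu (bwz v)).
rewrite le_eqVlt; apply/orP; left; apply/eqP.
by apply: eq_Rintegral => u _; apply: eq_bigr => k _; rewrite wxiE.
Qed.

Lemma wzlin_center_le s u :
  \sum_k (w k * (zlin s u k - E (zlin s ^~ k))) ^+ 2 <= 4 * (q * C ^+ 4 * \sum_k s k ^+ 2).
Proof.
have bw k : bmeas (fun u => w k * zlin s u k).
  by apply: bmeasZ; exact: (bmeas_zlin alpha C0).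
have wE k : w k * (zlin s u k - E (zlin s ^~ k)) =
    w k * zlin s u k - E (fun u => w k * zlin s u k).
  by rewrite expectZ ?mulrBr //; exact: (bmeas_zlin alpha C0).
under eq_bigr do rewrite wE.
apply: (sqsum_center_le nu bw) => u'.
exact: (zlin_sqsum_le alpha01).
Qed.

End Weighted.

(* Pathwise contraction: the cross term with the random operator is absorbed because [eta * C^2 <= 1/4]. *)
Lemma contraction_sqsum i s u (x := 1 - (bt i.+1)^-1) :
  \sum_k (x * s k - eta i.+1 * (zlin s u k + xi (vbar i) u k)) ^+ 2 <=
  \sum_k (x * s k) ^+ 2 + 2 * (\sum_k (x * s k) * (- eta i.+1 * xi (vbar i) u k))
  + 2 * \sum_k (- eta i.+1 * xi (vbar i) u k) ^+ 2.
Proof.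
set e := eta i.+1; have e0 : 0 < e := eta0 _.
have := zlin_sqsum_dot_le alpha01 phi1C phi2C s u.
set B := \sum_k zlin s u k ^+ 2; set A := \sum_k s k * zlin s u k => BA.
have B0 : 0 <= B by apply: sumr_ge0 => k _; exact: sqr_ge0.
have hx : 1 / 2 <= x by rewrite /x; have := invbt_le t0_ge2 i.+1; lra.
have eC : e * C ^+ 2 <= 1 / 4 by exact: etaC.
have C2 : 0 < C ^+ 2 by rewrite exprn_gt0.
have A0 : 0 <= A by rewrite -(pmulr_rge0 _ C2); lra.
apply: (@le_trans _ _ (\sum_k (x * s k) ^+ 2 + 2 * (\sum_k (x * s k) * (- e * xi (vbar i) u k))
  + 2 * (\sum_k (- e * xi (vbar i) u k) ^+ 2) + (2 * e ^+ 2 * B - 2 * e * x * A))).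
  rewrite /A /B !mulr_sumr -!big_split /= -sumrB -big_split /=.
  apply: ler_sum => k _; have := sqr_ge0 (e * zlin s u k - e * xi (vbar i) u k).
  move: (zlin s u k) (xi (vbar i) u k) (s k) => a b c; nra.
rewrite gerDl subr_le0.
have h1 : e * B <= e * (C ^+ 2 * A) by rewrite ler_pM2l.
have h2 : e * C ^+ 2 * A <= 1 / 4 * A by rewrite ler_wpM2r.
have h3 : e * B <= x * A by have := ler_wpM2r A0 hx; lra.
by have := ler_wpM2l (ltW e0) h3; lra.
Qed.

Section Measurability.
Context {dX : measure_display} {X : measurableType dX}.

(** The source space is a parameter because these facts are needed over [O] and also over [O] with
    the sigma-algebra of the past. *)
Lemma measurable_zeta (V : X -> 'I_n -> R) (G : X -> U) k :
  (forall i, measurable_fun setT (fun x => V x i)) -> measurable_fun setT G ->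
  measurable_fun setT (fun x => zeta (V x) (G x) k).
Proof.
move=> mV mG.
have m1 i : measurable_fun setT (fun x => phi1 i (G x)) by exact: measurableT_comp.
have m2 i : measurable_fun setT (fun x => phi2 i (G x)) by exact: measurableT_comp.
apply: measurable_funD; apply: measurable_funM => //.
- apply: measurable_funM => //; apply: measurable_sum => i; exact: measurable_funM.
- apply: measurable_funB => //; apply: measurable_funM => //.
  by apply: measurable_sum => i; exact: measurable_funM.
Qed.

Lemma measurable_zlin (V : X -> 'I_n -> R) (G : X -> U) k :
  (forall i, measurable_fun setT (fun x => V x i)) -> measurable_fun setT G ->
  measurable_fun setT (fun x => zlin (V x) (G x) k).
Proof.
move=> mV mG.
have m1 i : measurable_fun setT (fun x => phi1 i (G x)) by exact: measurableT_comp.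
have m2 i : measurable_fun setT (fun x => phi2 i (G x)) by exact: measurableT_comp.
apply: measurable_funD; apply: measurable_funM => //.
- apply: measurable_funM => //; apply: measurable_sum => i; exact: measurable_funM.
- apply: measurable_funM => //.
  by apply: measurable_sum => i; exact: measurable_funM.
Qed.

Lemma measurable_xi v (G : X -> U) k : measurable_fun setT G ->
  measurable_fun setT (fun x => xi v (G x) k).
Proof. by move=> mG; apply: measurable_funB => //; exact: measurable_zeta. Qed.

Variable zX : nat -> X -> U.

Lemma measurable_iter j k : (forall i, (i < j)%N -> measurable_fun setT (zX i)) ->
  measurable_fun setT (fun x => iter (zX ^~ x) j k).
Proof.
elim: j k => [|j IH] k mz //=.
have mz' i : (i < j)%N -> measurable_fun setT (zX i) by move=> /ltnW; exact: mz.
apply: measurable_funB; apply: measurable_funM => //; first exact: IH.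
by apply: measurable_zeta => [i|]; [exact: IH|exact: mz].
Qed.

Lemma measurable_dev j k : (forall i, (i < j)%N -> measurable_fun setT (zX i)) ->
  measurable_fun setT (fun x => dev (zX ^~ x) j k).
Proof. by move=> mz; apply: measurable_funB => //; exact: measurable_iter. Qed.

Lemma measurable_main_noise T j k : (forall i, (i < j)%N -> measurable_fun setT (zX i)) ->
  measurable_fun setT (fun x => main_noise T (zX ^~ x) j k).
Proof.
move=> mz; apply: measurable_sum => i; apply: measurableT_comp => //.
by apply: measurable_funM => //; apply: measurable_xi; exact: mz.
Qed.

Lemma measurable_mult_noise T j k : (forall i, (i < j)%N -> measurable_fun setT (zX i)) ->
  measurable_fun setT (fun x => mult_noise T (zX ^~ x) j k).
Proof.
move=> mz; have md i l : (i < j)%N -> measurable_fun setT (fun x => dev (zX ^~ x) i l).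
  by move=> ij; apply: measurable_dev => i' i'i; apply: mz; exact: ltn_trans ij.
apply: measurable_sum => i; apply: measurableT_comp => //.
apply: measurable_funM => //; apply: measurable_funB.
  by apply: measurable_zlin => [l|]; [exact: md|exact: mz].
under [X in measurable_fun _ X]eq_fun do rewrite expect_zlin.
by apply: measurable_funM => //; exact: md.
Qed.

Lemma measurable_qvar T j : (forall i, (i < j)%N -> measurable_fun setT (zX i)) ->
  measurable_fun setT (fun x => qvar T (zX ^~ x) j).
Proof.
move=> mz; apply: measurable_sum => i; apply: measurable_funM => //.
apply: measurable_sum => k; apply: measurable_funX; apply: measurable_dev => i' i'i.
by apply: mz; exact: ltn_trans (ltn_ord i).
Qed.

End Measurability.

Context {dO : measure_display} {O : measurableType dO}.
Variables (P : probability O R) (Z : nat -> O -> U).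
Hypothesis mZ : forall i, measurable_fun setT (Z i).
Hypothesis indepZ : forall (I : seq nat) (A : nat -> set U), uniq I ->
  (forall i, measurable (A i)) ->
  fine (P (\bigcap_(i in [set` I]) (Z i @^-1` A i)))
    = \prod_(i <- I) fine (P (Z i @^-1` A i)).
Hypothesis lawZ : forall i A, measurable A -> P (Z i @^-1` A) = nu A.

Local Notation Ot t := (g_sigma_algebraType (past Z t)).
Local Notation zO o := (Z ^~ o).

Lemma measurable_expR_sqrt {dX} {X : measurableType dX} (f : X -> R) :
  measurable_fun setT f -> measurable_fun setT (fun x => expR (Num.sqrt (4 + f x))).
Proof.
move=> mf; apply: measurableT_comp => //.
apply: (measurableT_comp (continuous_measurable_fun (@sqrt_continuous R))).
exact: measurable_funD.
Qed.

Lemma measurable_expRN {dX} {X : measurableType dX} (f : X -> R) :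
  measurable_fun setT f -> measurable_fun setT (fun x => expR (- f x)).
Proof.
move=> mf; apply: (measurableT_comp (@measurable_expR R)).
exact: measurable_funN.
Qed.

Lemma measurable_sqsum {dX} {X : measurableType dX} (f : X -> 'I_n -> R) :
  (forall k, measurable_fun setT (fun x => f x k)) ->
  measurable_fun setT (fun x => \sum_k f x k ^+ 2).
Proof. by move=> mf; apply: measurable_sum => k; exact: measurable_funX. Qed.

Lemma measurable_past_fst t {dY} {Y : measurableType dY} (f : Ot t -> Y) :
  measurable_fun setT f -> @measurable_fun _ _ (Ot t * U)%type Y setT (fun x => f x.1).
Proof. by move=> mf; apply: measurableT_comp => //; exact: measurable_fst. Qed.

Lemma sqsum_ge0 (f : 'I_n -> R) : 0 <= \sum_k f k ^+ 2.
Proof. by apply: sumr_ge0 => k _; exact: sqr_ge0. Qed.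

Lemma sum_sqrZ (c : R) (f : 'I_n -> R) : \sum_k (c * f k) ^+ 2 = c ^+ 2 * \sum_k f k ^+ 2.
Proof. by rewrite mulr_sumr; apply: eq_bigr => k _; rewrite exprMn. Qed.

Lemma rate_ge0 T : 0 < eta T ^+ 2 * bt T.
Proof. by rewrite mulr_gt0 ?exprn_gt0 ?bt_gt0. Qed.

(** With [y = sqrt (bt T) >= 7/5] one has [sqrt alpha * (supf T + 1) <= y / 2 + 1], and
    [8 (y / 2 + 1)^2 <= 12 y^2] on that range. This is the smallness condition of the Bernstein step
    in [dev_moment]. *)
Lemma supf1_sqr_le T : 8 * alpha * (supf T + 1) ^+ 2 <= 12 * bt T.
Proof.
have /andP[a0 a1] := alpha01.
have b2 := bt_ge2 t0_ge2 T; have b0 : 0 <= bt T by lra.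
have aV : 0 <= alpha^-1 by rewrite invr_ge0 ltW.
have e0 : 0 <= eta T * bt T by rewrite mulr_ge0 // ltW.
have s2 : supf T ^+ 2 * alpha <= bt T / 4.
  rewrite /supf !exprMn !sqr_sqrtr //.
  have -> : C ^+ 2 * (alpha^-1 * (eta T * bt T)) * alpha = (eta T * C ^+ 2) * bt T.
    by field; rewrite gt_eqF.
  by have := ler_wpM2r b0 (etaC T); lra.
set y := Num.sqrt (bt T); have y0 : 0 <= y := sqrtr_ge0 _.
have y2 : y ^+ 2 = bt T by rewrite sqr_sqrtr.
have y1 : 7 / 5 <= y by rewrite -ler_sqr ?nnegrE ?y2 //; lra.
set s := Num.sqrt alpha; have ss : s ^+ 2 = alpha by rewrite sqr_sqrtr // ltW.
have s0 : 0 <= s := sqrtr_ge0 _.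
have s1 : s <= 1 by rewrite -(@expr_le1 _ 2) // ss ltW.
have h : s * supf T <= y / 2.
  rewrite -ler_sqr ?nnegrE; last 2 first.
  - by rewrite mulr_ge0 ?supf_ge0.
  - by rewrite divr_ge0.
  have -> : (y / 2) ^+ 2 = bt T / 4 by rewrite -y2; field.
  by rewrite exprMn ss (mulrC alpha).
have h2 : s * (supf T + 1) <= y / 2 + 1 by lra.
have h3 : (s * (supf T + 1)) ^+ 2 <= (y / 2 + 1) ^+ 2.
  rewrite ler_sqr ?nnegrE //; last lra.
  by rewrite mulr_ge0 //; have := supf_ge0 T; lra.
have hy : 0 <= (y - 7 / 5) * y by rewrite mulr_ge0 //; lra.
move: h3; rewrite exprMn ss -y2; lra.
Qed.

Definition devscale i := Num.sqrt (alpha / (12 * C ^+ 2 * (eta i ^+ 2 * bt i))).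

Lemma devscale_sqr i : devscale i ^+ 2 = alpha / (12 * C ^+ 2 * (eta i ^+ 2 * bt i)).
Proof.
have /andP[a0 _] := alpha01; rewrite sqr_sqrtr // divr_ge0 ?(ltW a0) //.
by apply: mulr_ge0; apply: mulr_ge0; rewrite ?sqr_ge0 ?bt_ge0.
Qed.

(** At time [j] the deviation is weighted by [b_j / b_T], which cancels the contraction [1 - 1/b].
    The exponent is 2, the gauge at 0, plus the sum of the variances, which [devscale] makes equal
    to at most 1/3. *)
Lemma dev_moment T :
  (\int[P]_o (expR (Num.sqrt (4 + \sum_k (devscale T * dev (zO o) T k) ^+ 2)))%:E
   <= (expR (7 / 3))%:E)%E.
Proof.
have /andP[a0 a1] := alpha01; have C2 : 0 < C ^+ 2 by rewrite exprn_gt0.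
set sg := devscale T; have sg0 : 0 <= sg := sqrtr_ge0 _.
have bT := bt_gt0 t0_ge2 T; have eT := eta0 T.
have sg2 : sg ^+ 2 = alpha / (12 * C ^+ 2 * (eta T ^+ 2 * bt T)) := devscale_sqr T.
pose sj j := sg * (bt j / bt T).
have sj0 j : 0 <= sj j by rewrite mulr_ge0 // divr_ge0 ?bt_ge0.
have sjS j : sj j = sj j.+1 * (1 - (bt j.+1)^-1).
  rewrite bt_frac // /sj.
  by have := bt_neq0 t0_ge2 T; have := bt_neq0 t0_ge2 j.+1 => u1 u2; field; rewrite u1 u2.
have sjT : sj T = sg by rewrite /sj divff ?mulr1 // bt_neq0.
have sje j : (j < T)%N -> (sj j.+1 * eta j.+1) ^+ 2 <= (sg * eta T) ^+ 2.
  move=> jT; have /andP[h0 h1] := ratio_eta_le jT.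
  have ha : sj j.+1 * eta j.+1 <= sg * eta T by rewrite /sj -mulrA ler_wpM2l.
  have hb : 0 <= sj j.+1 * eta j.+1 by rewrite mulr_ge0 // ltW.
  by rewrite ler_sqr // nnegrE // (le_trans hb).
pose F j o := expR (Num.sqrt (4 + \sum_k (sj j * dev (zO o) j k) ^+ 2)).
pose H j o u := expR (Num.sqrt (4 + \sum_k (sj j.+1 *
   ((1 - (bt j.+1)^-1) * dev (zO o) j k
   - eta j.+1 * (zlin (dev (zO o) j) u k + xi (vbar j) u k))) ^+ 2)).
pose B j := 4 * ((sj j.+1 * eta j.+1) ^+ 2 * (C ^+ 2 / alpha)).
have key := @iter_expectation_le R _ _ O U P nu Z mZ indepZ lawZ T F H (fun j => expR (B j)) (expR 2).
have : (\int[P]_o (F T o)%:E <= (expR 2 * \prod_(j < T) expR (B j))%:E)%E.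
  apply: key.
  - move=> j jT; apply: measurable_expR_sqrt; apply: measurable_sqsum => k.
    have md l : @measurable_fun _ _ (Ot j * U)%type R setT (fun x => dev (zO x.1) j l).
      apply: (@measurable_past_fst j _ _ (fun o => dev (zO o) j l)).
      by apply: measurable_dev => i; exact: measurable_past_proj.
    apply: measurable_funM => //; apply: measurable_funB; first exact: measurable_funM.
    apply: measurable_funM => //; apply: measurable_funD.
      by apply: measurable_zlin => //; exact: measurable_snd.
    by apply: measurable_xi; exact: measurable_snd.
  - move=> j _; apply: measurable_expR_sqrt; apply: measurable_sqsum => k.
    by apply: measurable_funM => //; apply: measurable_dev => i _; exact: mZ.
  - move=> j o jT; rewrite /F /H; congr (expR (Num.sqrt (4 + _))).
    by apply: eq_bigr => k _; rewrite devS.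
  - by move=> j o u; exact: expR_ge0.
  - by move=> j o; exact: expR_ge0.
  - by move=> j; exact: expR_ge0.
  - move=> j o jT.
    pose w (k : 'I_n) : R := - (sj j.+1 * eta j.+1).
    have wq (k : 'I_n) : w k ^+ 2 <= (sj j.+1 * eta j.+1) ^+ 2 by rewrite sqrrN.
    have q0 := sqr_ge0 (sj j.+1 * eta j.+1).
    pose x k := sj j * dev (zO o) j k.
    pose X u k := w k * xi (vbar j) u k.
    have bX k : bmeas (X ^~ k) by apply: bmeasZ; exact: bmeas_xi.
    have EX k : E (X ^~ k) = 0 by rewrite expectZ ?expect_xi ?mulr0 //; exact: bmeas_xi.
    have EX2 : E (fun u => \sum_k X u k ^+ 2) <= (sj j.+1 * eta j.+1) ^+ 2 * (C ^+ 2 / alpha).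
      apply: (le_trans (expect_wxi_le w (vbar j))).
      have -> : E (fun u => \sum_k (w k * zeta (vbar j) u k) ^+ 2) =
         (sj j.+1 * eta j.+1) ^+ 2 * E (fun u => \sum_k zeta (vbar j) u k ^+ 2).
        rewrite -expectZ; last first.
          by apply: bmeas_sqsum => k; exact: (bmeas_zeta alpha C0).
        by apply: eq_Rintegral => u _; rewrite sum_sqrZ sqrrN.
      rewrite ler_wpM2l //; apply: (le_trans (var_zeta1 _)).
      rewrite ler_wpM2l ?(ltW C2) //; have := dist2_le j; rewrite /dist2; lra.
    apply: (le_trans (@bernstein_step R _ _ nu n 2 x X _ _ bX EX _ _ _ _)).
    + by rewrite ler1n.
    + apply: measurable_sqsum => k; apply: measurable_funM => //; apply: measurable_funB => //.
      apply: measurable_funM => //; apply: measurable_funD.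
        by apply: measurable_zlin.
      exact: measurable_xi.
    + by move=> u; exact: sqsum_ge0.
    + move=> u; have := wxi_sqsum_le q0 wq u (ltnW jT); rewrite -/(X u _) => h.
      have h1 : \sum_k X u k ^+ 2 <= 4 * ((sg * eta T) ^+ 2 * (C * (supf T + 1)) ^+ 2).
        by apply: (le_trans h); rewrite ler_wpM2l // ler_wpM2r ?sqr_ge0 // sje.
      have h2 : 8 * ((sg * eta T) ^+ 2 * (C * (supf T + 1)) ^+ 2) <= 1.
        rewrite [(sg * _) ^+ 2]exprMn [(C * _) ^+ 2]exprMn sg2.
        have -> : 8 * (alpha / (12 * C ^+ 2 * (eta T ^+ 2 * bt T)) * eta T ^+ 2 *
           (C ^+ 2 * (supf T + 1) ^+ 2)) = 8 * alpha * (supf T + 1) ^+ 2 / (12 * bt T).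
          by field; rewrite !gt_eqF.
        rewrite ler_pdivrMr ?mul1r; first exact: supf1_sqr_le.
        by rewrite mulr_gt0.
      by rewrite /=; lra.
    + move=> u; rewrite /x; under [X in _ <= X + _ + _]eq_bigr do rewrite sjS -mulrA.
      under [X in _ <= _ + 2 * X + _]eq_bigr do rewrite sjS -mulrA.
      rewrite !sum_sqrZ.
      have := ler_wpM2l (sqr_ge0 (sj j.+1)) (contraction_sqsum j (dev (zO o) j) u).
      rewrite !mulrDr; set a1' := \sum_k (_ - _) ^+ 2; move=> h; apply: (le_trans h).
      rewrite !sum_sqrZ le_eqVlt; apply/orP; left; apply/eqP; congr (_ + _ + _).
      * rewrite !mulr_sumr; apply: eq_bigr => k _; rewrite /X /w; ring.
      * rewrite !mulr_sumr; apply: eq_bigr => k _; rewrite /X /w; ring.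
    rewrite lee_fin mulrC ler_wpM2r ?expR_ge0 //.
    have := expR_ge1Dx (B j); rewrite /B => hB; apply: le_trans hB.
    by rewrite lerD2l; lra.
  - by move=> o; rewrite /F /dev /vbar /=; under eq_bigr do rewrite subr0 mulr0 expr0n;
      rewrite big1 // addr0 (_ : 4 = 2 ^+ 2) ?sqrtr_sqr ?ger0_norm // -natrX.
move/le_trans => /(_ (expR (7 / 3))%:E).
rewrite /F sjT; apply; rewrite lee_fin prod_expR -expRD ler_expR.
have : \sum_(j < T) B j <= \sum_(j < T) 4 * sg ^+ 2 * (C ^+ 2 / alpha) * (bt j.+1 / bt T * eta j.+1) ^+ 2.
  apply: ler_sum => j _; rewrite /B /sj.
  by rewrite le_eqVlt; apply/orP; left; apply/eqP; ring.
move=> h.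
have k0 : 0 <= 4 * sg ^+ 2 * (C ^+ 2 / alpha).
  apply: mulr_ge0; first by apply: mulr_ge0 => //; exact: sqr_ge0.
  by apply: divr_ge0; [exact: sqr_ge0 | exact: ltW].
have h2 := ler_wpM2l k0 (sum_ratio_sqr_le t0_ge2 eta0 eta_bt T).
(* The 12 in [devscale] is calibrated for this value: 4 is twice the Bernstein constant [k = 2] of
   the contraction. *)
have h3 : 4 * sg ^+ 2 * (C ^+ 2 / alpha) * (eta T ^+ 2 * bt T) = 1 / 3.
  by rewrite sg2; field; rewrite !gt_eqF.
rewrite mulr_sumr in h2; have := le_trans h h2; rewrite h3 => h4; rewrite -lerBrDl; apply: (le_trans h4); lra.
Qed.

(** [Q] has to dominate the largest increment and the standard deviation. The exponent 4 is the
    gauge at 0 plus twice the normalised variance. *)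
Lemma main_moment T Q : 0 < Q -> 2 * C ^+ 2 * eta T * (supf T + 1) <= Q ->
  mainvar T <= Q ^+ 2 ->
  (\int[P]_o (expR (Num.sqrt (4 + \sum_k (Q^-1 * main_noise T (zO o) T k) ^+ 2)))%:E
   <= (expR 4)%:E)%E.
Proof.
move=> Q0 hQ hV; have /andP[a0 a1] := alpha01.
have uQ : Q != 0 by rewrite gt_eqF.
have ua : alpha != 0 by rewrite gt_eqF.
pose F j o := expR (Num.sqrt (4 + \sum_k (Q^-1 * main_noise T (zO o) j k) ^+ 2)).
pose H j o u := expR (Num.sqrt (4 + \sum_k (Q^-1 *
   (main_noise T (zO o) j k - gain T j k * xi (vbar j) u k)) ^+ 2)).
pose V j := C ^+ 2 * gain2 T j * (dist2 j + tau ^+ 2)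
  + (4 * alpha ^+ 2)^-1 * \sum_k gain T j k ^+ 2 * mu k.
have key := @iter_expectation_le R _ _ O U P nu Z mZ indepZ lawZ T F H
  (fun j => expR (2 * (V j / Q ^+ 2))) (expR 2).
have : (\int[P]_o (F T o)%:E <= (expR 2 * \prod_(j < T) expR (2 * (V j / Q ^+ 2)))%:E)%E.
  apply: key.
  - move=> j jT; apply: measurable_expR_sqrt; apply: measurable_sqsum => k.
    apply: measurable_funM => //; apply: measurable_funB.
      apply: (@measurable_past_fst j _ _ (fun o => main_noise T (zO o) j k)).
      by apply: measurable_main_noise => i; exact: measurable_past_proj.
    by apply: measurable_funM => //; apply: measurable_xi; exact: measurable_snd.
  - move=> j _; apply: measurable_expR_sqrt; apply: measurable_sqsum => k.
    by apply: measurable_funM => //; apply: measurable_main_noise => i _; exact: mZ.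
  - move=> j o jT; rewrite /F /H; congr (expR (Num.sqrt (4 + _))).
    by apply: eq_bigr => k _; rewrite /main_noise big_ord_recr.
  - by move=> j o u; exact: expR_ge0.
  - by move=> j o; exact: expR_ge0.
  - by move=> j; exact: expR_ge0.
  - move=> j o jT.
    pose w (k : 'I_n) : R := - (Q^-1 * gain T j k).
    have wq k : w k ^+ 2 <= gain2 T j / Q ^+ 2.
      by rewrite sqrrN exprMn mulrC exprVn ler_wpM2r ?invr_ge0 ?sqr_ge0 // gain_sqr_le.
    have q0 : 0 <= gain2 T j / Q ^+ 2 by rewrite divr_ge0 ?gain2_ge0 ?sqr_ge0.
    pose x k := Q^-1 * main_noise T (zO o) j k.
    pose X u k := w k * xi (vbar j) u k.
    have bX k : bmeas (X ^~ k) by apply: bmeasZ; exact: bmeas_xi.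
    have EX k : E (X ^~ k) = 0 by rewrite expectZ ?expect_xi ?mulr0 //; exact: bmeas_xi.
    have EX2 : E (fun u => \sum_k X u k ^+ 2) <= V j / Q ^+ 2.
      apply: (le_trans (expect_wxi_le w (vbar j))).
      apply: (le_trans (var_zeta _ q0 wq)).
      rewrite le_eqVlt; apply/orP; left; apply/eqP.
      have -> : \sum_k w k ^+ 2 * mu k = (Q ^+ 2)^-1 * \sum_k gain T j k ^+ 2 * mu k.
        by rewrite mulr_sumr; apply: eq_bigr => k _; rewrite /w; field.
      rewrite /V -/(dist2 j).
      by field; rewrite ?ua ?uQ.
    apply: (le_trans (@bernstein_step R _ _ nu n 1 x X _ _ bX EX _ _ _ _)).
    + exact: lexx.
    + apply: measurable_sqsum => k; apply: measurable_funM => //; apply: measurable_funB => //.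
      by apply: measurable_funM => //; exact: measurable_xi.
    + by move=> u; exact: sqsum_ge0.
    + move=> u; have := wxi_sqsum_le q0 wq u (ltnW jT); rewrite -/(X u _) mul1r => h.
      apply: (le_trans h).
      have h1 : gain2 T j / Q ^+ 2 <= (eta T * C) ^+ 2 / Q ^+ 2.
        by rewrite ler_wpM2r ?invr_ge0 ?sqr_ge0 // gain2_le.
      have h2 := ler_wpM2r (sqr_ge0 (C * (supf T + 1))) h1.
      have h3 : 4 * ((eta T * C) ^+ 2 / Q ^+ 2 * (C * (supf T + 1)) ^+ 2) <= 1.
        have -> : 4 * ((eta T * C) ^+ 2 / Q ^+ 2 * (C * (supf T + 1)) ^+ 2) =
          (2 * C ^+ 2 * eta T * (supf T + 1) / Q) ^+ 2.
          by field.
        rewrite exprn_ile1 //.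
          rewrite divr_ge0 ?(ltW Q0) // mulr_ge0 //; last by have := supf_ge0 T; lra.
          by rewrite mulr_ge0 ?(ltW (eta0 _)) // mulr_ge0 // sqr_ge0.
        by rewrite ler_pdivrMr // mul1r.
      by apply: le_trans h3; rewrite ler_wpM2l.
    + move=> u; rewrite mul1r le_eqVlt; apply/orP; left; apply/eqP.
      rewrite mulr_sumr -!big_split /=; apply: eq_bigr => k _; rewrite /x /X /w; ring.
    rewrite lee_fin mulrC ler_wpM2r ?expR_ge0 // mulr1.
    apply: le_trans (expR_ge1Dx _); rewrite lerD2l; lra.
  - by move=> o; rewrite /F /main_noise; under eq_bigr do rewrite big_ord0 mulr0 expr0n;
      rewrite big1 // addr0 (_ : 4 = 2 ^+ 2) ?sqrtr_sqr ?ger0_norm // -natrX.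
move=> h; apply: (le_trans h); rewrite lee_fin (prod_expR T (fun j => 2 * (V j / Q ^+ 2))) -expRD ler_expR.
rewrite -mulr_sumr -mulr_suml -/(mainvar T).
have : mainvar T / Q ^+ 2 <= 1 by rewrite ler_pdivrMr ?exprn_gt0 // mul1r.
lra.
Qed.

(** The increments are bounded only through the past, so the exponential is compensated by the
    quadratic variation; the product is a supermartingale with factor 1 for every scale [sg]. *)
Lemma mult_moment T sg : 0 < sg ->
  (\int[P]_o (expR (Num.sqrt (4 + \sum_k (sg * mult_noise T (zO o) T k) ^+ 2))
     * expR (- (5 / 4 * sg ^+ 2 * qvar T (zO o) T)))%:E <= (expR 2)%:E)%E.
Proof.
move=> sg0.
pose G j o := expR (- (5 / 4 * sg ^+ 2 * qvar T (zO o) j)).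
pose F j o := expR (Num.sqrt (4 + \sum_k (sg * mult_noise T (zO o) j k) ^+ 2)) * G j o.
pose D j o := 4 * C ^+ 4 * gain2 T j * \sum_k dev (zO o) j k ^+ 2.
pose Y j o u := \sum_k (sg *
   (mult_noise T (zO o) j k - gain T j k * (zlin (dev (zO o) j) u k - E (zlin (dev (zO o) j) ^~ k)))) ^+ 2.
pose H j o u := expR (Num.sqrt (4 + Y j o u)) * (G j o * expR (- (5 / 4 * sg ^+ 2 * D j o))).
have D0 j o : 0 <= D j o.
  apply: mulr_ge0; last exact: sqsum_ge0.
  apply: mulr_ge0; last exact: gain2_ge0.
  by rewrite mulr_ge0 // exprn_ge0 // ltW.
have mY j k : (j < T)%N -> @measurable_fun _ _ (Ot j * U)%type R setT (fun x =>
   sg * (mult_noise T (zO x.1) j k - gain T j k *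
    (zlin (dev (zO x.1) j) x.2 k - E (zlin (dev (zO x.1) j) ^~ k)))).
  move=> jT; have md l : @measurable_fun _ _ (Ot j * U)%type R setT (fun x => dev (zO x.1) j l).
    apply: (@measurable_past_fst j _ _ (fun o => dev (zO o) j l)).
    by apply: measurable_dev => i; exact: measurable_past_proj.
  apply: measurable_funM => //; apply: measurable_funB.
    apply: (@measurable_past_fst j _ _ (fun o => mult_noise T (zO o) j k)).
    by apply: measurable_mult_noise => i; exact: measurable_past_proj.
  apply: measurable_funM => //; apply: measurable_funB.
    by apply: measurable_zlin => //; exact: measurable_snd.
  under [X in measurable_fun _ X]eq_fun do rewrite expect_zlin.
  exact: measurable_funM.
have mD j : @measurable_fun _ _ (Ot j) R setT (fun o => D j o).
  apply: measurable_funM => //; apply: measurable_sqsum => k.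
  by apply: measurable_dev => i; exact: measurable_past_proj.
have mG j : @measurable_fun _ _ (Ot j) R setT (fun o => G j o).
  apply: measurable_expRN.
  apply: measurable_funM => //.
  by apply: measurable_qvar => i; exact: measurable_past_proj.
have mEY j : (j < T)%N -> @measurable_fun _ _ (Ot j * U)%type R setT
    (fun x => expR (Num.sqrt (4 + Y j x.1 x.2))).
  move=> jT; apply: measurable_expR_sqrt; apply: measurable_sqsum => k; exact: mY.
have key := @iter_expectation_le R _ _ O U P nu Z mZ indepZ lawZ T F H (fun=> 1) (expR 2).
have : (\int[P]_o (F T o)%:E <= (expR 2 * \prod_(j < T) 1)%:E)%E.
  apply: key.
  - move=> j jT; apply: measurable_funM; first exact: mEY.
    apply: (@measurable_past_fst j _ _ (fun o => G j o * expR (- (5 / 4 * sg ^+ 2 * D j o)))).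
    apply: measurable_funM => //.
    apply: measurable_expRN.
    exact: measurable_funM.
  - move=> j _; apply: measurable_funM.
      apply: measurable_expR_sqrt; apply: measurable_sqsum => k.
      by apply: measurable_funM => //; apply: measurable_mult_noise => i _; exact: mZ.
    apply: measurable_expRN.
    by apply: measurable_funM => //; apply: measurable_qvar => i _; exact: mZ.
  - move=> j o jT; rewrite /F /H; congr (expR (Num.sqrt (4 + _)) * _).
      by apply: eq_bigr => k _; rewrite /mult_noise big_ord_recr.
    rewrite /G -expRD; congr expR; rewrite /qvar big_ord_recr /= -/(D j o); ring.
  - by move=> j o u; rewrite !mulr_ge0 ?expR_ge0.
  - by move=> j o; rewrite !mulr_ge0 ?expR_ge0.
  - by [].
  - move=> j o jT.
    pose w (k : 'I_n) : R := - (sg * gain T j k).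
    have wq k : w k ^+ 2 <= sg ^+ 2 * gain2 T j.
      by rewrite sqrrN exprMn ler_wpM2l ?sqr_ge0 // gain_sqr_le.
    have q0 : 0 <= sg ^+ 2 * gain2 T j by rewrite mulr_ge0 ?gain2_ge0 ?sqr_ge0.
    pose x k := sg * mult_noise T (zO o) j k.
    pose X u k := w k * (zlin (dev (zO o) j) u k - E (zlin (dev (zO o) j) ^~ k)).
    have bz k : bmeas (fun u => zlin (dev (zO o) j) u k) by exact: (bmeas_zlin alpha C0).
    have bX k : bmeas (X ^~ k).
      by apply: bmeasZ; apply: (bmeas_center nu (X := zlin (dev (zO o) j))).
    have EX k : E (X ^~ k) = 0.
      rewrite expectZ; last exact: (bmeas_center nu (X := zlin (dev (zO o) j))).
      by rewrite (expect_center nu (X := zlin (dev (zO o) j))) // mulr0.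
    pose c := Num.sqrt (sg ^+ 2 * D j o).
    have c2 : c ^+ 2 = sg ^+ 2 * D j o by rewrite sqr_sqrtr // mulr_ge0 // sqr_ge0.
    have step : (\int[nu]_u (expR (Num.sqrt (4 + Y j o u)))%:E <=
       (expR (Num.sqrt (4 + \sum_k x k ^+ 2)) * expR (5 / 4 * c ^+ 2))%:E)%E.
      apply: (@azuma_step R _ _ nu n c x X _ _ bX EX) => //.
      + exact: sqrtr_ge0.
      + apply: measurable_sqsum => k; apply: measurable_funM => //; apply: measurable_funB => //.
        apply: measurable_funM => //; apply: measurable_funB => //; exact: (bz k).1.
      + by move=> u; exact: sqsum_ge0.
      + move=> u; have := wzlin_center_le q0 wq (dev (zO o) j) u; rewrite -/(X u _) => h.
        by apply: (le_trans h); rewrite c2 /D le_eqVlt; apply/orP; left; apply/eqP; ring.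
      + move=> u; rewrite le_eqVlt; apply/orP; left; apply/eqP.
        rewrite mulr_sumr -!big_split /=; apply: eq_bigr => k _; rewrite /x /X /w; ring.
    pose K := G j o * expR (- (5 / 4 * sg ^+ 2 * D j o)).
    have K0 : 0 <= K by rewrite mulr_ge0 ?expR_ge0.
    have -> : (\int[nu]_u (H j o u)%:E = K%:E * \int[nu]_u (expR (Num.sqrt (4 + Y j o u)))%:E)%E.
      rewrite -ge0_integralZl ?lee_fin //.
      - by apply: eq_integral => u _; rewrite -EFinM; congr EFin; rewrite mulrC.
      - apply/measurable_EFinP; apply: measurable_expR_sqrt; apply: measurable_sqsum => k.
        apply: measurable_funM => //; apply: measurable_funB => //.
        by apply: measurable_funM => //; apply: measurable_funB => //; exact: (bz k).1.
    apply: (@le_trans _ _ (K%:E * (expR (Num.sqrt (4 + \sum_k x k ^+ 2)) * expR (5 / 4 * c ^+ 2))%:E)%E).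
      by apply: lee_wpmul2l => //; rewrite lee_fin.
    rewrite -EFinM lee_fin mul1r /K /F c2.
    rewrite le_eqVlt; apply/orP; left; apply/eqP.
    have := expRxMexpNx_1 (5 / 4 * sg ^+ 2 * D j o).
    have -> : 5 / 4 * (sg ^+ 2 * D j o) = 5 / 4 * sg ^+ 2 * D j o by ring.
    move: (expR (5 / 4 * sg ^+ 2 * D j o)) (expR (- (5 / 4 * sg ^+ 2 * D j o))) => y y' yy.
    rewrite mulrACA [y' * y]mulrC yy mulr1 mulrC; congr (expR (Num.sqrt (4 + _)) * _).
  - move=> o; rewrite /F /G /mult_noise /qvar big_ord0 mulr0 oppr0 expR0 mulr1.
    by under eq_bigr do rewrite big_ord0 mulr0 expr0n; 
      rewrite big1 // addr0 (_ : 4 = 2 ^+ 2) ?sqrtr_sqr ?ger0_norm // -natrX.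
by rewrite big1 // mulr1.
Qed.

(* Jensen with the convex function of [expR_sqrt_tangent] replaces a union bound over the times [i]. *)
Lemma qvar_moment T W : 0 < W ->
  48 * C ^+ 6 / alpha * (\sum_(i < T) gain2 T i * (eta i ^+ 2 * bt i)) <= W ->
  (\int[P]_o (expR (Num.sqrt (4 + W^-1 * qvar T (zO o) T)))%:E <= (expR (7 / 3))%:E)%E.
Proof.
move=> W0 hW; have /andP[a0 a1] := alpha01.
(* Weights that write [qvar / W] as a sub-convex combination of the normalised squared deviations;
   48 is 4 from [qvar] times 12 from [devscale]. The missing mass is placed at 0. *)
pose om (i : 'I_T) := 48 * C ^+ 6 / alpha * (gain2 T i * (eta i ^+ 2 * bt i)) / W.
have om0 i : 0 <= om i.
  rewrite divr_ge0 ?(ltW W0) //; apply: mulr_ge0.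
    apply: divr_ge0; last exact: ltW.
    by apply: mulr_ge0 => //; apply: exprn_ge0; exact: ltW.
  by rewrite mulr_ge0 ?gain2_ge0 // ltW // rate_ge0.
have om1 : \sum_i om i <= 1.
  by rewrite /om -mulr_suml -mulr_sumr ler_pdivrMr // mul1r.
pose y (i : 'I_T) o := \sum_k (devscale i * dev (zO o) i k) ^+ 2.
have y0 i o : 0 <= y i o by exact: sqsum_ge0.
have qE o : W^-1 * qvar T (zO o) T = \sum_i om i * y i o.
  rewrite /qvar mulr_sumr; apply: eq_bigr => i _.
  rewrite /om /y sum_sqrZ devscale_sqr.
  have uW : W != 0 by rewrite gt_eqF.
  have uC : C != 0 by rewrite gt_eqF.
  have ub := bt_neq0 t0_ge2 i; have ue : eta i != 0 by rewrite gt_eqF.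
  have ua : alpha != 0 by rewrite gt_eqF.
  by field; rewrite uW uC ub ue ua.
have Y0 o : 0 <= \sum_i om i * y i o by apply: sumr_ge0 => i _; exact: mulr_ge0.
have s4 : Num.sqrt (4 + 0) = 2 :> R by rewrite addr0 (_ : 4 = 2 ^+ 2) ?sqrtr_sqr ?ger0_norm // -natrX.
have jensen o : expR (Num.sqrt (4 + W^-1 * qvar T (zO o) T)) <=
  \sum_i om i * expR (Num.sqrt (4 + y i o)) + (1 - \sum_i om i) * expR 2.
  rewrite qE; set S := \sum_i om i * y i o.
  set e := expR (Num.sqrt (4 + S)); set c := e / (2 * Num.sqrt (4 + S)).
  have h i : om i * (e + c * (y i o - S)) <= om i * expR (Num.sqrt (4 + y i o)).
    by rewrite ler_wpM2l // expR_sqrt_tangent // Y0.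
  have h0 : (1 - \sum_i om i) * (e + c * (0 - S)) <= (1 - \sum_i om i) * expR 2.
    have := expR_sqrt_tangent (Y0 o) (lexx 0); rewrite s4 => ht.
    by apply: ler_wpM2l; [rewrite subr_ge0 | exact: ht].
  have h1 : \sum_i om i * (e + c * (y i o - S)) <= \sum_i om i * expR (Num.sqrt (4 + y i o)).
    by apply: ler_sum => i _; exact: h.
  have h2 : \sum_i om i * (e + c * (y i o - S)) = (\sum_i om i) * (e - c * S) + c * S.
    transitivity (\sum_i (om i * (e - c * S) + c * (om i * y i o))).
      by apply: eq_bigr => i _; ring.
    by rewrite big_split /= -mulr_suml -mulr_sumr.
  move: h0 h1; rewrite h2; move: (\sum_i om i) => o1; lra.
have mdev i k : measurable_fun setT (fun o => dev (zO o) i k).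
  by apply: measurable_dev => j _; exact: mZ.
have my i : measurable_fun setT (fun o => expR (Num.sqrt (4 + y i o))).
  by apply: measurable_expR_sqrt; apply: measurable_sqsum => k; exact: measurable_funM.
apply: (@le_trans _ _ (\int[P]_o (\sum_i (om i)%:E * (expR (Num.sqrt (4 + y i o)))%:E
   + ((1 - \sum_i om i) * expR 2)%:E))%E).
  apply: ge0_le_integral => //.
  - apply/measurable_EFinP; apply: measurable_expR_sqrt; apply: measurable_funM => //.
    by apply: measurable_qvar => j _; exact: mZ.
  - apply: emeasurable_funD => //; apply: emeasurable_sum => i.
    by apply: emeasurable_funM => //; exact/measurable_EFinP.
  - move=> o _; rewrite (le_trans _ (_ : (\sum_i om i * expR (Num.sqrt (4 + y i o)) + (1 - \sum_i om i) * expR 2)%:E <= _)%E) //.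
      by rewrite lee_fin.
    by rewrite EFinD -sumEFin.
rewrite ge0_integralD //.
- rewrite integral_cst // [X in (_ + _ * X)%E](_ : _ = 1%E); last exact: probability_setT.
  rewrite mule1 ge0_integral_sum //.
  + apply: (@le_trans _ _ (\sum_i (om i * expR (7 / 3))%:E + ((1 - \sum_i om i) * expR 2)%:E)%E).
      apply: leeD => //; apply: lee_sum => i _.
      rewrite ge0_integralZl ?lee_fin //.
      * rewrite [leRHS]EFinM lee_wpmul2l ?lee_fin //; exact: dev_moment.
      * exact/measurable_EFinP.
    rewrite sumEFin -EFinD lee_fin -mulr_suml.
    have h : expR 2 <= expR (7 / 3) :> R by rewrite ler_expR; lra.
    have := ler_wpM2l (_ : 0 <= 1 - \sum_i om i) h; rewrite subr_ge0 => /(_ om1).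
    lra.
  + by move=> i; apply: emeasurable_funM => //; exact/measurable_EFinP.
  + by move=> i o _; rewrite -EFinM lee_fin mulr_ge0 // expR_ge0.
- by move=> o _; apply: sume_ge0 => i _; rewrite -EFinM lee_fin mulr_ge0 // expR_ge0.
- by apply: emeasurable_sum => i; apply: emeasurable_funM => //; exact/measurable_EFinP.
- by move=> o _; rewrite lee_fin mulr_ge0 ?expR_ge0 // subr_ge0.
Qed.

Variables (gam : R) (g pw : 'I_n -> R).
Hypothesis L0 : forall j, 0 < L j.
Hypothesis L_dec : forall j, L j.+1 <= L j.
Hypothesis L_step : forall j,
  L j * (1 - (bt j.+1)^-1) <= L j.+1 * (1 - 2 / 3 * (bt j.+1)^-1).
Hypothesis tau0 : 0 <= tau.
Hypothesis gam0 : 0 <= gam.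
Hypothesis g_le : \sum_k g k ^+ 2 <= gam ^+ 2.
Hypothesis rrE : forall k, rr k = pw k * g k.
Hypothesis pw0 : forall k, 0 <= pw k.
Hypothesis pw_le : forall k i, pw k <= L i * (1 + 3 / 2 * (eta i * bt i) * mu k).

Definition ebound i : R := t0 / bt i * Num.sqrt alpha^-1 + 3 / 2 * gam * L i + tau.

Lemma ebound_gt0 i : 0 < ebound i.
Proof.
have t2 := t0_ge2; have aV := alphaV_ge1.
have h1 : 0 < t0 / bt i * Num.sqrt alpha^-1.
  rewrite mulr_gt0 ?divr_gt0 ?bt_gt0 ?sqrtr_gt0 //; lra.
have h2 : 0 <= 3 / 2 * gam * L i by rewrite mulr_ge0 ?(ltW (L0 i)) // mulr_ge0.
rewrite /ebound; have := tau0; lra.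
Qed.

Lemma enorm_bias_le i :
  enorm (fun k => Num.sqrt (mu k) * vbar i k - rr k) <=
  t0 / bt i * Num.sqrt alpha^-1 + 3 / 2 * gam * L i.
Proof.
have t2 := t0_ge2.
have q0 : 0 <= t0 / bt i by rewrite divr_ge0 ?bt_ge0 //; lra.
have l0 : 0 <= 3 / 2 * L i by rewrite mulr_ge0 // ltW.
apply: (@le_trans _ _ (enorm (fun k => t0 / bt i * `|rr k| + 3 / 2 * L i * `|g k|))).
  apply: ler_enorm => k; rewrite meanE // normrN normrM.
  rewrite [leRHS]ger0_norm; last by rewrite addr_ge0 // mulr_ge0.
  rewrite (ger0_norm (bias_ge0 t0_ge2 eta0 etaC (mu_le k) i)).
  have := bias_mul_le t0_ge2 eta0 etaC L0 L_dec L_step (mu0 k) (mu_le k) i (pw0 k) (pw_le k).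
  move=> /(ler_wpM2r (normr_ge0 (g k))).
  by rewrite rrE normrM (ger0_norm (pw0 k)); lra.
apply: (le_trans (enormD _ _)); rewrite !enormZ //.
have nr : enorm (fun k => `|rr k|) <= Num.sqrt alpha^-1.
  apply: enorm_le; first exact: sqrtr_ge0.
  rewrite sqr_sqrtr; last by have := alphaV_ge1; lra.
  under eq_bigr do rewrite real_normK ?num_real //.
  by apply: le_trans rr_le; rewrite lerDl sqr_ge0.
have ng : enorm (fun k => `|g k|) <= gam.
  by apply: enorm_le => //; under eq_bigr do rewrite real_normK ?num_real //.
have := ler_wpM2l q0 nr; have := ler_wpM2l l0 ng; lra.
Qed.

(** One factor of the square is bounded by the norm of the ratio, the other by the error. The bound
    must be linear in [ebound]: [sum_bias_gain_le] requires [bt * e] not to decrease, which fails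
    for the square of the term [t0 / bt]. *)
Lemma dist2_ebound i : dist2 i + tau ^+ 2 <= Num.sqrt alpha^-1 * ebound i.
Proof.
have d0 : 0 <= dist2 i by exact: sqsum_ge0.
have t2 := sqr_ge0 tau.
set x := Num.sqrt (dist2 i + tau ^+ 2).
have x2 : x ^+ 2 = dist2 i + tau ^+ 2 by rewrite sqr_sqrtr // addr_ge0.
have x0 : 0 <= x := sqrtr_ge0 _.
rewrite -x2 expr2; apply: ler_pM => //.
  rewrite /x ler_wsqrtr //; apply: le_trans rr_le; rewrite lerD2r; exact: dist2_le.
have h := enorm_bias_le i.
set y := enorm _ in h; have y0 : 0 <= y := enorm_ge0 _.
have y2 : y ^+ 2 = dist2 i by exact: sqr_enorm.
apply: (@le_trans _ _ (y + tau)); last by rewrite /ebound; lra.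
rewrite -ler_sqr ?nnegrE ?addr_ge0 ?tau0 // x2.
by rewrite sqrrD y2; have := mulr_ge0 y0 tau0; lra.
Qed.

Definition Lg T : R := ln (1 + C ^+ 2 * tail eta T 0).

Lemma Lg_ge0 T : 0 <= Lg T.
Proof.
by apply: ln_ge0; rewrite lerDl mulr_ge0 ?sqr_ge0 // tail_ge0.
Qed.

Lemma mainvar_le T : mainvar T <=
  (15 / 8 * C ^+ 2 * eta T * Lg T * Num.sqrt alpha^-1) * ebound T
  + C ^+ 2 * eta T / (4 * alpha ^+ 2).
Proof.
rewrite /mainvar big_split /=; apply: lerD.
  apply: (@le_trans _ _ (C ^+ 2 * Num.sqrt alpha^-1 * \sum_(i < T) gain2 T i * ebound i)).
    rewrite mulr_sumr; apply: ler_sum => i _.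
    have c0 : 0 <= C ^+ 2 * gain2 T i by rewrite mulr_ge0 ?gain2_ge0 ?sqr_ge0.
    by have := ler_wpM2l c0 (dist2_ebound i); lra.
  have c0 : 0 <= C ^+ 2 * Num.sqrt alpha^-1 by rewrite mulr_ge0 ?sqr_ge0 ?sqrtr_ge0.
  have h1 i : (i < T)%N -> 0 <= ebound i by move=> _; rewrite ltW // ebound_gt0.
  have h2 i : (i < T)%N -> bt i * ebound i <= bt T * ebound T.
    move=> /ltnW iT; rewrite /ebound.
    have E j : bt j * (t0 / bt j * Num.sqrt alpha^-1 + 3 / 2 * gam * L j + tau) =
      t0 * Num.sqrt alpha^-1 + 3 / 2 * gam * (bt j * L j) + bt j * tau.
      by field; exact: bt_neq0.
    rewrite !E; apply: lerD; first apply: lerD => //.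
      by apply: ler_wpM2l; [rewrite mulr_ge0 | exact: bt_L_mono].
    by apply: ler_wpM2r => //; rewrite /bt lerD2r ler_nat.
  have := ler_wpM2l c0 (sum_bias_gain_le t0_ge2 eta0 eta_bt etaC h1 h2).
  by move/le_trans; apply; rewrite -/(Lg T); lra.
rewrite -mulr_sumr mulrC.
have a4 : 0 <= (4 * alpha ^+ 2)^-1 by rewrite invr_ge0 mulr_ge0 ?sqr_ge0.
apply: ler_wpM2r => //.
(* Summing over time first allows [gain_sqsum_le] for each eigenvalue; the trace bound then sums
   over the eigenvalues. *)
rewrite exchange_big /=.
apply: (@le_trans _ _ (\sum_k eta T * mu k)).
  apply: ler_sum => k _.
  have := gain_sqsum_le t0_ge2 eta0 eta_dec eta_bt etaC (mu0 k) (mu_le k) T.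
  move/(le_trans _); apply; rewrite le_eqVlt; apply/orP; left; apply/eqP.
  apply: eq_bigr => i _; rewrite /gain [in LHS]exprMn sqr_sqrtr //; ring.
by rewrite -mulr_sumr mulrC ler_wpM2r // ltW.
Qed.

Definition core_bound T ell : R :=
  2 * ebound T + 8 * ell * C * Num.sqrt (eta T) / alpha
  + 16 * ell * C ^+ 2 * eta T * supf T
  + 30 * ell ^+ 2 * C ^+ 2 * eta T * Lg T * Num.sqrt alpha^-1
  + 35 * ell ^+ 2 * Num.sqrt (90 * C ^+ 6 / alpha * (eta T ^+ 3 * bt T * ln (bt T))).

(** Markov's inequality is applied to three exponential moments: main noise, compensated
    multiplicative noise, and quadratic variation. *)
Theorem core_tail T delta : 0 < delta < 1 ->
  exists E : set O, [/\ measurable E, ((1 - delta)%:E <= P E)%E &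
    forall o, E o ->
      enorm (fun k => Num.sqrt (mu k) * iter (zO o) T k - rr k) <= core_bound T (ln (2 / delta))].
Proof.
move=> /andP[d0 d1]; have /andP[a0 a1] := alpha01.
set ell := ln (2 / delta).
have ell_ge : 2 / 3 <= ell.
  apply: (le_trans (@ln2_ge R)); rewrite ler_ln ?posrE ?divr_gt0 //.
  by rewrite ler_pdivlMr //; lra.
(* Each of the three bad events gets probability [delta / 3]. The excess [ln (3/2) <= 1/2] and the
   other additive constants are absorbed into multiples of [ell] since [ell >= 2/3]. *)
set l3 := ln (3 / delta).
have l3_le : l3 <= ell + 1 / 2.
  rewrite /l3 /ell.
  have -> : 3 / delta = 2 / delta * (1 + 1 / 2) by field; rewrite gt_eqF.
  rewrite lnM ?posrE ?divr_gt0 //.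
  have hm : - 1 < 1 / 2 :> R by lra.
  by have := le_ln1Dx hm; lra.
have l3_ge : 0 <= l3.
  by apply: ln_ge0; rewrite ler_pdivlMr //; lra.
have e3 : expR l3 = 3 / delta by rewrite lnK // posrE divr_gt0.
have tailE c : 0 < c -> c / (c * expR l3) = delta / 3.
  by move=> c0; rewrite e3; field; rewrite !gt_eqF.
have eT := eta0 T; have bT := bt_gt0 t0_ge2 T; have bT2 := bt_ge2 t0_ge2 T.
have lnb : 0 < ln (bt T) by apply: ln_gt0; lra.
set X := 15 / 8 * C ^+ 2 * eta T * Lg T * Num.sqrt alpha^-1.
have X0 : 0 <= X.
  apply: mulr_ge0; last exact: sqrtr_ge0.
  apply: mulr_ge0; last exact: Lg_ge0.
  apply: mulr_ge0; last exact: ltW.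
  by apply: mulr_ge0 => //; exact: sqr_ge0.
have e0 := ebound_gt0 T.
set s := Num.sqrt (eta T); have s2 : s ^+ 2 = eta T by rewrite sqr_sqrtr // ltW.
have s0 : 0 < s by rewrite sqrtr_gt0.
have Cs : C * s <= 1 / 2.
  rewrite -ler_sqr ?nnegrE ?mulr_ge0 ?(ltW C0) ?(ltW s0) //.
  by rewrite exprMn s2 mulrC; have := etaC T; lra.
have Cs0 : 0 < C * s by rewrite mulr_gt0.
have Csa : C * s <= C * s / alpha by rewrite ler_pdivlMr // ler_piMr // ltW.
set m2 := 2 * C ^+ 2 * eta T * supf T.
have m20 : 0 <= m2.
  apply: mulr_ge0; last exact: supf_ge0.
  apply: mulr_ge0; last exact: ltW.
  by apply: mulr_ge0 => //; exact: sqr_ge0.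
have ea0 : 0 < ebound T / (8 * ell) by rewrite divr_gt0 // mulr_gt0 //; lra.
have X1 : 0 <= 2 * ell * X by rewrite mulr_ge0 //; lra.
(* [C s / alpha] covers the part of the variance that does not vanish, [m2] the increments. The
   bracket covers [X * ebound T] by the arithmetic-geometric inequality, weighted so that [8 ell Q]
   contains [ebound T] exactly once. *)
set Q := C * s / alpha + m2 + (ebound T / (8 * ell) + 2 * ell * X).
have Q0 : 0 < Q by rewrite /Q; lra.
have hQ1 : 2 * C ^+ 2 * eta T * (supf T + 1) <= Q.
  have -> : 2 * C ^+ 2 * eta T * (supf T + 1) = m2 + 2 * (C * s) ^+ 2.
    by rewrite exprMn s2 /m2; ring.
  have : 2 * (C * s) ^+ 2 <= C * s by nra.
  by rewrite /Q; lra.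
have hQ2 : mainvar T <= Q ^+ 2.
  apply: (le_trans (mainvar_le T)); rewrite -/X.
  have h1 : C ^+ 2 * eta T / (4 * alpha ^+ 2) <= (C * s / alpha) ^+ 2.
    have -> : C ^+ 2 * eta T / (4 * alpha ^+ 2) = (C * s / alpha) ^+ 2 / 4.
      by rewrite -s2; field; rewrite gt_eqF.
    by have := sqr_ge0 (C * s / alpha); lra.
  have h2 : X * ebound T <= (ebound T / (8 * ell) + 2 * ell * X) ^+ 2.
    have -> : X * ebound T = 4 * (ebound T / (8 * ell)) * (2 * ell * X).
      by field; rewrite gt_eqF //; lra.
    by have := sqr_ge0 (ebound T / (8 * ell) - 2 * ell * X); nra.
  have p0 : 0 <= C * s / alpha by rewrite (le_trans (ltW Cs0)).
  have q0 : 0 <= ebound T / (8 * ell) + 2 * ell * X by lra.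
  rewrite /Q; move: p0 q0 h1 h2 m20.
  move: (C * s / alpha) (ebound T / (8 * ell) + 2 * ell * X) => p q p0 q0 h1 h2 m20.
  have := mulr_ge0 p0 q0; have := mulr_ge0 p0 m20; have := mulr_ge0 m20 q0.
  have := sqr_ge0 m2; nra.
(* 90 is 48 from [qvar_moment] times 15/8 from [sum_azuma_le]. *)
set W := 90 * C ^+ 6 / alpha * (eta T ^+ 3 * bt T * ln (bt T)).
have C6 : 0 < C ^+ 6 / alpha by rewrite divr_gt0 // exprn_gt0.
have W0 : 0 < W.
  rewrite /W -[90 * _ / _]mulrA; apply: mulr_gt0; first exact: mulr_gt0.
  by apply: mulr_gt0 => //; apply: mulr_gt0 => //; exact: exprn_gt0.
have hW : 48 * C ^+ 6 / alpha * (\sum_(i < T) gain2 T i * (eta i ^+ 2 * bt i)) <= W.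
  have h := sum_azuma_le t0_ge2 eta0 eta_bt etaC T.
  have hL : Lg T <= ln (bt T).
    rewrite ler_ln ?posrE //; last first.
      by have := mulr_ge0 (sqr_ge0 C) (tail_ge0 eta0 T 0); lra.
    exact: tail0_le_bt.
  have k0 : 0 <= 15 / 8 * eta T ^+ 3 * bt T.
    apply: mulr_ge0; last exact: ltW.
    by apply: mulr_ge0 => //; apply: exprn_ge0; exact: ltW.
  have h1 := le_trans h (ler_wpM2l k0 hL).
  have k1 : 0 <= 48 * (C ^+ 6 / alpha) by rewrite mulr_ge0 // ltW.
  by have := ler_wpM2l k1 h1; rewrite /W /gain2; lra.
set z := 7 / 3 + l3; have z0 : 0 < z by rewrite /z; lra.
set w := Num.sqrt W; have w2 : w ^+ 2 = W by rewrite sqr_sqrtr // ltW.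
have w0 : 0 < w by rewrite sqrtr_gt0.
(* Outside the third event [qvar] is at most [(w z)^2], so with this scale the compensator costs no
   more than 5/4. *)
set sg := (w * z)^-1; have sg0 : 0 < sg by rewrite invr_gt0 mulr_gt0.
pose F1 o := expR (Num.sqrt (4 + \sum_k (Q^-1 * main_noise T (zO o) T k) ^+ 2)).
pose F2 o := expR (Num.sqrt (4 + \sum_k (sg * mult_noise T (zO o) T k) ^+ 2))
     * expR (- (5 / 4 * sg ^+ 2 * qvar T (zO o) T)).
pose F3 o := expR (Num.sqrt (4 + W^-1 * qvar T (zO o) T)).
have mF1 : measurable_fun setT F1.
  apply: measurable_expR_sqrt; apply: measurable_sqsum => k; apply: measurable_funM => //.
  by apply: measurable_main_noise => i _; exact: mZ.
have mq : measurable_fun setT (fun o => qvar T (zO o) T).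
  by apply: measurable_qvar => i _; exact: mZ.
have mF2 : measurable_fun setT F2.
  apply: measurable_funM; last by apply: measurable_expRN; exact: measurable_funM.
  apply: measurable_expR_sqrt; apply: measurable_sqsum => k; apply: measurable_funM => //.
  by apply: measurable_mult_noise => i _; exact: mZ.
have mF3 : measurable_fun setT F3 by apply: measurable_expR_sqrt; exact: measurable_funM.
have pe c : 0 < expR c * expR l3 by rewrite mulr_gt0 ?expR_gt0.
have [mB1 PB1] := markov_tail mF1 (fun=> expR_ge0 _) (pe 4) (main_moment Q0 hQ1 hQ2).
have [mB2 PB2] := markov_tail mF2 (fun=> mulr_ge0 (expR_ge0 _) (expR_ge0 _)) (pe 2) (mult_moment T sg0).
have [mB3 PB3] := markov_tail mF3 (fun=> expR_ge0 _) (pe (7 / 3)) (qvar_moment W0 hW).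
rewrite !tailE ?expR_gt0 // in PB1 PB2 PB3.
set B1 := [set o | _] in mB1 PB1; set B2 := [set o | _] in mB2 PB2; set B3 := [set o | _] in mB3 PB3.
have mB : measurable (B1 `|` B2 `|` B3) by apply: measurableU => //; exact: measurableU.
exists (~` (B1 `|` B2 `|` B3)); split; first exact: measurableC.
  rewrite probability_setC // EFinB leeB //.
  apply: (le_trans (measureU2 _ _ _)) => //; first exact: measurableU.
  apply: (@le_trans _ _ ((delta / 3)%:E + (delta / 3)%:E + (delta / 3)%:E)%E).
    apply: leeD => //; apply: (le_trans (measureU2 _ _ _)) => //; exact: leeD.
  by rewrite -!EFinD lee_fin; lra.
move=> o nB.
have n1 : F1 o <= expR 4 * expR l3.
  by rewrite leNgt; apply/negP => h; apply: nB; left; left.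
have n2 : F2 o <= expR 2 * expR l3.
  by rewrite leNgt; apply/negP => h; apply: nB; left; right.
have n3 : F3 o <= expR (7 / 3) * expR l3.
  by rewrite leNgt; apply/negP => h; apply: nB; right.
have le_sqrt4 (c x y : R) : 0 < c -> 0 <= x -> Num.sqrt (4 + (c * x) ^+ 2) <= y -> x <= y / c.
  move=> c0 x0 h; rewrite ler_pdivlMr // mulrC.
  apply: le_trans h; rewrite -[leLHS]ger0_norm ?mulr_ge0 ?(ltW c0) //.
  rewrite -sqrtr_sqr ler_wsqrtr //; lra.
have main_le : enorm (main_noise T (zO o) T) <= 8 * ell * Q.
  move: n1; rewrite /F1 -expRD ler_expR sum_sqrZ -sqr_enorm -exprMn.
  have Qi : 0 < Q^-1 by rewrite invr_gt0.
  move=> /(le_sqrt4 Q^-1 _ _ Qi (enorm_ge0 _)); rewrite invrK.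
  move/le_trans; apply; rewrite ler_pM2r //; lra.
have q_le : qvar T (zO o) T <= (w * z) ^+ 2.
  move: n3; rewrite /F3 -expRD ler_expR -/z => h.
  have q0 : 0 <= qvar T (zO o) T.
    apply: sumr_ge0 => i _; apply: mulr_ge0; last exact: sqsum_ge0.
    apply: mulr_ge0; last exact: gain2_ge0.
    by rewrite mulr_ge0 // exprn_ge0 // ltW.
  have v0 : 0 <= W^-1 * qvar T (zO o) T by rewrite mulr_ge0 // invr_ge0 ltW.
  have : Num.sqrt (4 + W^-1 * qvar T (zO o) T) ^+ 2 <= z ^+ 2.
    by rewrite ler_sqr ?nnegrE ?sqrtr_ge0 // ltW.
  rewrite sqr_sqrtr; last lra.
  move=> h2; have h3 : W^-1 * qvar T (zO o) T <= z ^+ 2 by lra.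
  by rewrite exprMn w2 -ler_pdivrMl.
(* One logarithm comes from Markov's inequality for this noise, the other from the scale [w z]. The
   constant 35 rounds up [53/8 * 21/4]. *)
have mult_le : enorm (mult_noise T (zO o) T) <= 35 * ell ^+ 2 * w.
  move: n2; rewrite /F2 -!expRD ler_expR sum_sqrZ -sqr_enorm -exprMn => h.
  have h1 : 5 / 4 * sg ^+ 2 * qvar T (zO o) T <= 5 / 4.
    rewrite -mulrA ler_piMr //.
    rewrite /sg exprVn mulrC ler_pdivrMr ?mul1r ?exprn_gt0 //; exact: mulr_gt0.
  have h2 : Num.sqrt (4 + (sg * enorm (mult_noise T (zO o) T)) ^+ 2) <= 13 / 4 + l3 by lra.
  have := le_sqrt4 sg _ _ sg0 (enorm_ge0 _) h2; rewrite /sg invrK.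
  move/le_trans; apply.
  have -> : (13 / 4 + l3) * (w * z) = ((13 / 4 + l3) * z) * w by ring.
  rewrite ler_pM2r //.
  have y1 : 13 / 4 + l3 <= 53 / 8 * ell by lra.
  have y2 : z <= 21 / 4 * ell by rewrite /z; lra.
  apply: (@le_trans _ _ ((53 / 8 * ell) * (21 / 4 * ell))).
    by apply: ler_pM; [lra|lra|exact: y1|exact: y2].
  have -> : 53 / 8 * ell * (21 / 4 * ell) = 53 / 8 * (21 / 4) * ell ^+ 2 by ring.
  by apply: ler_wpM2r; [exact: sqr_ge0|lra].
apply: (@le_trans _ _ (enorm (fun k => Num.sqrt (mu k) * vbar T k - rr k)
   + (enorm (main_noise T (zO o) T) + enorm (mult_noise T (zO o) T)))).
  apply: le_trans (_ : enorm (fun k => (Num.sqrt (mu k) * vbar T k - rr k) +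
     (main_noise T (zO o) T k + mult_noise T (zO o) T k)) <= _).
    apply: ler_enorm => k; rewrite -dev_final /dev le_eqVlt; apply/orP; left; apply/eqP.
    by congr (`|_|); ring.
  by apply: (le_trans (enormD _ _)); rewrite lerD2l enormD.
have h8 : 8 * ell * Q = 8 * ell * C * s / alpha + 16 * ell * C ^+ 2 * eta T * supf T
   + ebound T + 30 * ell ^+ 2 * C ^+ 2 * eta T * Lg T * Num.sqrt alpha^-1.
  rewrite /Q /m2 /X; field; rewrite !gt_eqF //; lra.
have := enorm_bias_le T; rewrite /core_bound -/W -/w -/s.
have : t0 / bt T * Num.sqrt alpha^-1 + 3 / 2 * gam * L T <= ebound T.
  by rewrite /ebound lerDl.
rewrite h8 in main_le; lra.
Qed.

End Processes.

(** * Mean and variance of the stochastic gradient under the mixture *)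

Section MixtureMoments.
Context {R : realType} {n : nat} {dT : measure_display} {T : measurableType dT}.
Variable nu : probability (T * T)%type R.
Variables (phi : 'I_n -> T -> R) (r : T -> R) (alpha C : R).
Variables (mu rr : 'I_n -> R) (tau : R).
Local Notation E f := (\int[nu]_u (f u)).
Implicit Types (h f : T -> R) (v w : 'I_n -> R).

(** The expectation under [p^alpha], expressed through the two marginals of the law of a pair; the
    joint law of the two coordinates does not enter it. *)
Definition Emix h : R :=
  (1 - alpha) * E (fun u => h u.1) + alpha * E (fun u => h u.2).

Hypothesis alpha01 : 0 < alpha < 1.
Hypothesis C0 : 0 < C.
Hypothesis mphi : forall i, measurable_fun setT (phi i).
Hypothesis phiC : forall y, \sum_i phi i y ^+ 2 <= C ^+ 2.
Hypothesis br : bmeas r.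
Hypothesis r01 : forall y, 0 <= r y <= alpha^-1.
Hypothesis ratio : forall h, bmeas h -> E (fun u => h u.2) = Emix (fun y => h y * r y).
Hypothesis Emix_phi : forall i j, Emix (fun y => phi i y * phi j y) = (i == j)%:R * mu i.
Hypothesis Emix_r : forall k, Emix (fun y => r y * phi k y) = Num.sqrt (mu k) * rr k.
Hypothesis Emix_r2 : Emix (fun y => r y ^+ 2) = \sum_k rr k ^+ 2 + tau ^+ 2.

Local Notation phi1 := (fun i (u : T * T) => phi i u.1).
Local Notation phi2 := (fun i (u : T * T) => phi i u.2).
Local Notation zeta := (zeta phi1 phi2 alpha).

Lemma bmeas_fst h : bmeas h -> bmeas (fun u : T * T => h u.1).
Proof.
move=> [mh [M hM]]; split; last by exists M => u.
by apply: measurableT_comp => //; exact: measurable_fst.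
Qed.

Lemma bmeas_snd h : bmeas h -> bmeas (fun u : T * T => h u.2).
Proof.
move=> [mh [M hM]]; split; last by exists M => u.
by apply: measurableT_comp => //; exact: measurable_snd.
Qed.

Lemma bmeas_phi i : bmeas (phi i).
Proof. by split => //; exists C => y; exact: (@coord_bound R n C C0 (fun j => phi j y) (phiC y) i). Qed.

Let a0 : 0 < alpha. Proof. by have /andP[] := alpha01. Qed.
Let a1 : alpha < 1. Proof. by have /andP[] := alpha01. Qed.

Lemma eq_Emix h f : (forall y, h y = f y) -> Emix h = Emix f.
Proof. by move=> e; congr Emix; apply/funext. Qed.

Lemma EmixD h f : bmeas h -> bmeas f -> Emix (fun y => h y + f y) = Emix h + Emix f.
Proof.
move=> bh bf; rewrite /Emix !expectD; [ring|exact: bmeas_snd|exact: bmeas_snd|exact: bmeas_fst|exact: bmeas_fst].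
Qed.

Lemma EmixZ c h : bmeas h -> Emix (fun y => c * h y) = c * Emix h.
Proof.
move=> bh; rewrite /Emix !expectZ; [ring|exact: bmeas_snd|exact: bmeas_fst].
Qed.

Lemma Emix_cst c : Emix (fun=> c) = c.
Proof. by rewrite /Emix !expect_cst; ring. Qed.

Lemma Emix_sum m (h : 'I_m -> T -> R) : (forall i, bmeas (h i)) ->
  Emix (fun y => \sum_i h i y) = \sum_i Emix (h i).
Proof.
move=> bh; rewrite /Emix.
rewrite (expect_sum nu (f := fun i u => h i u.1)); last by move=> i; exact: bmeas_fst.
rewrite (expect_sum nu (f := fun i u => h i u.2)); last by move=> i; exact: bmeas_snd.
by rewrite !mulr_sumr -big_split.
Qed.

Lemma ler_Emix h f : bmeas h -> bmeas f -> (forall y, h y <= f y) -> Emix h <= Emix f.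
Proof.
move=> bh bf hf; apply: lerD.
  rewrite ler_pM2l ?subr_gt0 //; apply: ler_expect; [exact: bmeas_fst|exact: bmeas_fst|by []].
rewrite ler_pM2l //; apply: ler_expect; [exact: bmeas_snd|exact: bmeas_snd|by []].
Qed.

Definition lin v y := \sum_i v i * phi i y.

Lemma bmeas_lin v : bmeas (lin v).
Proof. by apply: bmeas_sum => i; apply: bmeasZ; exact: bmeas_phi. Qed.

Lemma Emix_lin_phi v k : Emix (fun y => lin v y * phi k y) = mu k * v k.
Proof.
have -> : Emix (fun y => lin v y * phi k y) = Emix (fun y => \sum_i v i * (phi i y * phi k y)).
  by apply: eq_Emix => y; rewrite /lin mulr_suml; apply: eq_bigr => i _; rewrite mulrA.
rewrite Emix_sum; last by move=> i; apply: bmeasZ; apply: bmeasM; exact: bmeas_phi.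
rewrite (bigD1 k) //= EmixZ ?Emix_phi ?eqxx; last by apply: bmeasM; exact: bmeas_phi.
rewrite big1 ?addr0; first by rewrite mul1r mulrC.
move=> i /negbTE ik; rewrite EmixZ ?Emix_phi ?ik ?mul0r ?mulr0 //.
by apply: bmeasM; exact: bmeas_phi.
Qed.

Lemma Emix_lin2 v : Emix (fun y => lin v y ^+ 2) = \sum_k mu k * v k ^+ 2.
Proof.
have -> : Emix (fun y => lin v y ^+ 2) = Emix (fun y => \sum_k v k * (lin v y * phi k y)).
  by apply: eq_Emix => y; rewrite expr2 {2}/lin mulr_sumr; apply: eq_bigr => i _; ring.
have b k : bmeas (fun y => lin v y * phi k y) by apply: bmeasM; [exact: bmeas_lin|exact: bmeas_phi].
rewrite Emix_sum; last by move=> i; exact: bmeasZ.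
by apply: eq_bigr => k _; rewrite EmixZ // Emix_lin_phi; ring.
Qed.

Lemma Emix_lin_r v : Emix (fun y => lin v y * r y) = \sum_k v k * (Num.sqrt (mu k) * rr k).
Proof.
have -> : Emix (fun y => lin v y * r y) = Emix (fun y => \sum_k v k * (r y * phi k y)).
  by apply: eq_Emix => y; rewrite /lin mulr_suml; apply: eq_bigr => i _; ring.
have b k : bmeas (fun y => r y * phi k y) by apply: bmeasM => //; exact: bmeas_phi.
rewrite Emix_sum; last by move=> i; exact: bmeasZ.
by apply: eq_bigr => k _; rewrite EmixZ // Emix_r.
Qed.

Lemma mix_mu_ge0 k : 0 <= mu k.
Proof.
have := Emix_phi k k; rewrite eqxx mul1r => <-.
rewrite -(Emix_cst 0); apply: ler_Emix; first exact: bmeas_cst.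
  by apply: bmeasM; exact: bmeas_phi.
by move=> y; rewrite -expr2 sqr_ge0.
Qed.

Lemma mix_sum_mu_le : \sum_k mu k <= C ^+ 2.
Proof.
have -> : \sum_k mu k = Emix (fun y => \sum_k phi k y ^+ 2).
  rewrite Emix_sum; last by move=> k; exact: bmeasX (bmeas_phi k).
  by apply: eq_bigr => k _; have := Emix_phi k k; rewrite eqxx mul1r => <-; exact: eq_Emix.
rewrite -[leRHS]Emix_cst; apply: ler_Emix => //; last exact: bmeas_cst.
by apply: bmeas_sum => k; exact: bmeasX (bmeas_phi k).
Qed.

Lemma Emix_r_eq1 : Emix r = 1.
Proof.
have := ratio (bmeas_cst 1); rewrite expect_cst => ->.
by apply: eq_Emix => y; rewrite mul1r.
Qed.

Lemma mix_rr_le : \sum_k rr k ^+ 2 + tau ^+ 2 <= alpha^-1.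
Proof.
rewrite -Emix_r2 -[leRHS]mulr1 -Emix_r_eq1 -EmixZ //.
apply: ler_Emix => [| |y]; [exact: bmeasX|exact: bmeasZ|].
by have /andP[h1 h2] := r01 y; rewrite expr2 ler_wpM2r.
Qed.

(** Pythagoras: [tau] is the norm of the part of the ratio outside the span of the first [n]
    eigenfunctions. *)
Lemma Emix_lin_dist v : Emix (fun y => (lin v y - r y) ^+ 2) =
  \sum_k (Num.sqrt (mu k) * v k - rr k) ^+ 2 + tau ^+ 2.
Proof.
have bl := bmeas_lin v.
have -> : Emix (fun y => (lin v y - r y) ^+ 2) =
   Emix (fun y => lin v y ^+ 2 + (-2 * (lin v y * r y) + r y ^+ 2)).
  by apply: eq_Emix => y; ring.
rewrite EmixD; [|exact: bmeasX|by apply: bmeasD; [apply: bmeasZ; exact: bmeasM|exact: bmeasX]].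
rewrite EmixD; [|by apply: bmeasZ; exact: bmeasM|exact: bmeasX].
rewrite EmixZ; last exact: bmeasM.
rewrite Emix_lin2 Emix_lin_r Emix_r2 !addrA; congr (_ + _).
rewrite mulr_sumr -!big_split /=; apply: eq_bigr => k _.
by rewrite sqrrB exprMn sqr_sqrtr ?mix_mu_ge0 // mulr2n; ring.
Qed.

Lemma mix_mean_zeta v k : E (zeta v ^~ k) = mu k * v k - Num.sqrt (mu k) * rr k.
Proof.
rewrite -Emix_lin_phi -Emix_r.
have b1 : bmeas (fun y => lin v y * phi k y) by apply: bmeasM; [exact: bmeas_lin|exact: bmeas_phi].
have -> : Emix (fun y => r y * phi k y) = E (fun u => phi k u.2).
  by rewrite ratio; [apply: eq_Emix => y; rewrite mulrC|exact: bmeas_phi].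
have e1 : (fun u : T * T => (zeta v ^~ k) u) = (fun u =>
   ((1 - alpha) * (lin v u.1 * phi k u.1) + alpha * (lin v u.2 * phi k u.2)) - phi k u.2).
  by apply/funext => u; rewrite /zeta /lin /=; ring.
rewrite e1.
have c1 := bmeas_fst b1; have c2 := bmeas_snd b1.
rewrite expectB; [|by apply: bmeasD; exact: bmeasZ|by apply: bmeas_snd; exact: bmeas_phi].
by rewrite expectD ?expectZ //; exact: bmeasZ.
Qed.

Definition wphi2 w y := \sum_k (w k * phi k y) ^+ 2.

Lemma bmeas_wphi2 w : bmeas (wphi2 w).
Proof. by apply: bmeas_sum => k; apply: bmeasX; apply: bmeasZ; exact: bmeas_phi. Qed.

Lemma wphi2_ge0 w y : 0 <= wphi2 w y.
Proof. by apply: sumr_ge0 => k _; exact: sqr_ge0. Qed.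

Lemma Emix_wphi2 w : Emix (wphi2 w) = \sum_k w k ^+ 2 * mu k.
Proof.
have b k : bmeas (fun y => phi k y * phi k y) by apply: bmeasM; exact: bmeas_phi.
have -> : Emix (wphi2 w) = Emix (fun y => \sum_k w k ^+ 2 * (phi k y * phi k y)).
  by apply: eq_Emix => y; apply: eq_bigr => k _; ring.
rewrite Emix_sum; last by move=> k; exact: bmeasZ.
by apply: eq_bigr => k _; rewrite EmixZ // Emix_phi eqxx mul1r.
Qed.

(* Since [E h(x') = Emix (h * r)], the square [(f - 1/alpha)^2] turns into [f^2 - 2 f r + r/alpha] under the mixture. *)
Lemma expect_zeta_le w v :
  E (fun u => \sum_k (w k * zeta v u k) ^+ 2) <=
  Emix (fun y => (lin v y ^+ 2 - 2 * lin v y * r y + alpha^-1 * r y) * wphi2 w y).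
Proof.
have bl := bmeas_lin v; have bw := bmeas_wphi2 w.
have b1 : bmeas (fun y => lin v y ^+ 2 * wphi2 w y) by apply: bmeasM => //; exact: bmeasX.
have b2 : bmeas (fun y => (lin v y - alpha^-1) ^+ 2 * wphi2 w y).
  by apply: bmeasM => //; apply: bmeasX; apply: bmeasB => //; exact: bmeas_cst.
have b3 : bmeas (fun y => (alpha^-1 - 2 * lin v y) * wphi2 w y).
  by apply: bmeasM => //; apply: bmeasB; [exact: bmeas_cst|exact: bmeasZ].
apply: (@le_trans _ _ (E (fun u => (1 - alpha) * (lin v u.1 ^+ 2 * wphi2 w u.1)
    + alpha * ((lin v u.2 - alpha^-1) ^+ 2 * wphi2 w u.2)))).
  apply: ler_expect.
  - apply: bmeas_sum => k; apply: bmeasX; apply: bmeasZ.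
    by apply: (bmeas_zeta alpha C0) => [i|i|u|u]; rewrite ?phiC //;
      [exact: (bmeas_fst (bmeas_phi i)).1|exact: (bmeas_snd (bmeas_phi i)).1].
  - by apply: bmeasD; apply: bmeasZ; [exact: (bmeas_fst b1)|exact: (bmeas_snd b2)].
  - by move=> u; exact: (zeta_conv phi1 phi2 alpha01).
rewrite expectD; [|apply: bmeasZ; exact: (bmeas_fst b1)|apply: bmeasZ; exact: (bmeas_snd b2)].
rewrite (expectZ nu (1 - alpha) (bmeas_fst b1)) (expectZ nu alpha (bmeas_snd b2)).
have -> : E (fun u => (lin v u.2 - alpha^-1) ^+ 2 * wphi2 w u.2) =
  E (fun u => lin v u.2 ^+ 2 * wphi2 w u.2) + alpha^-1 * E (fun u => (alpha^-1 - 2 * lin v u.2) * wphi2 w u.2).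
  rewrite -(expectZ nu alpha^-1 (bmeas_snd b3)) -expectD; [|exact: (bmeas_snd b1)|apply: bmeasZ; exact: (bmeas_snd b3)].
  by apply: eq_Rintegral => u _; ring.
rewrite (ratio b3).
have -> : Emix (fun y => (lin v y ^+ 2 - 2 * lin v y * r y + alpha^-1 * r y) * wphi2 w y) =
  Emix (fun y => lin v y ^+ 2 * wphi2 w y) + Emix (fun y => (alpha^-1 - 2 * lin v y) * wphi2 w y * r y).
  rewrite -EmixD //; last exact: bmeasM.
  by apply: eq_Emix => y; ring.
rewrite {2}/Emix le_eqVlt; apply/orP; left; apply/eqP.
by field; rewrite gt_eqF.
Qed.

Let bdist v : bmeas (fun y => (lin v y - r y) ^+ 2).
Proof. by apply: bmeasX; apply: bmeasB => //; exact: bmeas_lin. Qed.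

Let bcross v w : bmeas (fun y => (lin v y ^+ 2 - 2 * lin v y * r y + alpha^-1 * r y) * wphi2 w y).
Proof.
have bl := bmeas_lin v.
apply: bmeasM; last exact: bmeas_wphi2.
apply: bmeasD; last exact: bmeasZ.
by apply: bmeasB; [exact: bmeasX|apply: bmeasM => //; exact: bmeasZ].
Qed.

(** Under the mixture the second moment is weighted by [(f - r)^2 + r (1/alpha - r)]. The first part
    vanishes at the target; the second is at most [1 / (4 alpha^2)] and is paired with the sharper
    trace weight. *)
Lemma mix_var_zeta v w (q : R) : 0 <= q -> (forall k, w k ^+ 2 <= q) ->
  E (fun u => \sum_k (w k * zeta v u k) ^+ 2) <=
  C ^+ 2 * q * (\sum_k (Num.sqrt (mu k) * v k - rr k) ^+ 2 + tau ^+ 2)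
  + (4 * alpha ^+ 2)^-1 * \sum_k w k ^+ 2 * mu k.
Proof.
move=> q0 wq; apply: (le_trans (expect_zeta_le w v)).
have bd := bdist v; have bw := bmeas_wphi2 w.
rewrite -Emix_lin_dist -Emix_wphi2 -!EmixZ // -EmixD; [|exact: bmeasZ|exact: bmeasZ].
apply: ler_Emix => // [|y]; first by apply: bmeasD; exact: bmeasZ.
have w0 := wphi2_ge0 w y.
have wC : wphi2 w y <= C ^+ 2 * q by rewrite mulrC; exact: wsqsum_le.
have h := ler_wpM2r (sqr_ge0 (lin v y - r y)) wC.
have h2 : 0 <= (r y - (2 * alpha)^-1) ^+ 2 * wphi2 w y by rewrite mulr_ge0 ?sqr_ge0.
have -> : (lin v y ^+ 2 - 2 * lin v y * r y + alpha^-1 * r y) * wphi2 w y =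
  wphi2 w y * (lin v y - r y) ^+ 2 + (4 * alpha ^+ 2)^-1 * wphi2 w y
  - (r y - (2 * alpha)^-1) ^+ 2 * wphi2 w y.
  by field; rewrite gt_eqF.
lra.
Qed.

(** For uniform weights the term [r (1/alpha - r)] is integrated exactly. Combined with [dist2_le]
    this gives a variance of order [C^2 / alpha] instead of [1 / alpha^2]. *)
Lemma mix_var_zeta1 v :
  E (fun u => \sum_k zeta v u k ^+ 2) <=
  C ^+ 2 * (alpha^-1 + \sum_k (Num.sqrt (mu k) * v k - rr k) ^+ 2 - \sum_k rr k ^+ 2).
Proof.
have bd := bdist v; have bw := bmeas_wphi2 (fun=> 1); have bl := bmeas_lin v.
have -> : E (fun u => \sum_k zeta v u k ^+ 2) = E (fun u => \sum_k (1 * zeta v u k) ^+ 2).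
  by apply: eq_Rintegral => u _; apply: eq_bigr => k _; rewrite mul1r.
apply: (le_trans (expect_zeta_le (fun=> 1) v)).
have b1 : bmeas (fun y => lin v y ^+ 2 - 2 * lin v y * r y + alpha^-1 * r y).
  apply: bmeasD; last exact: bmeasZ.
  by apply: bmeasB; [exact: bmeasX|apply: bmeasM => //; exact: bmeasZ].
apply: (@le_trans _ _ (Emix (fun y => C ^+ 2 * (lin v y ^+ 2 - 2 * lin v y * r y + alpha^-1 * r y)))).
  apply: ler_Emix => // [|y]; first exact: bmeasZ.
  have wC : wphi2 (fun=> 1) y <= C ^+ 2.
    by rewrite /wphi2; under eq_bigr do rewrite mul1r.
  rewrite mulrC; apply: ler_wpM2r => //.
  have /andP[h1 h2] := r01 y.
  have -> : lin v y ^+ 2 - 2 * lin v y * r y + alpha^-1 * r y =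
    (lin v y - r y) ^+ 2 + r y * (alpha^-1 - r y) by ring.
  by rewrite addr_ge0 ?sqr_ge0 // mulr_ge0 // subr_ge0.
rewrite EmixZ // ler_wpM2l ?sqr_ge0 //.
have -> : Emix (fun y => lin v y ^+ 2 - 2 * lin v y * r y + alpha^-1 * r y) =
  Emix (fun y => (lin v y - r y) ^+ 2 + (- 1 * r y ^+ 2 + alpha^-1 * r y)).
  by apply: eq_Emix => y; ring.
rewrite EmixD //; last by apply: bmeasD; apply: bmeasZ => //; exact: bmeasX.
rewrite EmixD; [|by apply: bmeasZ; exact: bmeasX|exact: bmeasZ].
rewrite !EmixZ //; last exact: bmeasX.
rewrite Emix_lin_dist Emix_r2 Emix_r_eq1; lra.
Qed.

End MixtureMoments.

(** * Mercer expansion *)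

Lemma quadratic_discr_le {R : realType} (A B C : R) :
  (forall x y, 0 <= x ^+ 2 * A - 2 * x * y * B + y ^+ 2 * C) -> B ^+ 2 <= A * C.
Proof.
move=> h.
have C0 : 0 <= C by have := h 0 1; rewrite expr0n expr1n !mul0r !mulr0 !mul0r; lra.
have A0 : 0 <= A by have := h 1 0; rewrite expr0n expr1n !mulr0 !mul0r; lra.
have [C1|C1] := eqVneq C 0.
  have [B0|B0] := eqVneq B 0; first by rewrite B0 C1 expr0n mulr0.
  have := h 1 ((A + 1) / (2 * B)); rewrite C1.
  have -> : 1 ^+ 2 * A - 2 * 1 * ((A + 1) / (2 * B)) * B + ((A + 1) / (2 * B)) ^+ 2 * 0 = - 1.
    by field.
  lra.
have Cp : 0 < C by rewrite lt0r C1.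
have := h C B.
have -> : C ^+ 2 * A - 2 * C * B * B + B ^+ 2 * C = C * (A * C - B ^+ 2) by ring.
by rewrite pmulr_rge0 // subr_ge0.
Qed.

(** * Square-integrable functions and their inner product *)

Section SquareIntegrable.
Context {R : realType} {d : measure_display} {T : measurableType d}.
Variables (m : probability T R) (X : set T).
Hypothesis mX : measurable X.
Hypothesis m1 : m X = 1%E.
Implicit Types f g h : T -> R.

Definition L2 f := measurable_fun X f /\ (\int[m]_(x in X) (f x ^+ 2)%:E < +oo)%E.

Definition IP f g : R := \int[m]_(x in X) (f x * g x).

Lemma L2_sqr_integrable f : L2 f -> m.-integrable X (EFin \o (fun x => f x ^+ 2)).
Proof.
move=> [mf hf]; apply/integrableP; split; first exact/measurable_EFinP/measurable_funX.
under eq_integral => x _ do rewrite /= ger0_norm ?sqr_ge0 //.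
exact: hf.
Qed.

Lemma L2_integrable f g : L2 f -> L2 g -> m.-integrable X (EFin \o (fun x => f x * g x)).
Proof.
move=> Lf Lg.
have i1 := L2_sqr_integrable Lf; have i2 := L2_sqr_integrable Lg.
have i3 : m.-integrable X (EFin \o (fun x => f x ^+ 2 + g x ^+ 2)).
  have -> : EFin \o (fun x => f x ^+ 2 + g x ^+ 2) =
    (EFin \o (fun x => f x ^+ 2)) \+ (EFin \o (fun x => g x ^+ 2)) by apply/funext.
  exact: integrableD.
apply: (le_integrable mX _ _ i3).
  by apply/measurable_EFinP; apply: measurable_funM; [exact: Lf.1|exact: Lg.1].
move=> x Xx /=; rewrite lee_fin [leRHS]ger0_norm ?addr_ge0 ?sqr_ge0 //.
rewrite ler_norml; apply/andP; split.
  by have := sqr_ge0 (f x + g x); have := sqr_ge0 (f x); have := sqr_ge0 (g x); nra.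
by have := sqr_ge0 (f x - g x); have := sqr_ge0 (f x); have := sqr_ge0 (g x); nra.
Qed.

Lemma IPC f g : IP f g = IP g f.
Proof. by apply: eq_Rintegral => x _; rewrite mulrC. Qed.

Lemma eq_IP f f' g g' : {in X, f =1 f'} -> {in X, g =1 g'} -> IP f g = IP f' g'.
Proof. by move=> e e'; apply: eq_Rintegral => x Xx; rewrite e // e'. Qed.

Lemma L2_bounded f M : measurable_fun X f -> (forall x, X x -> `|f x| <= M) -> L2 f.
Proof.
move=> mf hM; split => //.
apply: (@le_lt_trans _ _ (\int[m]_(x in X) (M ^+ 2)%:E)%E).
  apply: ge0_le_integral => //.
  - by move=> x _; rewrite lee_fin sqr_ge0.
  - exact/measurable_EFinP/measurable_funX.
  - move=> x Xx; rewrite lee_fin -real_normK ?num_real //.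
    by rewrite ler_sqr ?nnegrE ?(le_trans _ (hM x Xx)) // hM.
by rewrite integral_cst // [X in (_ * X)%E](_ : _ = 1%E) ?mule1 ?ltry.
Qed.

Lemma L2_cst c : L2 (fun=> c).
Proof. by apply: (@L2_bounded _ `|c|). Qed.

Lemma L2Z c f : L2 f -> L2 (fun x => c * f x).
Proof.
move=> Lf; have mf := Lf.1; split; first exact: measurable_funM.
have -> : (fun x => ((c * f x) ^+ 2)%:E) = (fun x => (c ^+ 2)%:E * (f x ^+ 2)%:E)%E.
  by apply/funext => x; rewrite exprMn EFinM.
rewrite ge0_integralZl //.
- by apply: lte_mul_pinfty => //; [rewrite lee_fin sqr_ge0|exact: Lf.2].
- exact/measurable_EFinP/measurable_funX.
- by move=> x _; rewrite lee_fin sqr_ge0.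
- by rewrite lee_fin sqr_ge0.
Qed.

Lemma L2D f g : L2 f -> L2 g -> L2 (fun x => f x + g x).
Proof.
move=> Lf Lg; have mf := Lf.1; have mg := Lg.1; split; first exact: measurable_funD.
apply: (@le_lt_trans _ _ (\int[m]_(x in X) ((2 * f x ^+ 2)%:E + (2 * g x ^+ 2)%:E))%E).
  apply: ge0_le_integral => //.
  - by move=> x _; rewrite lee_fin sqr_ge0.
  - exact/measurable_EFinP/measurable_funX/measurable_funD.
  - apply: emeasurable_funD; apply/measurable_EFinP; apply: measurable_funM => //; exact: measurable_funX.
  - by move=> x _; rewrite -EFinD lee_fin; have := sqr_ge0 (f x - g x); nra.
rewrite ge0_integralD //.
- apply: lte_add_pinfty.
    have -> : (fun x => (2 * f x ^+ 2)%:E) = (fun x => 2%:E * (f x ^+ 2)%:E)%E by apply/funext.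
    rewrite ge0_integralZl //; first by apply: lte_mul_pinfty => //; exact: Lf.2.
    + exact/measurable_EFinP/measurable_funX.
    + by move=> x _; rewrite lee_fin sqr_ge0.
  have -> : (fun x => (2 * g x ^+ 2)%:E) = (fun x => 2%:E * (g x ^+ 2)%:E)%E by apply/funext.
  rewrite ge0_integralZl //; first by apply: lte_mul_pinfty => //; exact: Lg.2.
  + exact/measurable_EFinP/measurable_funX.
  + by move=> x _; rewrite lee_fin sqr_ge0.
- by move=> x _; rewrite lee_fin mulr_ge0 // sqr_ge0.
- by apply/measurable_EFinP; apply: measurable_funM => //; exact: measurable_funX.
- by move=> x _; rewrite lee_fin mulr_ge0 // sqr_ge0.
- by apply/measurable_EFinP; apply: measurable_funM => //; exact: measurable_funX.
Qed.

Lemma L2B f g : L2 f -> L2 g -> L2 (fun x => f x - g x).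
Proof.
move=> Lf Lg; have := L2D Lf (L2Z (-1) Lg).
by congr L2; apply/funext => x; rewrite mulN1r.
Qed.

Lemma L2_sum n (F : 'I_n -> T -> R) : (forall k, L2 (F k)) -> L2 (fun x => \sum_k F k x).
Proof.
elim: n F => [|n IH] F LF.
  by have := L2_cst 0; congr L2; apply/funext => x; rewrite big_ord0.
have := L2D (IH (fun k => F (widen_ord (leqnSn n) k)) (fun k => LF _)) (LF ord_max).
by congr L2; apply/funext => x; rewrite big_ord_recr.
Qed.

Lemma IPDl f g h : L2 f -> L2 g -> L2 h -> IP (fun x => f x + g x) h = IP f h + IP g h.
Proof.
move=> Lf Lg Lh; rewrite /IP -RintegralD //; last 2 first.
- exact: L2_integrable.
- exact: L2_integrable.
by apply: eq_Rintegral => x _; rewrite mulrDl.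
Qed.

Lemma IPZl c f h : L2 f -> L2 h -> IP (fun x => c * f x) h = c * IP f h.
Proof.
move=> Lf Lh; rewrite /IP -RintegralZl //; last exact: L2_integrable.
by apply: eq_Rintegral => x _; rewrite mulrA.
Qed.

Lemma IPBl f g h : L2 f -> L2 g -> L2 h -> IP (fun x => f x - g x) h = IP f h - IP g h.
Proof.
move=> Lf Lg Lh; rewrite -[- IP g h]mulN1r -IPZl // -IPDl //; last exact: L2Z.
by apply: eq_IP => x _ //; rewrite mulN1r.
Qed.

Lemma IP_suml n (F : 'I_n -> T -> R) h : (forall k, L2 (F k)) -> L2 h ->
  IP (fun x => \sum_k F k x) h = \sum_k IP (F k) h.
Proof.
move=> LF Lh; elim: n F LF => [|n IH] F LF.
  rewrite big_ord0 -[RHS](mul0r (IP h h)) -IPZl //; apply: eq_IP => x _ //.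
  by rewrite big_ord0 mul0r.
rewrite big_ord_recr /= -IH // -IPDl //; last exact: L2_sum.
by apply: eq_IP => x _ //; rewrite big_ord_recr.
Qed.

Lemma IP_ge0 f : 0 <= IP f f.
Proof. by apply: Rintegral_ge0 => x _; rewrite -expr2 sqr_ge0. Qed.

Lemma IPffE f : L2 f -> (\int[m]_(x in X) (f x ^+ 2)%:E = (IP f f)%:E)%E.
Proof.
move=> Lf; rewrite /IP /Rintegral fineK; last first.
  by apply: integrable_fin_num => //; exact: L2_integrable.
by apply: eq_integral => x _; rewrite expr2.
Qed.

Lemma IP_quad f g (a b : R) : L2 f -> L2 g ->
  IP (fun x => a * f x + b * g x) (fun x => a * f x + b * g x) =
  a ^+ 2 * IP f f + 2 * a * b * IP f g + b ^+ 2 * IP g g.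
Proof.
move=> Lf Lg; have La := L2Z a Lf; have Lb := L2Z b Lg; have Ls := L2D La Lb.
rewrite IPDl // !IPZl // ![IP _ (fun x => _ + _)]IPC !IPDl // !IPZl //.
rewrite (IPC g f); ring.
Qed.

Lemma IP_sqr_le f g : L2 f -> L2 g -> IP f g ^+ 2 <= IP f f * IP g g.
Proof.
move=> Lf Lg; apply: quadratic_discr_le => x y.
have := IP_ge0 (fun z => x * f z + (- y) * g z); rewrite IP_quad // sqrrN; lra.
Qed.

Lemma IP_le f g h : L2 f -> L2 g -> L2 h -> (forall x, X x -> 0 <= h x) ->
  (forall x, X x -> h x != 0 -> f x <= g x) -> IP h f <= IP h g.
Proof.
move=> Lf Lg Lh h0 fg; apply: le_Rintegral => //; [exact: L2_integrable|exact: L2_integrable|].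
move=> x Xx; have [->|hx] := eqVneq (h x) 0; first by rewrite !mul0r.
by rewrite ler_wpM2l ?h0 // fg.
Qed.

(** An average of [f] with respect to a density [h] is as close to [c] as [f] is wherever [h] does
    not vanish. *)
Lemma IP_density_dist h f c e : L2 h -> L2 f -> (forall x, X x -> 0 <= h x) ->
  IP h (fun=> 1) = 1 -> (forall x, X x -> h x != 0 -> `|f x - c| <= e) ->
  `|IP h f - c| <= e.
Proof.
move=> Lh Lf h0 h1 hf.
have cE k : IP h (fun=> k) = k.
  have -> : IP h (fun=> k) = IP (fun=> k * 1) h by rewrite IPC; apply: eq_IP => x _ //; rewrite mulr1.
  by rewrite IPZl // ?[IP _ h]IPC ?h1 ?mulr1 //; exact: L2_cst.
rewrite ler_norml; apply/andP; split.
  rewrite lerBrDr -[leLHS]cE; apply: IP_le => //; first exact: L2_cst.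
  by move=> x Xx hx; have := hf x Xx hx; rewrite ler_norml => /andP[]; lra.
rewrite lerBlDr -[leRHS]cE; apply: IP_le => //; first exact: L2_cst.
by move=> x Xx hx; have := hf x Xx hx; rewrite ler_norml => /andP[]; lra.
Qed.

Lemma IP_bounded_le f M : measurable_fun X f -> 0 <= M ->
  (forall x, X x -> `|f x| <= M) -> IP f f <= M ^+ 2.
Proof.
move=> mf M0 hM; have Lf := L2_bounded mf hM.
have -> : M ^+ 2 = \int[m]_(x in X) (M ^+ 2) by rewrite Rintegral_cst // [X in fine X](_ : _ = 1%E) ?mulr1.
apply: le_Rintegral => //; first exact: L2_integrable.
  have := L2_integrable (L2_cst M) (L2_cst M).
  by congr (m.-integrable _ _); apply/funext => x /=; rewrite expr2.
move=> x Xx; rewrite -expr2 -real_normK ?num_real // ler_sqr ?nnegrE //; exact: hM.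
Qed.

Lemma IP_cvg (u : nat -> T -> R) F f : (forall n, L2 (u n)) -> L2 F -> L2 f ->
  (fun n => \int[m]_(x in X) ((F x - u n x) ^+ 2)%:E)%E @ \oo --> 0%E ->
  (fun n => IP (u n) f) @ \oo --> IP F f.
Proof.
move=> Lu LF Lf h.
have Ld n : L2 (fun x => F x - u n x) by exact: L2B.
have h2 : (fun n => IP (fun x => F x - u n x) (fun x => F x - u n x)) @ \oo --> (0 : R).
  have e : (fun n => IP (fun x => F x - u n x) (fun x => F x - u n x)) =
      fine \o (fun n => \int[m]_(x in X) ((F x - u n x) ^+ 2)%:E)%E.
    by apply/funext => n /=; rewrite IPffE.
  by rewrite e; exact: fine_cvg h.
apply/cvgrPdist_lt => e e0.
have c0 := IP_ge0 f; set c := IP f f in c0.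
have ec : 0 < e ^+ 2 / (c + 1) by rewrite divr_gt0 ?exprn_gt0 //; lra.
move/cvgrPdist_lt : h2 => /(_ _ ec); apply: filterS => n.
rewrite sub0r normrN ger0_norm ?IP_ge0 // ltr_pdivlMr; last lra.
move=> hn; rewrite -IPBl // -ltr_sqr ?nnegrE ?normr_ge0 ?(ltW e0) //.
rewrite real_normK ?num_real //; apply: le_lt_trans hn.
apply: (le_trans (IP_sqr_le (Ld n) Lf)); rewrite -/c ler_wpM2l ?IP_ge0 //; lra.
Qed.

End SquareIntegrable.

Section Mercer.
Context {R : realType} {d : nat}.
Local Notation T := (Rd R d).
Variables (m : probability T R) (X : set T) (K : T -> T -> R) (C : R).
Hypothesis mX : measurable X.
Hypothesis m1 : m X = 1%E.
Hypothesis full : forall (x : T) (U : set 'rV[R]_d), X x -> open U -> U x -> (0 < m (U `&` X))%E.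
Hypothesis merc : mercer_kernel X K.
Hypothesis KC : forall x, X x -> Num.sqrt (K x x) <= C.
Hypothesis C0 : 0 <= C.
Implicit Types (x y z s : T).
Local Notation L2 := (L2 m X).
Local Notation IP := (IP m X).

(** Continuity is only relative to [X]; the preimage of a ray is the trace on [X] of the union of
    all open sets on which [f] exceeds the level within [X]. *)
Lemma measurable_of_local (f : T -> R) :
  (forall x e, X x -> 0 < e -> exists U : set 'rV[R]_d,
     [/\ open U, U x & forall z, U z -> X z -> `|f z - f x| <= e]) ->
  measurable_fun X f.
Proof.
move=> hf; apply: (measurability _ (RGenOInfty.measurableE R)).
move=> _ [_ [a ->] <-].
pose O := \bigcup_(U in [set U : set 'rV[R]_d | open U /\ forall z, U z -> X z -> a < f z]) U.
have -> : X `&` f @^-1` `]a, +oo[ = X `&` O.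
  apply/seteqP; split => x [Xx]; rewrite /= ?in_itv /= ?andbT.
    move=> ax; split => //.
    have e0 : 0 < (f x - a) / 2 by rewrite divr_gt0 // subr_gt0.
    have [U [oU Ux hU]] := hf x _ Xx e0.
    exists U => //; split => // z Uz Xz; have := hU z Uz Xz.
    by rewrite ler_norml => /andP[]; lra.
  by move=> [U [oU hU] Ux]; split => //; rewrite /= ?in_itv /= ?andbT; exact: hU.
apply: measurableI => //; apply: sub_sigma_algebra.
by apply: bigcup_open => U [].
Qed.

Lemma kernel_local x y e : X x -> X y -> 0 < e ->
  exists U V : set 'rV[R]_d, [/\ open U, U x, open V, V y &
    forall s z, U s -> V z -> X s -> X z -> `|K s z - K x y| <= e].
Proof.
move=> Xx Xy e0; have [cK _ _] := merc.
pose k := fun z : 'rV[R]_d * 'rV[R]_d => K z.1 z.2.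
have XX : (X `*` X) (x, y) by [].
have := cK (x, y).
move=> /cvgrPdist_lt /(_ e e0).
rewrite /prop_near1 /=; case: (nbhs_subspaceP (X `*` X) (x, y)) => // _.
move=> -[[A B] /= [nA nB] AB].
move: nA nB; rewrite !nbhsE => -[U [oU Ux] UA] [V [oV Vy] VB].
exists U, V; split => // s z Us Vz Xs Xz.
have := AB (s, z); rewrite /= => h; rewrite distrC ltW //.
by apply: h; split => //=; [exact: UA|exact: VB].
Qed.

Lemma Ksym x y : X x -> X y -> K x y = K y x.
Proof. by have [_ h _] := merc; exact: h. Qed.

(** The squared RKHS distance of [K x] and [K y]. Every regularity statement below is a Lipschitz
    bound for this distance. *)
Definition omega2 x y := K x x - 2 * K x y + K y y.

Lemma psd3 x y z (a b c : R) : X x -> X y -> X z ->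
  0 <= a ^+ 2 * K x x + b ^+ 2 * K y y + c ^+ 2 * K z z
     + 2 * a * b * K x y + 2 * a * c * K x z + 2 * b * c * K y z.
Proof.
move=> Xx Xy Xz; have [_ _ h] := merc.
have := h 3 (fun i => nth x [:: x; y; z] i) (fun i => nth 0 [:: a; b; c] i).
have Xs (i : 'I_3) : X (nth x [:: x; y; z] i) by case: i => -[|[|[|]]].
move=> /(_ Xs); rewrite !big_ord_recl !big_ord0 /=.
rewrite (Ksym Xy Xx) (Ksym Xz Xx) (Ksym Xz Xy).
by move=> h0; apply: (le_trans h0); rewrite le_eqVlt; apply/orP; left; apply/eqP; ring.
Qed.

Lemma Kdiag x : X x -> 0 <= K x x <= C ^+ 2.
Proof.
move=> Xx; have := psd3 1 0 0 Xx Xx Xx => h.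
have k0 : 0 <= K x x by move: h; rewrite expr1n expr0n /=; lra.
rewrite k0 /= -[leLHS](sqr_sqrtr k0) ler_sqr ?nnegrE ?sqrtr_ge0 //; exact: KC.
Qed.

Lemma omega2_ge0 x y : X x -> X y -> 0 <= omega2 x y.
Proof.
move=> Xx Xy; have := psd3 1 (-1) 0 Xx Xy Xy; rewrite /omega2; lra.
Qed.

(** Cauchy-Schwarz in the RKHS, obtained without constructing it: positivity on the three points is
    a quadratic form whose discriminant is the claim. *)
Lemma kernel_lip x y z : X x -> X y -> X z ->
  `|K x z - K y z| <= C * Num.sqrt (omega2 x y).
Proof.
move=> Xx Xy Xz; have o0 := omega2_ge0 Xx Xy; have /andP[kz0 kzC] := Kdiag Xz.
rewrite -ler_sqr ?nnegrE ?normr_ge0 ?mulr_ge0 ?sqrtr_ge0 //.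
rewrite real_normK ?num_real // exprMn sqr_sqrtr //.
apply: (@le_trans _ _ (K z z * omega2 x y)); last by rewrite ler_wpM2r.
apply: quadratic_discr_le => a b.
have := psd3 (- b) b a Xx Xy Xz; rewrite /omega2; lra.
Qed.

Lemma kernel_bound x y : X x -> X y -> `|K x y| <= C ^+ 2.
Proof.
move=> Xx Xy; have /andP[x0 xC] := Kdiag Xx; have /andP[y0 yC] := Kdiag Xy.
rewrite -ler_sqr ?nnegrE ?normr_ge0 ?sqr_ge0 // real_normK ?num_real //.
apply: (@le_trans _ _ (K x x * K y y)); last by rewrite expr2; exact: ler_pM.
apply: quadratic_discr_le => a b.
have := psd3 a (- b) 0 Xx Xy Xy; lra.
Qed.

Lemma omega2_local x e : X x -> 0 < e -> exists U : set 'rV[R]_d,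
  [/\ open U, U x & forall z, U z -> X z -> C * Num.sqrt (omega2 z x) <= e].
Proof.
move=> Xx e0.
have c1 : 0 < C + 1 by have := C0; lra.
have e1 : 0 < (e / (C + 1)) ^+ 2 / 3 by rewrite divr_gt0 // exprn_gt0 // divr_gt0.
have [U [V [oU Ux oV Vx h]]] := kernel_local Xx Xx e1.
exists (U `&` V); split => //; first exact: openI.
move=> z [Uz Vz] Xz; have o0 := omega2_ge0 Xz Xx.
have : omega2 z x <= (e / (C + 1)) ^+ 2.
  have := h z z Uz Vz Xz Xz; have := h z x Uz Vx Xz Xx.
  by rewrite !ler_norml => /andP[? ?] /andP[? ?]; rewrite /omega2; lra.
move=> h2; have : Num.sqrt (omega2 z x) <= e / (C + 1).
  rewrite -ler_sqr ?nnegrE ?sqrtr_ge0 ?sqr_sqrtr //.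
  by rewrite divr_ge0 // ltW.
have s0 := sqrtr_ge0 (omega2 z x); set s := Num.sqrt _ in s0 *.
rewrite ler_pdivlMr //; nra.
Qed.

Lemma measurable_of_lip (f : T -> R) (M : R) : 0 <= M ->
  (forall x y, X x -> X y -> `|f x - f y| <= M * (C * Num.sqrt (omega2 x y))) ->
  measurable_fun X f.
Proof.
move=> M0 hf; apply: measurable_of_local => x e Xx e0.
have e1 : 0 < e / (M + 1) by rewrite divr_gt0 //; lra.
have [U [oU Ux hU]] := omega2_local Xx e1.
exists U; split => // z Uz Xz; apply: (le_trans (hf z x Xz Xx)).
have := hU z Uz Xz; rewrite ler_pdivlMr; last lra.
have : 0 <= C * Num.sqrt (omega2 z x) by rewrite mulr_ge0 ?sqrtr_ge0.
nra.
Qed.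

Lemma measurable_kernel x : X x -> measurable_fun X (K x).
Proof.
move=> Xx; apply: (@measurable_of_lip _ 1) => // y z Xy Xz.
by rewrite mul1r (Ksym Xx Xy) (Ksym Xx Xz) kernel_lip.
Qed.

Lemma L2_kernel x : X x -> L2 (K x).
Proof.
move=> Xx; apply: (@L2_bounded _ _ _ m X mX m1 _ (C ^+ 2)); first exact: measurable_kernel.
by move=> y Xy; exact: kernel_bound.
Qed.

Definition LKm (f : T -> R) x := IP (K x) f.

Lemma LKm_lip f x y : L2 f -> X x -> X y ->
  `|LKm f x - LKm f y| <= Num.sqrt (IP f f) * (C * Num.sqrt (omega2 x y)).
Proof.
move=> Lf Xx Xy; rewrite /LKm -IPBl //; [|exact: L2_kernel|exact: L2_kernel].
have Lk : L2 (fun z => K x z - K y z) by apply: L2B => //; exact: L2_kernel.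
rewrite -ler_sqr ?nnegrE ?normr_ge0 //; last by rewrite !mulr_ge0 ?sqrtr_ge0.
rewrite real_normK ?num_real //; apply: (le_trans (IP_sqr_le mX Lk Lf)).
rewrite mulrC exprMn [X in _ <= X * _]sqr_sqrtr ?IP_ge0 // ler_wpM2l ?IP_ge0 //.
apply: IP_bounded_le => //; [exact: Lk.1|by rewrite mulr_ge0 ?sqrtr_ge0|].
by move=> z Xz; exact: kernel_lip.
Qed.

Lemma LKm_bound f x : L2 f -> X x -> `|LKm f x| <= C ^+ 2 * Num.sqrt (IP f f).
Proof.
move=> Lf Xx; have Lk := L2_kernel Xx.
rewrite -ler_sqr ?nnegrE ?normr_ge0 //; last by rewrite mulr_ge0 ?sqrtr_ge0 ?sqr_ge0.
rewrite real_normK ?num_real //; apply: (le_trans (IP_sqr_le mX Lk Lf)).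
rewrite exprMn [X in _ <= _ * X]sqr_sqrtr ?IP_ge0 // ler_wpM2r ?IP_ge0 //.
by apply: IP_bounded_le => //; [exact: Lk.1|exact: sqr_ge0|move=> z Xz; exact: kernel_bound].
Qed.

Lemma L2_LKm f : L2 f -> L2 (LKm f).
Proof.
move=> Lf; apply: (@L2_bounded _ _ _ m X mX m1 _ (C ^+ 2 * Num.sqrt (IP f f))).
  apply: (@measurable_of_lip _ (Num.sqrt (IP f f))); first exact: sqrtr_ge0.
  by move=> x y Xx Xy; exact: LKm_lip.
by move=> x Xx; exact: LKm_bound.
Qed.

(* Normalised indicators of small neighbourhoods play the role of the Dirac mass at [x]. *)
Definition is_bump x (e : R) (h : T -> R) :=
  [/\ L2 h, (forall z, X z -> 0 <= h z), IP h (fun=> 1) = 1 &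
      forall z, X z -> h z != 0 -> C * Num.sqrt (omega2 z x) <= e].

Lemma exists_bump x e : X x -> 0 < e -> exists h, is_bump x e h.
Proof.
move=> Xx e0; have [U [oU Ux hU]] := omega2_local Xx e0.
have mU : measurable (U `&` X : set T).
  by apply: measurableI => //; apply: sub_sigma_algebra.
have mass := full Xx oU Ux.
have fin : m (U `&` X) \is a fin_num by rewrite fin_num_measure.
set c := fine (m (U `&` X)).
have c0 : 0 < c by rewrite /c fine_gt0 // mass /= ltey_eq fin.
have m1U : measurable_fun X (\1_(U `&` X : set T) : T -> R) by exact: measurable_indic.
have b1 z : X z -> `|(\1_(U `&` X : set T) z : R)| <= 1.
  by move=> _; rewrite indicE; case: (_ \in _); rewrite ?normr1 ?normr0.
have L1 : L2 (\1_(U `&` X : set T) : T -> R).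
  exact: (@L2_bounded _ _ _ m X mX m1 _ 1).
exists (fun z => c^-1 * \1_(U `&` X : set T) z); split.
- exact: L2Z.
- by move=> z _; rewrite mulr_ge0 ?invr_ge0 ?(ltW c0) // indicE ler0n.
- rewrite IPZl //; last exact: L2_cst.
  have -> : IP (\1_(U `&` X : set T)) (fun=> 1) = c.
    rewrite /IP /Rintegral; under eq_integral => z _ do rewrite mulr1.
    by rewrite integral_indic // -setIA setIid.
  by rewrite mulVf // gt_eqF.
- move=> z Xz; rewrite mulf_eq0 negb_or => /andP[_]; rewrite indicE.
  by case: (boolP (z \in _)) => [|_]; [rewrite inE => -[Uz _] _; exact: hU|rewrite eqxx].
Qed.

Lemma bump_lip x e h f M : X x -> is_bump x e h -> L2 f -> 0 <= M ->
  (forall z, X z -> `|f z - f x| <= M * (C * Num.sqrt (omega2 z x))) ->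
  `|IP h f - f x| <= M * e.
Proof.
move=> Xx [Lh h0 h1 hh] Lf M0 hf; apply: IP_density_dist => // z Xz hz.
by apply: (le_trans (hf z Xz)); rewrite ler_wpM2l // hh.
Qed.

Lemma bump_LKm x e h f : X x -> is_bump x e h -> L2 f ->
  `|IP h (LKm f) - LKm f x| <= Num.sqrt (IP f f) * e.
Proof.
move=> Xx bh Lf; apply: (bump_lip Xx bh (L2_LKm Lf) (sqrtr_ge0 _)).
by move=> z Xz; exact: LKm_lip.
Qed.

(** The bilinear form of [L_K] at two bumps averages the kernel in both variables, and each average
    moves the value by at most its radius. *)
Lemma bump_kernel x y e e' h h' : X x -> X y -> is_bump x e h -> is_bump y e' h' ->
  `|IP (LKm h) h' - K x y| <= e + e'.
Proof.
move=> Xx Xy bh bh'; have [Lh h0 h1 hh] := bh; have [Lh' h0' h1' hh'] := bh'.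
rewrite IPC; apply: IP_density_dist => //; first exact: L2_LKm.
move=> z Xz hz.
have k1 : `|LKm h z - K z x| <= e.
  rewrite /LKm IPC -[e]mul1r.
  apply: (bump_lip Xx bh (L2_kernel Xz) ler01) => s Xs.
  by rewrite mul1r (Ksym Xz Xs) (Ksym Xz Xx); exact: kernel_lip.
have k2 : `|K z x - K y x| <= e'.
  by apply: (le_trans (kernel_lip Xz Xy Xx)); exact: hh'.
rewrite (Ksym Xx Xy).
have -> : LKm h z - K y x = (LKm h z - K z x) + (K z x - K y x) by ring.
by apply: (le_trans (ler_normD _ _)); exact: lerD.
Qed.

Variables (mu : nat -> R) (psi : nat -> T -> R).
Hypothesis Lpsi : forall k, L2 (psi k).
Hypothesis orth : forall i j, IP (psi i) (psi j) = (i == j)%:R.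
Hypothesis mu0 : forall k, 0 <= mu k.

Lemma L2_comb n (c : nat -> R) : L2 (fun y => \sum_(k < n) c k * psi k y).
Proof. by apply: L2_sum => // k; exact: L2Z. Qed.

Lemma IP_comb n (c : nat -> R) h : L2 h ->
  IP (fun y => \sum_(k < n) c k * psi k y) h = \sum_(k < n) c k * IP (psi k) h.
Proof.
move=> Lh; rewrite IP_suml //; last by move=> k; exact: L2Z.
by apply: eq_bigr => k _; rewrite IPZl.
Qed.

Lemma IP_comb_psi n (c : nat -> R) j : (j < n)%N ->
  IP (fun y => \sum_(k < n) c k * psi k y) (psi j) = c j.
Proof.
move=> jn; rewrite IP_comb // (bigD1 (Ordinal jn)) //= orth eqxx mulr1 big1 ?addr0 //.
by move=> k /negbTE kj; rewrite orth; move: kj; rewrite -val_eqE /= => ->; rewrite mulr0.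
Qed.

Lemma comb_dist n (c : nat -> R) f : L2 f -> (forall k, IP f (psi k) = c k) ->
  IP (fun y => f y - \sum_(k < n) c k * psi k y) (fun y => f y - \sum_(k < n) c k * psi k y)
  = IP f f - \sum_(k < n) c k ^+ 2.
Proof.
move=> Lf fc; have Lc := L2_comb n c; have Ld := L2B mX Lf Lc.
have e1 : IP (fun y => \sum_(k < n) c k * psi k y) f = \sum_(k < n) c k ^+ 2.
  by rewrite IP_comb //; apply: eq_bigr => k _; rewrite IPC fc expr2.
have e2 : IP (fun y => \sum_(k < n) c k * psi k y) (fun y => \sum_(k < n) c k * psi k y)
   = \sum_(k < n) c k ^+ 2.
  by rewrite IP_comb //; apply: eq_bigr => k _; rewrite IPC IP_comb_psi // expr2.
rewrite IPBl // ![IP _ (fun y => f y - _)]IPC !IPBl // [IP f (fun y => \sum_(k < n) _)]IPC e1 e2; ring.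
Qed.

Lemma bessel n f : L2 f -> \sum_(k < n) IP f (psi k) ^+ 2 <= IP f f.
Proof.
move=> Lf; rewrite -subr_ge0 -(@comb_dist n (fun k => IP f (psi k))) //; exact: IP_ge0.
Qed.

Definition L2_expansion (c : nat -> R) (F : T -> R) :=
  (fun n => (\int[m]_(x in X) ((F x - \sum_(k < n) c k * psi k x) ^+ 2)%:E)%E) @ \oo --> 0%E.

Lemma expansion_IP (c : nat -> R) F f : L2 F -> L2 f -> L2_expansion c F ->
  (fun n => \sum_(k < n) c k * IP (psi k) f) @ \oo --> IP F f.
Proof.
move=> LF Lf h; have := IP_cvg mX (fun n => L2_comb n c) LF Lf h.
by under eq_fun do rewrite IP_comb //.
Qed.

Lemma expansion_coef (c : nat -> R) F k : L2 F -> L2_expansion c F -> IP F (psi k) = c k.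
Proof.
move=> LF h; have := expansion_IP LF (Lpsi k) h => h1.
have h2 : (fun n => \sum_(j < n) c j * IP (psi j) (psi k)) @ \oo --> c k.
  apply: cvg_near_cst; exists k.+1 => // n /= kn.
  by rewrite -IP_comb // IP_comb_psi.
by have := cvg_unique _ h1 h2; apply.
Qed.

Lemma expansion_tail (c : nat -> R) F : L2 F -> L2_expansion c F ->
  (fun n => IP F F - \sum_(k < n) c k ^+ 2) @ \oo --> 0.
Proof.
move=> LF h; have e : (fun n => IP F F - \sum_(k < n) c k ^+ 2) =
   fine \o (fun n => \int[m]_(x in X) ((F x - \sum_(k < n) c k * psi k x) ^+ 2)%:E)%E.
  apply/funext => n /=; rewrite IPffE //; last by apply: L2B => //; exact: L2_comb.
  by rewrite -(@comb_dist n c) // => k; exact: expansion_coef.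
by rewrite e; exact: fine_cvg h.
Qed.

Hypothesis eig : forall f, L2 f -> L2_expansion (fun k => mu k * IP f (psi k)) (LKm f).

Lemma LKm_cvg f h : L2 f -> L2 h ->
  (fun n => \sum_(k < n) mu k * IP f (psi k) * IP h (psi k)) @ \oo --> IP (LKm f) h.
Proof.
move=> Lf Lh; have := expansion_IP (L2_LKm Lf) Lh (eig Lf).
by under eq_fun do under eq_bigr do rewrite (IPC _ _ _ h).
Qed.

(** The partial sums have nonnegative terms and converge to the quadratic form of [L_K], so they
    stay below it. *)
Lemma LKm_partial_le n h : L2 h ->
  \sum_(k < n) mu k * IP h (psi k) ^+ 2 <= IP (LKm h) h.
Proof.
move=> Lh; have h1 := LKm_cvg Lh Lh.
have nd : nondecreasing_seq (fun n => \sum_(k < n) mu k * IP h (psi k) * IP h (psi k)).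
  apply/nondecreasing_seqP => j; rewrite big_ord_recr /= lerDl -mulrA mulr_ge0 // -expr2 sqr_ge0.
  by [].
have := nondecreasing_cvgn_le nd (cvgP _ h1) n; rewrite (cvg_lim _ h1) //.
by under eq_bigr do rewrite -mulrA -expr2.
Qed.

(** The representative of [mu_k psi_k] that has a meaningful value at every point; [psi k] itself is
    determined only up to a null set. *)
Definition kap k := LKm (psi k).

Lemma IP_kap k f : L2 f -> IP f (kap k) = mu k * IP f (psi k).
Proof.
move=> Lf; rewrite IPC.
have h1 := LKm_cvg (Lpsi k) Lf.
have h2 : (fun n => \sum_(j < n) mu j * IP (psi k) (psi j) * IP f (psi j)) @ \oo
   --> mu k * IP f (psi k).
  apply: cvg_near_cst; exists k.+1 => // n /= kn.
  rewrite (bigD1 (Ordinal kn)) //= orth eqxx mulr1 big1 ?addr0 //.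
  move=> j jk; rewrite orth (_ : (k == j) = false) ?mulr0 ?mul0r //.
  by apply/negbTE; apply: contra jk => /eqP e; apply/eqP/val_inj.
by have := cvg_unique _ h1 h2; apply.
Qed.

(** For [mu k = 0] the division yields 0, so such a feature vanishes identically. *)
Definition feat k x := kap k x / Num.sqrt (mu k).

(** The average of the feature against [h]; for a bump at [x] it approximates [feat k x]. *)
Definition acoef h k := Num.sqrt (mu k) * IP h (psi k).

Lemma sqrt_div (c : R) : 0 <= c -> c / Num.sqrt c = Num.sqrt c.
Proof.
move=> c0; have [->|h] := eqVneq (Num.sqrt c) 0.
  by rewrite invr0 mulr0.
by rewrite -[X in X / _](sqr_sqrtr c0) expr2 mulfK.
Qed.

Lemma acoefE h k : L2 h -> acoef h k = IP h (kap k) / Num.sqrt (mu k).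
Proof. by move=> Lh; rewrite IP_kap // mulrAC sqrt_div. Qed.

Lemma L2_kap k : L2 (kap k). Proof. exact: L2_LKm. Qed.

Lemma featE k : feat k = (fun x => (Num.sqrt (mu k))^-1 * kap k x).
Proof. by apply/funext => x; rewrite /feat mulrC. Qed.

Lemma L2_feat k : L2 (feat k).
Proof. by rewrite featE; apply: L2Z => //; exact: L2_kap. Qed.

Lemma IP_feat f k : L2 f -> IP f (feat k) = Num.sqrt (mu k) * IP f (psi k).
Proof.
move=> Lf; rewrite featE IPC IPZl //; last exact: L2_kap.
by rewrite IPC IP_kap // mulrA [_^-1 * _]mulrC sqrt_div.
Qed.

Lemma IP_feat_feat i j : IP (feat i) (feat j) = (i == j)%:R * mu i.
Proof.
rewrite (IP_feat j (L2_feat i)) IPC (IP_feat i (Lpsi j)) orth eq_sym.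
have [->|_] := eqVneq i j; last by rewrite !mulr0 mul0r.
by rewrite mulr1 mul1r -expr2 sqr_sqrtr.
Qed.

(** The factor [1 / sqrt mu_k] makes this useless uniformly in [k]; it serves only to pass to the
    limit in finite sums. *)
Lemma bump_feat x e h k : X x -> is_bump x e h ->
  `|acoef h k - feat k x| <= (Num.sqrt (mu k))^-1 * e.
Proof.
move=> Xx bh; have [Lh _ _ _] := bh.
rewrite acoefE // /feat -mulrBl normrM [`|_^-1|]ger0_norm ?invr_ge0 ?sqrtr_ge0 //.
rewrite mulrC ler_wpM2l ?invr_ge0 ?sqrtr_ge0 //.
by have := bump_LKm Xx bh (Lpsi k); rewrite orth eqxx sqrtr1 mul1r.
Qed.

Lemma bump_seq x : X x -> exists h : nat -> T -> R, forall i, is_bump x (i.+1%:R^-1) (h i).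
Proof.
move=> Xx.
have h i : exists f, is_bump x (i.+1%:R^-1) f by apply: exists_bump => //; rewrite invr_gt0 ltr0n.
by have [f hf] := choice h; exists f.
Qed.

Lemma cvg_sum_ord n (f : nat -> nat -> R) (l : nat -> R) :
  (forall k, (f k) @ \oo --> l k) -> (fun i => \sum_(k < n) f k i) @ \oo --> \sum_(k < n) l k.
Proof.
move=> h; elim: n => [|n IH].
  by under eq_fun do rewrite big_ord0; rewrite big_ord0; exact: cvg_cst.
under eq_fun do rewrite big_ord_recr /=.
by rewrite big_ord_recr /=; exact: cvgD.
Qed.

Lemma cvg_invS (c b : R) : (fun i : nat => c + b * i.+1%:R^-1) @ \oo --> c.
Proof.
rewrite -[X in _ --> X]addr0; apply: cvgD; first exact: cvg_cst.
by rewrite -[X in _ --> X](mulr0 b); apply: cvgM; [exact: cvg_cst|exact: cvg_harmonic].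
Qed.

Lemma cvg_le_invS (u : nat -> R) (l c b : R) :
  u @ \oo --> l -> (forall i, u i <= c + b * i.+1%:R^-1) -> l <= c.
Proof.
move=> ul uc; have h := @cvg_invS c b.
rewrite -(cvg_lim _ ul) // -(cvg_lim _ h) //; apply: ler_lim.
- by apply/cvg_ex; exists l.
- by apply/cvg_ex; exists c.
- exact: nearW.
Qed.

Lemma acoef_cvg x h k : X x -> (forall i, is_bump x (i.+1%:R^-1) (h i)) ->
  (fun i => acoef (h i) k) @ \oo --> feat k x.
Proof.
move=> Xx bh; set s := (Num.sqrt (mu k))^-1.
apply: (@squeeze_cvgr _ _ _ _ (fun i => feat k x + (- s) * i.+1%:R^-1)
  (fun i => feat k x + s * i.+1%:R^-1)).
- near=> i; have := bump_feat k Xx (bh i); rewrite -/s mulNr ler_norml.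
  by set z := s * _ => /andP[? ?]; apply/andP; split; lra.
- exact: cvg_invS.
- exact: cvg_invS.
Unshelve. all: by end_near. Qed.

Lemma acoef_sqsum_le n x e h : X x -> is_bump x e h ->
  \sum_(k < n) acoef h k ^+ 2 <= C ^+ 2 + 2 * e.
Proof.
move=> Xx bh; have [Lh _ _ _] := bh.
have -> : \sum_(k < n) acoef h k ^+ 2 = \sum_(k < n) mu k * IP h (psi k) ^+ 2.
  by apply: eq_bigr => k _; rewrite exprMn sqr_sqrtr.
apply: (le_trans (LKm_partial_le n Lh)).
have := bump_kernel Xx Xx bh bh; have /andP[_ kC] := Kdiag Xx.
rewrite ler_norml => /andP[]; lra.
Qed.

Lemma feat_sqsum_le n x : X x -> \sum_(k < n) feat k x ^+ 2 <= C ^+ 2.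
Proof.
move=> Xx; have [h bh] := bump_seq Xx.
have h1 : (fun i => \sum_(k < n) acoef (h i) k ^+ 2) @ \oo --> \sum_(k < n) feat k x ^+ 2.
  apply: (cvg_sum_ord (f := fun k i => acoef (h i) k ^+ 2) (l := fun k => feat k x ^+ 2)) => k.
  have := acoef_cvg (k := k) Xx bh => hk; under eq_fun do rewrite expr2.
  by rewrite expr2; exact: cvgM.
by apply: (cvg_le_invS h1 (b := 2)) => i; exact: (acoef_sqsum_le n Xx (bh i)).
Qed.

(** Uniform in [n]: for two bumps at [x] the form of [L_K] at their difference is close to
    [K x x - K x x - K x x + K x x = 0]. The second bump is then shrunk to the point. *)
Lemma feat_dist_le n x e h : X x -> is_bump x e h ->
  \sum_(k < n) (acoef h k - feat k x) ^+ 2 <= 4 * e.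
Proof.
move=> Xx bh; have [Lh _ _ _] := bh; have [g bg] := bump_seq Xx.
have h1 : (fun i => \sum_(k < n) (acoef h k - acoef (g i) k) ^+ 2) @ \oo -->
    \sum_(k < n) (acoef h k - feat k x) ^+ 2.
  apply: (cvg_sum_ord (f := fun k i => (acoef h k - acoef (g i) k) ^+ 2)
    (l := fun k => (acoef h k - feat k x) ^+ 2)) => k.
  have hk := acoef_cvg (k := k) Xx bg; under eq_fun do rewrite expr2.
  by rewrite expr2; apply: cvgM; apply: cvgB => //; exact: cvg_cst.
apply: (cvg_le_invS h1 (b := 4)) => i; have [Lg _ _ _] := bg i.
have Ld := L2B mX Lh Lg.
have -> : \sum_(k < n) (acoef h k - acoef (g i) k) ^+ 2 =
  \sum_(k < n) mu k * IP (fun y => h y - g i y) (psi k) ^+ 2.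
  by apply: eq_bigr => k _; rewrite IPBl // -mulrBr exprMn sqr_sqrtr.
apply: (le_trans (LKm_partial_le n Ld)).
have Lkh := L2_LKm Lh; have Lkg := L2_LKm Lg.
have -> : IP (LKm (fun y => h y - g i y)) (fun y => h y - g i y) =
  IP (LKm h) h - IP (LKm h) (g i) - (IP (LKm (g i)) h - IP (LKm (g i)) (g i)).
  have -> : IP (LKm (fun y => h y - g i y)) (fun y => h y - g i y) =
     IP (fun y => LKm h y - LKm (g i) y) (fun y => h y - g i y).
    apply: eq_IP => // y; rewrite inE => Xy; have Lk := L2_kernel Xy.
    by rewrite /LKm ![IP (K y) _]IPC IPBl.
  by rewrite IPBl // ![IP (LKm _) _]IPC !IPBl.
have := bump_kernel Xx Xx bh bh; have := bump_kernel Xx Xx bh (bg i).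
have := bump_kernel Xx Xx (bg i) bh; have := bump_kernel Xx Xx (bg i) (bg i).
move: (IP (LKm h) h) (IP (LKm h) (g i)) (IP (LKm (g i)) h) (IP (LKm (g i)) (g i)).
move: (K x x) i.+1%:R^-1 => k z c1 c2 c3 c4.
rewrite !ler_norml => /andP[? ?] /andP[? ?] /andP[? ?] /andP[? ?]; lra.
Qed.


(** The bump radii are fixed before [n]: exchanging features for bump averages costs an amount
    uniform in [n], and for fixed bumps the eigenexpansion of [L_K] converges. *)
Theorem mercer_expansion x y : X x -> X y ->
  (fun n => \sum_(k < n) feat k x * feat k y) @ \oo --> K x y.
Proof.
move=> Xx Xy; have c0 := C0; apply/cvgrPdist_le => e e0.
(* The radii are [D^2], so features differ from averages by [2 D] in norm; the errors [D],
   [2 D (C + 1)] and [2 D C] add up to [D (4 C + 3) <= e / 2]. *)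
set D := e / (2 * (4 * C + 3) + 2 * e).
have den : 0 < 2 * (4 * C + 3) + 2 * e by lra.
have D0 : 0 < D by rewrite divr_gt0.
have D1 : D <= 1 / 2 by rewrite /D ler_pdivrMr //; lra.
have D2 : D * (4 * C + 3) <= e / 2.
  by rewrite /D mulrAC ler_pdivrMr //; nra.
have [h bh] := exists_bump Xx (exprn_gt0 2 D0).
have [h' bh'] := exists_bump Xy (exprn_gt0 2 D0).
have [Lh _ _ _] := bh; have [Lh' _ _ _] := bh'.
have DD : D ^+ 2 <= D / 2 by rewrite expr2 -ler_pdivlMl // mulrA mulVf ?gt_eqF //; lra.
have k2 : `|IP (LKm h) h' - K x y| <= D.
  by apply: (le_trans (bump_kernel Xx Xy bh bh')); lra.
have e2 : 0 < e / 2 by lra.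
have hc : \forall n \near \oo, `|IP (LKm h) h' - \sum_(k < n) mu k * IP h (psi k) * IP h' (psi k)| <= e / 2.
  by move/cvgrPdist_le : (LKm_cvg Lh Lh'); apply.
near=> n.
have k1 : `|IP (LKm h) h' - \sum_(k < n) acoef h k * acoef h' k| <= e / 2.
  have -> : \sum_(k < n) acoef h k * acoef h' k = \sum_(k < n) mu k * IP h (psi k) * IP h' (psi k).
    by apply: eq_bigr => k _; rewrite /acoef -[in RHS](sqr_sqrtr (mu0 k)); ring.
  by near: n.
have n1 : enorm (fun k : 'I_n => acoef h k - feat k x) <= 2 * D.
  apply: enorm_le; first by rewrite mulr_ge0 // ltW.
  by apply: (le_trans (feat_dist_le n Xx bh)); lra.
have n2 : enorm (fun k : 'I_n => acoef h' k - feat k y) <= 2 * D.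
  apply: enorm_le; first by rewrite mulr_ge0 // ltW.
  by apply: (le_trans (feat_dist_le n Xy bh')); lra.
have n3 : enorm (fun k : 'I_n => feat k y) <= C by apply: enorm_le => //; exact: feat_sqsum_le.
have n4 : enorm (fun k : 'I_n => acoef h k) <= C + 1.
  apply: enorm_le; first by lra.
  by apply: (le_trans (acoef_sqsum_le n Xx bh)); rewrite sqrrD; nra.
have -> : K x y - \sum_(k < n) feat k x * feat k y =
  (K x y - IP (LKm h) h') + (IP (LKm h) h' - \sum_(k < n) acoef h k * acoef h' k)
  + (\sum_(k < n) acoef h k * (acoef h' k - feat k y)
     + \sum_(k < n) (acoef h k - feat k x) * feat k y).
  rewrite -big_split /=.
  have -> : \sum_(k < n) feat k x * feat k y = \sum_(k < n) acoef h k * acoef h' k -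
    \sum_(k < n) (acoef h k * (acoef h' k - feat k y) + (acoef h k - feat k x) * feat k y).
    by rewrite -sumrB; apply: eq_bigr => k _; ring.
  ring.
have d1 : `|\sum_(k < n) acoef h k * (acoef h' k - feat k y)| <= (C + 1) * (2 * D).
  apply: (le_trans (dot_le_enorm (fun k : 'I_n => acoef h k) (fun k => acoef h' k - feat k y))).
  by apply: ler_pM => //; exact: enorm_ge0.
have d2 : `|\sum_(k < n) (acoef h k - feat k x) * feat k y| <= 2 * D * C.
  apply: (le_trans (dot_le_enorm (fun k : 'I_n => acoef h k - feat k x) (fun k => feat k y))).
  by apply: ler_pM => //; exact: enorm_ge0.
rewrite -normrN opprB in k2.
move: k1 k2 d1 d2; rewrite !ler_norml => /andP[? ?] /andP[? ?] /andP[? ?] /andP[? ?].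
by apply/andP; split; lra.
Unshelve. all: by end_near. Qed.

End Mercer.

(** * Densities *)

Section Density.
Context d (T : measurableType d) (R : realType).
Variables (lam : {measure set T -> \bar R}) (X : set T) (w : T -> R).
Hypothesis mX : measurable X.
Hypothesis mw : measurable_fun X w.
Hypothesis w0 : forall x, X x -> 0 <= w x.

Section MassOne.
Hypothesis w1 : (\int[lam]_(x in X) (w x)%:E = 1)%E.

Let nu (A : set T) := (\int[lam]_(x in A `&` X) (w x)%:E)%E.

Let nu0 : nu set0 = 0%E.
Proof. by rewrite /nu set0I integral_set0. Qed.

Let nu_ge0 A : (0 <= nu A)%E.
Proof. by apply: integral_ge0 => x [_ Xx]; rewrite lee_fin w0. Qed.

Let nu_sigma_additive : semi_sigma_additive nu.
Proof.
move=> F mF tF mUF; rewrite /nu; apply: cvg_toP.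
  apply: ereal_nondecreasing_is_cvgn => n m nm.
  by apply: lee_sum_nneg_natr => // k _ _; exact: nu_ge0.
rewrite setI_bigcupl ge0_integral_bigcup //=.
- by move=> k; exact: measurableI.
- rewrite -setI_bigcupl; apply: measurable_funS (mX) _ _ => //.
  exact/measurable_EFinP.
- by move=> x [k _ [_ Xx]]; rewrite lee_fin w0.
- exact: trivIset_setIr.
Qed.

HB.instance Definition _ := isMeasure.Build _ _ _ nu nu0 nu_ge0 nu_sigma_additive.

Let nu_setT : nu [set: T] = 1%E. Proof. by rewrite /nu setTI. Qed.

HB.instance Definition _ := @Measure_isProbability.Build _ _ R nu nu_setT.

(** Intersecting with [X] gives a measure on the whole type for which [X] has full mass. *)
Lemma density_probability : exists m : probability T R,
  forall A, measurable A -> m A = (\int[lam]_(x in A `&` X) (w x)%:E)%E.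
Proof. by exists nu. Qed.

End MassOne.

Variable m : {measure set T -> \bar R}.
Hypothesis mE : forall A, measurable A -> m A = (\int[lam]_(x in A `&` X) (w x)%:E)%E.

Import HBNNSimple.

Let integral_density_indic E : measurable E ->
  (\int[m]_(x in X) (\1_E x)%:E = \int[lam]_(x in X) ((\1_E x)%:E * (w x)%:E))%E.
Proof.
move=> mE'; rewrite integral_indic // mE; last exact: measurableI.
rewrite -setIA setIid setIC integral_mkcondr; apply: eq_integral => x _.
by rewrite patchE indicE; case: ifP => xE; rewrite ?mul1e ?mul0e.
Qed.

Let integral_density_nnsfun (f : {nnsfun T >-> R}) :
  (\int[m]_(x in X) (f x)%:E = \int[lam]_(x in X) ((f x)%:E * (w x)%:E))%E.
Proof.
under [LHS]eq_integral do rewrite fimfunE -fsumEFin//.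
rewrite [LHS]ge0_integral_fsum//; last 2 first.
  - by move=> r; apply/measurable_EFinP/measurable_funTS/measurableT_comp.
  - by move=> n x _; rewrite EFinM nnfun_muleindic_ge0.
under [RHS]eq_integral => x xX.
  rewrite fimfunE -fsumEFin// ge0_mule_fsuml; last first.
    by move=> r; rewrite EFinM nnfun_muleindic_ge0.
  over.
rewrite [RHS]ge0_integral_fsum//; last 2 first.
  - move=> r; apply: emeasurable_funM; apply/measurable_EFinP => //.
    exact/measurable_funTS/measurableT_comp.
  - by move=> n x Xx; apply: mule_ge0; [exact: nnfun_muleindic_ge0|rewrite lee_fin w0].
apply: eq_fsbigr => r; rewrite inE => -[t _ <-].
under eq_integral do rewrite EFinM.
under [RHS]eq_integral do rewrite EFinM -muleA.
rewrite !ge0_integralZl ?integral_density_indic //.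
- by apply: emeasurable_funM; apply/measurable_EFinP => //; exact/measurable_indic.
- by move=> x Xx; rewrite mule_ge0 // lee_fin ?w0.
- by rewrite lee_fin.
- by apply/measurable_EFinP; exact/measurable_indic.
- by rewrite lee_fin.
Qed.

Lemma ge0_integral_density (f : T -> \bar R) : measurable_fun X f ->
  (forall x, X x -> (0 <= f x)%E) ->
  (\int[m]_(x in X) f x = \int[lam]_(x in X) (f x * (w x)%:E))%E.
Proof.
move=> mf f0; pose f_ := nnsfun_approx mX mf.
transitivity (limn (fun n => \int[m]_(x in X) (f_ n x)%:E)%E).
  rewrite -monotone_convergence //=.
  - by apply: eq_integral => x /[!inE] Xx; apply/esym/cvg_lim => //; exact: cvg_nnsfun_approx.
  - by move=> n; exact/measurable_EFinP/measurable_funTS.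
  - by move=> n x _; rewrite lee_fin.
  - by move=> x _ i j ij; rewrite lee_fin; exact/lefP/nd_nnsfun_approx.
under eq_fun do rewrite integral_density_nnsfun.
rewrite -monotone_convergence //=.
- apply: eq_integral => x /[!inE] Xx; apply/cvg_lim => //.
  by apply: cvgeZr => //; exact: cvg_nnsfun_approx.
- by move=> n; apply: emeasurable_funM; apply/measurable_EFinP => //; exact/measurable_funTS.
- by move=> n x Xx; rewrite mule_ge0 // lee_fin ?w0.
- move=> x Xx i j ij; rewrite lee_wpmul2r ?lee_fin ?w0 //.
  exact/lefP/nd_nnsfun_approx.
Qed.

Lemma integral_density (f : T -> R) : measurable_fun X f ->
  (\int[m]_(x in X) (f x)%:E = \int[lam]_(x in X) (f x * w x)%:E)%E.
Proof.
move=> mf; have mf' : measurable_fun X (EFin \o f) by exact/measurable_EFinP.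
rewrite integralE [RHS]integralE !ge0_integral_density //.
- congr (_ - _)%E; apply: eq_integral => x; rewrite inE => Xx.
  + by rewrite !funeposE -!EFin_max -EFinM maxr_pMl ?mul0r ?w0.
  + by rewrite !funenegE -!EFinN -!EFin_max -EFinM maxr_pMl ?mul0r ?mulNr ?w0.
- exact: measurable_funeneg.
- exact: measurable_funepos.
Qed.

Lemma Rintegral_density (f : T -> R) : measurable_fun X f ->
  Rintegral m X f = Rintegral lam X (fun x => f x * w x).
Proof. by move=> mf; rewrite /Rintegral integral_density. Qed.

End Density.

(** * Step sizes *)

Section StepSizes.
Context {R : realType}.
Implicit Types x y : R.

(** With [y = ln (1 - x)] and [u = exp (p y)], the tangent bound of [exp] gives
    [u (1 + (1 - p) y) <= 1 - x] and [u (1 - p y) <= 1]. Weighted by [p] and [1 - p], the terms in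
    [y] cancel. *)
Lemma powR_1B_le x (p : R) : 0 <= x < 1 -> 0 <= p <= 1 -> powR (1 - x) p <= 1 - p * x.
Proof.
move=> /andP[x0 x1] /andP[p0 p1].
have h0 : 0 < 1 - x by rewrite subr_gt0.
set y := ln (1 - x); set u := expR (p * y).
have ey : expR y = 1 - x by rewrite lnK ?posrE.
have -> : powR (1 - x) p = u by rewrite /powR gt_eqF.
have u0 : 0 < u by exact: expR_gt0.
have h1 : u * (1 + (1 - p) * y) <= 1 - x.
  have -> : 1 - x = u * expR ((1 - p) * y) by rewrite -ey /u -expRD; congr expR; ring.
  by rewrite ler_pM2l // expR_ge1Dx.
have h2 : u * (1 - p * y) <= 1.
  have := expR_ge1Dx (- (p * y)); rewrite expRN -/u => h.
  by rewrite mulrC -ler_pdivlMr // div1r.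
have h3 : p * (u * (1 + (1 - p) * y)) <= p * (1 - x) by rewrite ler_wpM2l.
have h4 : (1 - p) * (u * (1 - p * y)) <= (1 - p) * 1 by rewrite ler_wpM2l // subr_ge0.
lra.
Qed.

Lemma powR_le_id_or_1 x (p : R) : 0 <= x -> 0 < p <= 1 -> powR x p <= 1 + x.
Proof.
move=> x0 /andP[p0 p1]; have [x1|/ltW x1] := leP x 1; last first.
  by apply: (le_trans (ler1_powR x1 p1)); rewrite lerDr.
have [->|xn] := eqVneq x 0; first by rewrite powR0 ?gt_eqF // addr0.
apply: (@le_trans _ _ (powR x 0)); last by rewrite powRr0 lerDl.
by apply: ger_powR => //; rewrite ?(ltW p0) // lt_def xn x0.
Qed.

Variables (a t0 C beta : R).
Hypothesis C0 : 0 < C.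
Hypothesis a4 : 4 <= a.
Hypothesis beta01 : 1 / 2 <= beta <= 1.
Hypothesis t0_large : powR (2 + 4 * C ^+ 2 * a) ((2 * beta + 1) / (2 * beta)) <= t0.

Let th : R := 2 * beta / (2 * beta + 1).

Definition step j : R := a * powR (bt t0 j) (- (2 * beta / (2 * beta + 1))).

Definition reg j : R := a^-1 * powR (bt t0 j) (- (1 / (2 * beta + 1))).

(** The approximation error [lambda^beta] under the source condition; it instantiates [L]. *)
Definition regpow j : R := powR (reg j) beta.

Let b0 : 0 < beta. Proof. by have /andP[] := beta01; lra. Qed.
Let b1 : 0 < 2 * beta + 1. Proof. by have := b0; lra. Qed.
Let a0 : 0 < a. Proof. by have := a4; lra. Qed.

Let th_half : 1 / 2 <= th.
Proof. by rewrite /th ler_pdivlMr; have /andP[] := beta01; have := b1; lra. Qed.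

Let th_23 : th <= 2 / 3.
Proof. by rewrite /th ler_pdivrMr; have /andP[] := beta01; have := b1; lra. Qed.

Let th_compl : 1 / (2 * beta + 1) = 1 - th.
Proof. by rewrite /th; field; rewrite gt_eqF. Qed.

Let th_beta : beta * (1 - th) = th / 2.
Proof. by rewrite /th; field; rewrite gt_eqF. Qed.

Let base_ge2 : 2 <= 2 + 4 * C ^+ 2 * a.
Proof. by rewrite lerDl mulr_ge0 ?(ltW a0) // mulr_ge0 // exprn_ge0 // ltW. Qed.

Lemma start_ge2 : 2 <= t0.
Proof.
apply: (le_trans base_ge2); apply: (le_trans _ t0_large); apply: le1r_powR.
  by have := base_ge2; lra.
by rewrite ler_pdivlMr ?mul1r ?mulr_gt0 //; lra.
Qed.

Let B2 j : 2 <= bt t0 j. Proof. exact: (bt_ge2 start_ge2). Qed.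
Let Bgt0 j : 0 < bt t0 j. Proof. by have := B2 j; lra. Qed.

Lemma start_powR : 2 + 4 * C ^+ 2 * a <= powR t0 th.
Proof.
have h := base_ge2; have t2 := start_ge2.
have th0 : 0 <= th by have := th_half; lra.
apply: (@le_trans _ _ (powR (powR (2 + 4 * C ^+ 2 * a) ((2 * beta + 1) / (2 * beta))) th)).
  rewrite -powRrM (_ : _ * th = 1) ?powRr1 //; first lra.
  by rewrite /th; field; rewrite !gt_eqF.
by apply: ge0_ler_powR => //; rewrite nnegrE; [exact: powR_ge0|lra].
Qed.

Lemma step_gt0 j : 0 < step j.
Proof. by rewrite mulr_gt0 // powR_gt0. Qed.

Lemma reg_gt0 j : 0 < reg j.
Proof. by rewrite mulr_gt0 ?invr_gt0 // powR_gt0. Qed.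

Lemma regpow_gt0 j : 0 < regpow j.
Proof. by rewrite powR_gt0 // reg_gt0. Qed.

Lemma bt_powR_inv j (p : R) : powR (bt t0 j.+1) (- p) * powR (bt t0 j) p
  = powR (1 - (bt t0 j.+1)^-1) p.
Proof.
rewrite (bt_frac start_ge2) powRM ?invr_ge0 ?(ltW (Bgt0 _)) // mulrC; congr (_ * _).
by rewrite -powR_inv1 ?(ltW (Bgt0 _)) // -powRrM mulN1r.
Qed.

Lemma step_btE j : step j * bt t0 j = a * powR (bt t0 j) (1 - th).
Proof.
rewrite /step -mulrA -/th powRD; last by rewrite (gt_eqF (Bgt0 _)) implybT.
by rewrite powRr1 ?(ltW (Bgt0 _)) //; congr (_ * _); rewrite mulrC.
Qed.

Lemma step_reg j : step j * bt t0 j * reg j = 1.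
Proof.
rewrite step_btE /reg th_compl powRN mulrACA mulfV ?gt_eqF // mul1r mulfV //.
by rewrite gt_eqF // powR_gt0.
Qed.

Lemma step_mul_reg j : step j * reg j = (bt t0 j)^-1.
Proof.
have := step_reg j; rewrite mulrAC => h; apply: (mulIf (lt0r_neq0 (Bgt0 j))).
by rewrite h mulVf // gt_eqF.
Qed.

Lemma bt_leS j : bt t0 j <= bt t0 j.+1.
Proof. by rewrite btS lerDl. Qed.

Let powS j (p : R) : 0 <= p -> powR (bt t0 j) p <= powR (bt t0 j.+1) p.
Proof. by move=> p0; apply: ge0_ler_powR; rewrite ?nnegrE ?(ltW (Bgt0 _)) // bt_leS. Qed.

Lemma step_decr j : step j.+1 <= step j.
Proof.
rewrite /step ler_pM2l // !powRN lef_pV2 ?posrE ?powR_gt0 //; apply: powS.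
by have := th_half; rewrite /th; lra.
Qed.

Lemma step_bt_incr j : step j * bt t0 j <= step j.+1 * bt t0 j.+1.
Proof. by rewrite !step_btE ler_pM2l // powS //; have := th_23; lra. Qed.

Lemma step_small j : step j * C ^+ 2 <= 1 / 4.
Proof.
have h : 4 * C ^+ 2 * a <= powR (bt t0 j) th.
  apply: (@le_trans _ _ (powR t0 th)); first by have := start_powR; lra.
  have t2 := start_ge2.
  apply: ge0_ler_powR; rewrite ?nnegrE ?(ltW (Bgt0 _)) //; first by have := th_half; lra.
    by lra.
  by rewrite /bt lerDr ler0n.
rewrite /step -/th powRN mulrAC ler_pdivrMr ?powR_gt0 //; lra.
Qed.

Let inv_lt1 j : 0 <= (bt t0 j)^-1 < 1.
Proof. by rewrite invr_ge0 (ltW (Bgt0 _)) /= invf_lt1 //; have := B2 j; lra. Qed.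

(** [powR_1B_le] with the exponent [1 - th]; the constant 3 works because [th <= 2/3]. *)
Lemma step_sum j :
  3 * (step j * bt t0 j) + step j.+1 <= 3 * (step j.+1 * bt t0 j.+1).
Proof.
have h : step j * bt t0 j <= step j.+1 * bt t0 j.+1 * (1 - (1 - th) * (bt t0 j.+1)^-1).
  have p1 : 0 <= 1 - th <= 1 by have := th_half; have := th_23; lra.
  have := powR_1B_le (inv_lt1 j.+1) p1.
  rewrite -bt_powR_inv => h1.
  apply: le_trans (_ : step j.+1 * bt t0 j.+1 *
    (powR (bt t0 j.+1) (- (1 - th)) * powR (bt t0 j) (1 - th)) <= _); last first.
    by rewrite ler_pM2l // mulr_gt0 // step_gt0.
  rewrite !step_btE -mulrA ler_pM2l // mulrA powRN mulfV ?mul1r //.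
  by rewrite gt_eqF // powR_gt0.
have h2 : step j.+1 * bt t0 j.+1 * (1 - (1 - th) * (bt t0 j.+1)^-1) =
   step j.+1 * bt t0 j.+1 - step j.+1 * (1 - th).
  by field; rewrite gt_eqF.
have h3 : step j.+1 * (1 / 3) <= step j.+1 * (1 - th).
  by rewrite ler_pM2l ?step_gt0 //; have := th_23; lra.
lra.
Qed.

Lemma regpowE j : regpow j = powR a (- beta) * powR (bt t0 j) (- (th / 2)).
Proof.
rewrite /regpow /reg powRM ?invr_ge0 ?powR_ge0 ?(ltW a0) //; congr (_ * _).
  by rewrite -powR_inv1 ?(ltW a0) // -powRrM mulN1r.
by rewrite -powRrM th_compl -th_beta; congr powR; ring.
Qed.

Lemma regpow_decr j : regpow j.+1 <= regpow j.
Proof.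
rewrite !regpowE ler_pM2l ?powR_gt0 // !powRN lef_pV2 ?posrE ?powR_gt0 //; apply: powS.
by have := th_half; lra.
Qed.

(** [powR_1B_le] with the exponent [1 - th / 2], which is at least 2/3. *)
Lemma regpow_step j : regpow j * (1 - (bt t0 j.+1)^-1) <=
  regpow j.+1 * (1 - 2 / 3 * (bt t0 j.+1)^-1).
Proof.
rewrite !regpowE -[leLHS]mulrA -[leRHS]mulrA ler_pM2l ?powR_gt0 //.
have p1 : 0 <= 1 - th / 2 <= 1 by have := th_half; have := th_23; lra.
have := powR_1B_le (inv_lt1 j.+1) p1; rewrite -bt_powR_inv => h.
have -> : powR (bt t0 j) (- (th / 2)) * (1 - (bt t0 j.+1)^-1) =
  powR (bt t0 j.+1) (- (th / 2)) *
   (powR (bt t0 j.+1) (- (1 - th / 2)) * powR (bt t0 j) (1 - th / 2)).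
  rewrite (bt_frac start_ge2) [RHS]mulrA -powRD; last by rewrite (gt_eqF (Bgt0 _)) implybT.
  rewrite [X in powR (bt t0 j.+1) X](_ : _ = -1); last by ring.
  rewrite powR_inv1 ?(ltW (Bgt0 _)) //.
  rewrite (_ : 1 - th / 2 = - (th / 2) + 1); last by ring.
  rewrite powRD ?powRr1 ?(ltW (Bgt0 _)) //; last by rewrite (gt_eqF (Bgt0 _)) implybT.
  by ring.
rewrite ler_pM2l ?powR_gt0 //; apply: (le_trans h).
rewrite lerD2l lerN2 ler_wpM2r //; first by rewrite invr_ge0 (ltW (Bgt0 _)).
by have := th_23; lra.
Qed.

Lemma powR_le_regpow mu j : 0 <= mu ->
  powR mu beta <= regpow j * (1 + 3 / 2 * (step j * bt t0 j) * mu).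
Proof.
move=> mu0; have r0 := reg_gt0 j.
have -> : mu = reg j * (mu / reg j) by rewrite mulrC divfK // gt_eqF.
have x0 : 0 <= mu / reg j by rewrite divr_ge0 // ltW.
set x := mu / reg j in x0 *.
rewrite powRM ?(ltW r0) // -/(regpow j) ler_pM2l ?regpow_gt0 //.
rewrite -mulrA [X in _ * X]mulrA step_reg mul1r.
have : powR x beta <= 1 + x by apply: powR_le_id_or_1 => //; have /andP[] := beta01; have := b0; lra.
lra.
Qed.

(** * Comparison of the tail bound with the stated constants *)

Section FinalBound.
Variables (alpha gam ell : R).
Hypothesis alpha01 : 0 < alpha < 1.
Hypothesis gam0 : 0 <= gam.
Hypothesis ell_ge : 2 / 3 <= ell.

Lemma core_bound_le T tau : core_bound alpha C t0 step regpow tau gam T ell <=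
  2 * tau + (2 * t0 / alpha / bt t0 T
  + ((5 * beta + 1) / (beta * (1 + beta)) * gam * powR a (- beta)
     + 16 * C / alpha * Num.sqrt a * ell) * powR (bt t0 T)^-1 (beta / (2 * beta + 1))
  + (32 * C ^+ 3 / alpha * powR a (5 / 2)
     + 8 * C ^+ 3 * (10 * C + 3) / alpha * powR a (7 / 2) * Num.sqrt (ln (bt t0 T)))
    * ell ^+ 2 * powR (bt t0 T)^-1 ((4 * beta - 1) / (4 * beta + 2))).
Proof.
have /andP[al0 al1] := alpha01; have c0 := C0; have aa := a4; have g0 := gam0; have l0 := ell_ge.
set b := bt t0 T; set A := Num.sqrt a.
have bb : 0 < b := Bgt0 T.
set s := powR b (- (th / 2)); set v := powR b (- ((4 * beta - 1) / (4 * beta + 2))).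
have A0 : 0 < A by rewrite sqrtr_gt0.
have AA : A ^+ 2 = a by rewrite sqr_sqrtr // ltW.
have s0 : 0 < s by rewrite powR_gt0.
have v0 : 0 < v by rewrite powR_gt0.
have powV (p : R) : powR b^-1 p = powR b (- p).
  by rewrite -powR_inv1 ?(ltW bb) // -powRrM mulN1r.
have powA (k : nat) (q : R) : q = k%:R + 2^-1 -> powR a q = a ^+ k * A.
  move=> ->; rewrite powRD ?(gt_eqF a0) ?implybT //.
  by rewrite powR_mulrn ?powR12_sqrt // ltW.
have a5 : powR a (5 / 2) = a ^+ 2 * A by apply: powA; field.
have a7 : powR a (7 / 2) = a ^+ 3 * A by apply: powA; field.
rewrite !powV a5 a7.
have -> : - (beta / (2 * beta + 1)) = - (th / 2) by rewrite /th; field; rewrite gt_eqF.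
rewrite -/s -/v.
have sqrt_pow (p : R) : Num.sqrt (powR b p) = powR b (p / 2).
  by rewrite -powR12_sqrt ?powR_ge0 // -powRrM.
have e1 : Num.sqrt (step T) = A * s.
  by rewrite /step sqrtrM ?(ltW a0) // sqrt_pow mulNr.
have e2 : step T * Num.sqrt (step T * b) = a * A * v.
  rewrite step_btE sqrtrM ?(ltW a0) // sqrt_pow /step -/th -/b -/A.
  have -> : v = powR b (- th) * powR b ((1 - th) / 2).
    rewrite -powRD ?(gt_eqF bb) ?implybT //; congr powR.
    by rewrite /th; field; rewrite !gt_eqF //; have := b0; lra.
  ring.
have st0 := step_gt0 T.
set w := Num.sqrt (step T * b) in e2.
have w0 : 0 <= w by rewrite sqrtr_ge0.
have ww : w ^+ 2 = step T * b by rewrite sqr_sqrtr // mulr_ge0 // ltW.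
set I := Num.sqrt alpha^-1.
have ia0 : 0 < alpha^-1 by rewrite invr_gt0.
have ia1 : 1 <= alpha^-1 by rewrite invf_ge1 // ltW.
have I0 : 0 <= I by exact: sqrtr_ge0.
have II : I ^+ 2 = alpha^-1 by rewrite sqr_sqrtr // ltW.
have I_le : I <= alpha^-1.
  by rewrite -ler_sqr ?nnegrE ?(ltW ia0) // II expr2 ler_pMl.
set h := a * A * v in e2.
have h0 : 0 < h by rewrite /h !mulr_gt0.
set Q := C ^+ 3 * h / alpha.
have Q0 : 0 < Q by rewrite /Q !mulr_gt0 // exprn_gt0.
set sl := Num.sqrt (ln b).
have sl0 : 0 <= sl by exact: sqrtr_ge0.
have lb0 : 0 <= ln b by rewrite ln_ge0 //; have := B2 T; rewrite -/b; lra.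
have l2 : ell <= 3 / 2 * ell ^+ 2 by rewrite expr2; nra.
have l20 : 0 <= ell ^+ 2 by exact: sqr_ge0.
have t1 : t0 / b * I <= t0 / alpha / b.
  rewrite [leRHS]mulrAC ler_wpM2l // divr_ge0 ?(ltW bb) //; have := start_ge2; lra.
(* [3 <= (5 beta + 1) / (beta (1 + beta))] amounts to [(3 beta + 1) (beta - 1) <= 0]. *)
have t2 : 3 * gam * regpow T <= (5 * beta + 1) / (beta * (1 + beta)) * gam * powR a (- beta) * s.
  rewrite regpowE -/b -/s !mulrA ler_pM2r // ler_pM2r ?powR_gt0 // ler_wpM2r //.
  have bp := b0; have /andP[bh b1'] := beta01.
  by rewrite ler_pdivlMr ?mulr_gt0 //; [nra|lra].
have t3 : 8 * ell * C * Num.sqrt (step T) / alpha <= 16 * C / alpha * A * ell * s.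
  have : 0 <= ell * C * (A * s) / alpha.
    by rewrite divr_ge0 ?(ltW al0) // !mulr_ge0 ?(ltW C0) ?(ltW A0) ?(ltW s0) //; lra.
  rewrite e1; have -> : 16 * C / alpha * A * ell * s = 16 * (ell * C * (A * s) / alpha) by ring.
  have -> : 8 * ell * C * (A * s) / alpha = 8 * (ell * C * (A * s) / alpha) by ring.
  lra.
have C3 : 0 < C ^+ 3 * h by rewrite mulr_gt0 // exprn_gt0.
have IQ : C ^+ 3 * h * I <= Q by rewrite /Q ler_pM2l.
have t4 : 16 * ell * C ^+ 2 * step T * (C * (I * w)) <= 24 * ell ^+ 2 * Q.
  have -> : 16 * ell * C ^+ 2 * step T * (C * (I * w)) = 16 * ell * (C ^+ 3 * h * I).
    by rewrite -e2; ring.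
  apply: (@le_trans _ _ (16 * ell * Q)); first by rewrite ler_wpM2l //; lra.
  by rewrite ler_pM2r //; lra.
have t5 : 30 * ell ^+ 2 * C ^+ 2 * step T * Lg C step T * I <= 104 * ell ^+ 2 * Q.
  have tl0 : 0 <= tail step T 0 by apply: sumr_ge0 => i _; rewrite ltW // step_gt0.
  (* The logarithm is traded for a square root of the sum of the steps; [104^2] just exceeds
     [60^2 * 3]. In this way the term joins those without [ln (bt T)], and 24 + 104 = 128. *)
  have LgC : Lg C step T <= 104 / 30 * (C * w).
    apply: (@le_trans _ _ (2 * Num.sqrt (C ^+ 2 * tail step T 0))).
      by apply: ln1D_le_sqrt; rewrite mulr_ge0 // sqr_ge0.
    rewrite -(ler_pM2l (_ : 0 < 30)) // mulrA [leRHS]mulrA.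
    have -> : (30 : R) * (104 / 30) = 104 by field.
    have -> : (30 : R) * 2 = 60 by ring.
    rewrite -ler_sqr ?nnegrE ?mulr_ge0 ?sqrtr_ge0 ?(ltW C0) //.
    rewrite !exprMn sqr_sqrtr; last by rewrite mulr_ge0 // sqr_ge0.
    rewrite ww [leLHS]mulrCA [leRHS]mulrCA ler_pM2l ?exprn_gt0 //.
    have := tail0_le start_ge2 step_gt0 step_sum T; rewrite -/b.
    have : 0 <= step T * b by rewrite mulr_ge0 // ltW.
    lra.
  have -> : 30 * ell ^+ 2 * C ^+ 2 * step T * Lg C step T * I =
    30 * ell ^+ 2 * (C ^+ 2 * (step T * I) * Lg C step T) by ring.
  apply: (@le_trans _ _ (30 * ell ^+ 2 * (C ^+ 2 * (step T * I) * (104 / 30 * (C * w))))).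
    rewrite ler_wpM2l //; first by rewrite mulr_ge0.
    by rewrite ler_wpM2l // mulr_ge0 ?sqr_ge0 // mulr_ge0 // ltW.
  have -> : 30 * ell ^+ 2 * (C ^+ 2 * (step T * I) * (104 / 30 * (C * w))) =
    104 * ell ^+ 2 * (C ^+ 3 * h * I) by rewrite -e2; field.
  by rewrite ler_wpM2l // mulr_ge0.
have t6 : 35 * ell ^+ 2 * Num.sqrt (90 * C ^+ 6 / alpha * (step T ^+ 3 * b * ln b)) <=
    333 * ell ^+ 2 * Q * sl.
  have -> : 333 * ell ^+ 2 * Q * sl = 35 * ell ^+ 2 * (333 / 35 * (Q * sl)) by field.
  rewrite ler_wpM2l //; first by rewrite mulr_ge0.
  have q0 : 0 <= 333 / 35 * (Q * sl).
    by apply: mulr_ge0; [lra|apply: mulr_ge0; [exact: ltW|]].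
  rewrite -[leRHS](ger0_norm q0) -sqrtr_sqr ler_wsqrtr //.
  have -> : 90 * C ^+ 6 / alpha * (step T ^+ 3 * b * ln b) =
    90 * ((C ^+ 3 * h) ^+ 2 * alpha^-1 * ln b).
    have -> : (C ^+ 3 * h) ^+ 2 = C ^+ 6 * (step T ^+ 2 * w ^+ 2) by rewrite -e2; ring.
    rewrite ww; ring.
  have -> : (333 / 35 * (Q * sl)) ^+ 2 =
    (333 / 35) ^+ 2 * ((C ^+ 3 * h) ^+ 2 * alpha^-1 * ln b * alpha^-1).
    have sl2 : sl ^+ 2 = ln b by rewrite sqr_sqrtr.
    by rewrite -sl2 /Q; ring.
  have y0 : 0 <= (C ^+ 3 * h) ^+ 2 * alpha^-1 * ln b.
    by rewrite mulr_ge0 // mulr_ge0 ?sqr_ge0 // ltW.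
  set y := _ * ln b in y0 *.
  have : y <= y * alpha^-1 by rewrite ler_peMr.
  lra.
(* The condition [a >= 4] pays for the constants: one surplus factor [a] turns 128 into 32, two
   reduce 333 to 24. *)
have ahv : 4 * h <= a ^+ 2 * A * v.
  have -> : a ^+ 2 * A * v = a * h by rewrite /h; ring.
  by rewrite ler_pM2r.
have ahv3 : 16 * h <= a ^+ 3 * A * v.
  have -> : a ^+ 3 * A * v = a * (a ^+ 2 * A * v) by rewrite /h; ring.
  have h1 : a * (4 * h) <= a * (a ^+ 2 * A * v) by rewrite ler_pM2l.
  have h2 : 4 * (4 * h) <= a * (4 * h) by rewrite ler_pM2r // mulr_gt0.
  lra.
set K3 := C ^+ 3 / alpha.
have K0 : 0 < K3 by rewrite /K3 mulr_gt0 // exprn_gt0.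
have QE : Q = K3 * h by rewrite /Q /K3; ring.
have t7 : 128 * ell ^+ 2 * Q <= 32 * C ^+ 3 / alpha * (a ^+ 2 * A) * ell ^+ 2 * v.
  have -> : 32 * C ^+ 3 / alpha * (a ^+ 2 * A) * ell ^+ 2 * v =
    32 * ell ^+ 2 * (K3 * (a ^+ 2 * A * v)) by rewrite /K3; ring.
  have -> : 128 * ell ^+ 2 * Q = 32 * ell ^+ 2 * (K3 * (4 * h)) by rewrite QE; ring.
  apply: ler_wpM2l; first by rewrite mulr_ge0.
  by rewrite (ler_pM2l K0).
have t8 : 333 * ell ^+ 2 * Q * sl <=
    8 * C ^+ 3 * (10 * C + 3) / alpha * (a ^+ 3 * A) * sl * ell ^+ 2 * v.
  have -> : 8 * C ^+ 3 * (10 * C + 3) / alpha * (a ^+ 3 * A) * sl * ell ^+ 2 * v =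
    (K3 * (ell ^+ 2 * sl)) * ((8 * (10 * C + 3)) * (a ^+ 3 * A * v)) by rewrite /K3; ring.
  have -> : 333 * ell ^+ 2 * Q * sl = (K3 * (ell ^+ 2 * sl)) * (333 * h) by rewrite QE; ring.
  rewrite ler_wpM2l //; first by rewrite mulr_ge0 ?(ltW K0) // mulr_ge0.
  apply: (@le_trans _ _ (24 * (16 * h))); first lra.
  by apply: ler_pM; [lra|lra|lra|exact: ahv3].
rewrite /core_bound /ebound /supf -/b -/I -/w -/sl; lra.
Qed.

End FinalBound.
End StepSizes.

(** * Laws with densities, limsup of events, Fatou *)

Section Generic.
Context {R : realType} {d} {T : measurableType d}.

Lemma expect_comp_density {d'} {U : measurableType d'} (nu : probability U R)
    (f : U -> T) (lam : {measure set T -> \bar R}) (X : set T) (p h : T -> R) :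
  measurable X -> measurable_fun X p -> (forall x, X x -> 0 <= p x) ->
  (\int[lam]_(x in X) (p x)%:E = 1)%E -> measurable_fun setT f ->
  (forall A, measurable A -> nu (f @^-1` A) = (\int[lam]_(x in A `&` X) (p x)%:E)%E) ->
  bmeas h -> \int[nu]_u h (f u) = Rintegral lam X (fun x => h x * p x).
Proof.
move=> mX mp p0 p1 mf fE bh; have [mh [M hM]] := bh.
have ih : nu.-integrable setT (EFin \o (h \o f)).
  apply: bmeas_integrable; split; first exact: measurableT_comp.
  by exists M => u; exact: hM.
have [m1 m1E] := density_probability mX mp p0 p1.
have mh' : measurable_fun setT (EFin \o h) by exact/measurable_EFinP.
have ih1 : m1.-integrable setT (EFin \o h) by exact: bmeas_integrable.
have XC0 : m1 (~` X) = 0%E by rewrite m1E ?setICl ?integral_set0 //; exact: measurableC.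
rewrite /Rintegral -(integral_density mX mp p0 m1E); last exact: measurable_funTS.
congr fine.
transitivity (\int[pushforward nu f]_x (h x)%:E)%E.
  by rewrite (integral_pushforward mf).
transitivity (\int[m1]_x (h x)%:E)%E.
  by apply: eq_measure_integral => A mA _; rewrite [RHS]m1E //; exact: fE.
by rewrite (negligible_integral (measurableC mX) measurableT ih1 XC0) setTD setCK.
Qed.

(** The events of different truncations are unrelated; still, with probability at least [c],
    infinitely many of them occur, which is enough for a limit along a subsequence. *)
Lemma lim_sup_set_ge (P : probability T R) (E : nat -> set T) (c : \bar R) :
  (forall n, measurable (E n)) -> (forall n, (c <= P (E n))%E) -> (c <= P (lim_sup_set E))%E.
Proof.
move=> mE cE; have h : (P (\bigcup_(k >= n) E k) @[n --> \oo] --> P (lim_sup_set E))%E.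
  apply: lim_sup_set_cvg => //; apply: (@le_lt_trans _ _ 1%E); last by rewrite ltry.
  by apply: probability_le1; exact: bigcup_measurable.
rewrite -(cvg_lim _ h) //; apply: lime_ge; first by apply/cvg_ex; eexists; exact: h.
apply: nearW => n; apply: (le_trans (cE n)); apply: le_measure; rewrite ?inE //.
  by apply: bigcup_measurable.
by move=> x Ex; exists n => /=.
Qed.

Lemma fatou_le (m : {measure set T -> \bar R}) (X : set T) (u : nat -> T -> R) (v : T -> R)
    (c : \bar R) : measurable X -> (forall n, measurable_fun X (u n)) ->
  (forall n x, X x -> 0 <= u n x) -> (forall x, X x -> u ^~ x @ \oo --> v x) ->
  (forall n, (\int[m]_(x in X) (u n x)%:E <= c)%E) -> (\int[m]_(x in X) (v x)%:E <= c)%E.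
Proof.
move=> mX mu u0 uv uc.
have mu' n : measurable_fun X (EFin \o u n) by exact/measurable_EFinP.
have u0' n x : X x -> (0 <= (EFin \o u n) x)%E by move=> Xx; rewrite lee_fin u0.
have := fatou m mX mu' u0'.
have -> : (\int[m]_(x in X) limn_einf (fun n => (EFin \o u n) x) = \int[m]_(x in X) (v x)%:E)%E.
  apply: eq_integral => x; rewrite inE => Xx; apply: (cvg_limn_einf_sup _).1.
  by apply: cvg_EFin; [exact: nearW|exact: uv].
move=> h; apply: (le_trans h); rewrite limn_einf_lim; apply: lime_le.
  exact: is_cvg_einfs.
apply: nearW => n; apply: (le_trans _ (uc n)); apply: ereal_inf_lbound.
by exists n => /=.
Qed.

End Generic.

(** * The truncated iterates and their limit *)

Section RatioModel.
Variables (R : realType) (d : nat).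
Local Notation T := (Rd R d).
Variables (lam : {measure set T -> \bar R}) (X : set T) (p q : T -> R) (alpha : R).
Hypothesis mX : measurable X.
Hypothesis dp : is_density lam X p.
Hypothesis dq : is_density lam X q.
Hypothesis alpha01 : 0 < alpha < 1.

Definition mixture x : R := (1 - alpha) * p x + alpha * q x.

Definition rel_ratio x : R := q x / mixture x.

Let a0 : 0 < alpha. Proof. by have /andP[] := alpha01. Qed.
Let a1 : 0 < 1 - alpha. Proof. by have /andP[] := alpha01; lra. Qed.

Lemma measurable_mixture : measurable_fun X mixture.
Proof. by have [mp _] := dp; have [mq _] := dq; apply: measurable_funD; exact: measurable_funM. Qed.

Lemma mixture_ge0 x : X x -> 0 <= mixture x.
Proof.
have [_ [p0 _]] := dp; have [_ [q0 _]] := dq => Xx.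
by rewrite addr_ge0 // mulr_ge0 ?p0 ?q0 // ltW.
Qed.

Lemma mixture_mass : (\int[lam]_(x in X) (mixture x)%:E = 1)%E.
Proof.
have [mp [p0 p1]] := dp; have [mq [q0 q1]] := dq.
under eq_integral do rewrite EFinD !EFinM.
have mp' : measurable_fun X (EFin \o p) by exact/measurable_EFinP.
have mq' : measurable_fun X (EFin \o q) by exact/measurable_EFinP.
rewrite ge0_integralD //=; last 4 first.
- by move=> x Xx; rewrite -EFinM lee_fin mulr_ge0 ?p0 // ltW.
- exact: emeasurable_funM.
- by move=> x Xx; rewrite -EFinM lee_fin mulr_ge0 ?q0 // ltW.
- exact: emeasurable_funM.
rewrite !ge0_integralZl // ?lee_fin ?(ltW a0) ?(ltW a1) //.
by rewrite p1 q1 !mule1 -EFinD subrK.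
Qed.

Lemma q_le_mixture x : X x -> q x <= alpha^-1 * mixture x.
Proof.
have [_ [p0 _]] := dp => Xx; rewrite ler_pdivlMl //.
by rewrite /mixture lerDr mulr_ge0 ?p0 // ltW.
Qed.

(** Where the mixture vanishes, [q] vanishes too because [q <= mixture / alpha], so the value given
    to the division does no harm. *)
Lemma rel_ratio_mixture x : X x -> rel_ratio x * mixture x = q x.
Proof.
move=> Xx; rewrite /rel_ratio; have [e|ne] := eqVneq (mixture x) 0; last by rewrite divfK.
have := q_le_mixture Xx; have [_ [q0 _]] := dq; have := q0 x Xx; rewrite e !mulr0 => h1 h2.
by apply/eqP; rewrite eq_le h1 h2.
Qed.

Lemma rel_ratio_bounds x : X x -> 0 <= rel_ratio x <= alpha^-1.
Proof.
move=> Xx; have [_ [q0 _]] := dq; have w0 := mixture_ge0 Xx.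
rewrite /rel_ratio divr_ge0 ?q0 //=; have [->|ne] := eqVneq (mixture x) 0.
  by rewrite invr0 mulr0 invr_ge0 ltW.
by rewrite ler_pdivrMr ?q_le_mixture // lt_def ne.
Qed.

Lemma measurable_rel_ratio : measurable_fun X rel_ratio.
Proof.
have [mq _] := dq.
apply: (eq_measurable_fun (fun x => q x * powR (mixture x) (-1))).
  by move=> x; rewrite inE => Xx; rewrite /rel_ratio powR_inv1 // mixture_ge0.
apply: measurable_funM => //.
exact: (measurableT_comp (@measurable_powR R (-1)) measurable_mixture).
Qed.

Section Transfer.
Variable m : probability T R.
Hypothesis mE : forall A, measurable A -> m A = (\int[lam]_(x in A `&` X) (mixture x)%:E)%E.

Lemma mixture_prob1 : m X = 1%E.
Proof. by rewrite mE // setIid mixture_mass. Qed.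

Lemma integral_mixture (f : T -> R) : measurable_fun X f ->
  (\int[m]_(x in X) (f x)%:E = \int[lam]_(x in X) (f x * mixture x)%:E)%E.
Proof. exact: (integral_density mX measurable_mixture mixture_ge0 mE). Qed.

Lemma inL2_L2 f : inL2 lam X mixture f <-> L2 m X f.
Proof.
by split => -[mf h]; split => //; [rewrite integral_mixture|rewrite -integral_mixture] => //;
  exact: measurable_funX.
Qed.

Lemma ip_IP f h : measurable_fun X f -> measurable_fun X h -> ip lam X mixture f h = IP m X f h.
Proof.
move=> mf mh; rewrite /ip /IP /Rintegral integral_mixture //.
exact: measurable_funM.
Qed.

Lemma L2_lim_expansion (psi : nat -> T -> R) (c c' : nat -> R) (F F' : T -> R) :
  (forall k, measurable_fun X (psi k)) -> measurable_fun X F' -> {in X, F =1 F'} ->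
  (forall k, c k = c' k) ->
  L2_lim lam X mixture (fun n y => \sum_(k < n) c k * psi k y) F -> L2_expansion m X psi c' F'.
Proof.
move=> mpsi mF FF cc; rewrite /L2_lim /L2_expansion => h; apply: cvg_trans h.
have -> // : (fun n => \int[m]_(x in X) ((F' x - \sum_(k < n) c' k * psi k x) ^+ 2)%:E)%E =
  (fun n => \int[lam]_(x in X) ((F x - \sum_(k < n) c k * psi k x) ^+ 2 * mixture x)%:E)%E.
apply/funext => n; rewrite integral_mixture.
  apply: eq_integral => x Xx; rewrite FF //; congr (((_ - _) ^+ 2 * _)%:E).
  by apply: eq_bigr => k _; rewrite cc.
apply: measurable_funX; apply: measurable_funB => //.
by apply: measurable_sum => k; exact: measurable_funM.
Qed.

Lemma mixture_full : dsupport lam X mixture = X ->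
  forall (x : T) (U : set 'rV[R]_d), X x -> open U -> U x -> (0 < m (U `&` X))%E.
Proof.
move=> sX x U Xx oU Ux; rewrite mE; last first.
  by apply: measurableI => //; apply: sub_sigma_algebra.
by rewrite -setIA setIid; move: Xx; rewrite -{1}sX => -[_]; apply.
Qed.

Lemma domain_nonempty : exists x, X x.
Proof.
apply/set0P/eqP => X0; have := mixture_mass; rewrite X0 integral_set0.
by move=> /(congr1 fine)/eqP; rewrite /= eq_sym oner_eq0.
Qed.

End Transfer.

End RatioModel.

Lemma law_exists {R : realType} {d d'} {O : measurableType d} {U : measurableType d'}
    (P : probability O R) (f : O -> U) : measurable_fun setT f ->
  exists nu : probability U R, forall A, measurable A -> nu A = P (f @^-1` A).
Proof.
move=> mf; pose F : {RV P >-> U} := HB.pack f (isMeasurableFun.Build _ _ _ _ _ mf).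
by exists (distribution P F).
Qed.

Lemma probability_setI1 {R : realType} {d} {O : measurableType d} (P : probability O R)
    (A B : set O) : measurable A -> measurable B -> P B = 1%E -> P (A `&` B) = P A.
Proof.
move=> mA mB PB; rewrite (measureDI P mA mB) [X in (X + _)%E](_ : _ = 0%E) ?add0e //.
apply: (subset_measure0 (B := ~` B)); first exact: measurableD.
- exact: measurableC.
- by move=> x [].
- by have h := probability_setC P mB; rewrite PB subee // in h.
Qed.

Section Truncation.
Variables (R : realType) (d : nat).
Local Notation T := (Rd R d).
Variables (lam : {measure set T -> \bar R}) (X : set T) (p q : T -> R) (alpha : R).
Variables (K : T -> T -> R) (C : R) (mu : nat -> R) (psi : nat -> T -> R).
Variables (beta : R) (g : T -> R).
Hypothesis mX : measurable X.
Hypothesis dp : is_density lam X p.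
Hypothesis dq : is_density lam X q.
Hypothesis alpha01 : 0 < alpha < 1.
Hypothesis sX : dsupport lam X (mixture p q alpha) = X.
Hypothesis merc : mercer_kernel X K.
Hypothesis KC : forall x, X x -> Num.sqrt (K x x) <= C.
Hypothesis eigs : eigensystem lam X (mixture p q alpha) K mu psi.
Hypothesis beta01 : 1 / 2 <= beta <= 1.
Hypothesis gL2 : inL2 lam X (mixture p q alpha) g.
Hypothesis gpow : is_LK_pow lam X (mixture p q alpha) mu psi beta g (rel_ratio p q alpha).
Variable m : probability T R.
Hypothesis mE : forall A, measurable A ->
  m A = (\int[lam]_(x in A `&` X) (mixture p q alpha x)%:E)%E.

Local Notation w := (mixture p q alpha).
Local Notation r := (rel_ratio p q alpha).
Local Notation L2 := (L2 m X).
Local Notation IP := (IP m X).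
Local Notation feat := (feat m X K mu psi).

Let m1 : m X = 1%E := mixture_prob1 mX dp dq alpha01 mE.
Let full := mixture_full mX mE sX.
Let a0 : 0 < alpha. Proof. by have /andP[] := alpha01. Qed.

Let C_ge0 : 0 <= C.
Proof.
have [x Xx] := domain_nonempty mX dp dq alpha01.
exact: (le_trans (sqrtr_ge0 _) (KC Xx)).
Qed.

Lemma L2_psi k : L2 (psi k).
Proof. by have [h _ _ _ _] := eigs; apply/(inL2_L2 mX dp dq alpha01 mE). Qed.

Lemma L2_g : L2 g.
Proof. exact/(inL2_L2 mX dp dq alpha01 mE). Qed.

Lemma orth_psi i j : IP (psi i) (psi j) = (i == j)%:R.
Proof.
have [_ h _ _ _] := eigs; rewrite -h (ip_IP mX dp dq alpha01 mE) //.
- by have [] := L2_psi i.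
- by have [] := L2_psi j.
Qed.

Lemma eigenvalue_ge0 k : 0 <= mu k.
Proof. by have [_ _ h _ _] := eigs. Qed.

Lemma eigen_expansion f : L2 f ->
  L2_expansion m X psi (fun k => mu k * IP f (psi k)) (LKm m X K f).
Proof.
move=> Lf; have [_ _ _ _ h] := eigs.
have mf := Lf.1; have mpsi k : measurable_fun X (psi k) := (L2_psi k).1.
apply: (L2_lim_expansion (c := fun k => mu k * ip lam X w f (psi k)) mX dp dq alpha01 mE mpsi
  _ _ _ (h f _)).
- by have [] := L2_LKm mX m1 merc KC C_ge0 Lf.
- move=> s; rewrite inE => Xs; rewrite /LKm -(ip_IP mX dp dq alpha01 mE) //.
  exact: measurable_kernel merc KC C_ge0 _ Xs.
- by move=> k /=; rewrite (ip_IP mX dp dq alpha01 mE).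
- exact/(inL2_L2 mX dp dq alpha01 mE).
Qed.

Lemma L2_ratio : L2 r.
Proof.
apply: (L2_bounded mX m1 (M := alpha^-1)); first exact: measurable_rel_ratio dp dq alpha01.
by move=> x Xx; have /andP[r0 r1] := rel_ratio_bounds dp dq alpha01 Xx; rewrite ger0_norm.
Qed.

Lemma ratio_expansion : L2_expansion m X psi (fun k => powR (mu k) beta * IP g (psi k)) r.
Proof.
have mg := L2_g.1; have mpsi k : measurable_fun X (psi k) := (L2_psi k).1.
apply: (L2_lim_expansion (c := fun k => powR (mu k) beta * ip lam X w g (psi k)) mX dp dq
  alpha01 mE mpsi _ _ _ gpow) => //.
- exact: L2_ratio.1.
- by move=> k /=; rewrite (ip_IP mX dp dq alpha01 mE).
Qed.

Definition rcoef k := powR (mu k) beta * IP g (psi k).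

Lemma IP_ratio_psi k : IP r (psi k) = rcoef k.
Proof. exact: (expansion_coef mX m1 L2_psi orth_psi k L2_ratio ratio_expansion). Qed.

Lemma IP_ratio_feat k : IP r (feat k) = Num.sqrt (mu k) * rcoef k.
Proof.
rewrite (IP_feat mX m1 merc KC C_ge0 L2_psi orth_psi eigenvalue_ge0 eigen_expansion) ?IP_ratio_psi //.
exact: L2_ratio.
Qed.

Definition rtail n := Num.sqrt (IP r r - \sum_(k < n) rcoef k ^+ 2).

Lemma sqr_rtail n : rtail n ^+ 2 = IP r r - \sum_(k < n) rcoef k ^+ 2.
Proof.
rewrite sqr_sqrtr // subr_ge0.
have := bessel mX m1 L2_psi orth_psi n L2_ratio.
by under eq_bigr do rewrite IP_ratio_psi.
Qed.

Lemma rtail_cvg : rtail @ \oo --> 0.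
Proof.
have h := expansion_tail mX m1 L2_psi orth_psi L2_ratio ratio_expansion.
rewrite -[X in _ --> X](@sqrtr0 R).
by apply: (continuous_cvg _ _ h); exact: sqrt_continuous.
Qed.

(** If [C] were 0, all features and hence all eigenvalues would vanish; the source condition would
    make the ratio zero in [L^2], although its mean is the total mass 1 of [q]. *)
Lemma kernel_bound_gt0 : 0 < C.
Proof.
rewrite lt_def C_ge0 andbT; apply/eqP => C0.
have b0 : beta != 0 by rewrite gt_eqF //; have /andP[] := beta01; lra.
have f0 k x : X x -> feat k x = 0.
  move=> Xx; have := feat_sqsum_le mX m1 full merc KC C_ge0 L2_psi orth_psi eigenvalue_ge0
    eigen_expansion k.+1 Xx.
  rewrite C0 expr0n /= big_ord_recr /= => h.
  have s0 : 0 <= \sum_(i < k) feat i x ^+ 2 by apply: sumr_ge0 => i _; exact: sqr_ge0.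
  have := sqr_ge0 (feat k x) => h2.
  have : feat k x ^+ 2 = 0 by apply/eqP; rewrite eq_le h2 andbT; lra.
  by move/eqP; rewrite sqrf_eq0 => /eqP.
have mu_0 k : mu k = 0.
  have := IP_feat_feat mX m1 merc KC C_ge0 L2_psi orth_psi eigenvalue_ge0 eigen_expansion k k.
  rewrite eqxx mul1r => <-; apply/eqP; rewrite eq_le IP_ge0 andbT -[X in _ <= X](expr0n R 2).
  apply: (IP_bounded_le mX m1) => //; first exact: (L2_feat mX m1 merc KC C_ge0 mu L2_psi k).1.
  by move=> x Xx; rewrite f0 // normr0.
have r0 : IP r r = 0.
  have h := expansion_tail mX m1 L2_psi orth_psi L2_ratio ratio_expansion.
  have h2 : (fun n => IP r r - \sum_(k < n) (powR (mu k) beta * IP g (psi k)) ^+ 2) @ \oo --> IP r r.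
    rewrite [X in X @ _](_ : _ = fun=> IP r r); first exact: cvg_cst.
    apply/funext => n; rewrite big1 ?subr0 // => k _.
    by rewrite mu_0 powR0 // mul0r expr0n.
  by have := cvg_unique _ h2 h; apply.
have L1 : L2 (fun=> 1) by apply: (L2_bounded mX m1 (M := 1)) => // x _; rewrite normr1.
have := IP_sqr_le mX L2_ratio L1; rewrite r0 mul0r.
have -> : IP r (fun=> 1) = 1.
  have [_ [_ q1]] := dq.
  rewrite -(ip_IP mX dp dq alpha01 mE) //; last exact: L2_ratio.1.
  rewrite /ip /Rintegral (eq_integral (fun x => (q x)%:E)) ?q1 //.
  by move=> x; rewrite inE => Xx; rewrite mulr1 (rel_ratio_mixture dp dq alpha01).
by rewrite expr1n ler10.
Qed.


Section Sampling.
Variable nu : probability (T * T)%type R.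
Hypothesis nu_fst : forall A, measurable A ->
  nu (fst @^-1` A) = (\int[lam]_(x in A `&` X) (p x)%:E)%E.
Hypothesis nu_snd : forall A, measurable A ->
  nu (snd @^-1` A) = (\int[lam]_(x in A `&` X) (q x)%:E)%E.

Let integrable_bdens (h s : T -> R) : bmeas h -> is_density lam X s ->
  lam.-integrable X (EFin \o (fun x => h x * s x)).
Proof.
move=> [mh [M hM]] [ms [s0 s1]].
have is_ : lam.-integrable X (EFin \o s).
  apply/integrableP; split; first exact/measurable_EFinP.
  rewrite (eq_integral (fun x => (s x)%:E)) ?s1 ?ltry // => x; rewrite inE => Xx /=.
  by rewrite ger0_norm // s0.
apply: (le_integrable mX _ _ (integrableZl mX `|M| is_)).
  by apply/measurable_EFinP; apply: measurable_funM => //; exact: measurable_funTS.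
move=> x Xx /=; rewrite lee_fin !normrM normr_id ler_wpM2r //.
exact: (le_trans (hM x) (ler_norm M)).
Qed.

Lemma EmixE h : bmeas h -> Emix nu alpha h = \int[m]_(x in X) h x.
Proof.
move=> bh; have [mp [p0 p1]] := dp; have [mq [q0 q1]] := dq.
rewrite /Emix (expect_comp_density mX mp p0 p1 measurable_fst nu_fst bh).
rewrite (expect_comp_density mX mq q0 q1 measurable_snd nu_snd bh).
rewrite (Rintegral_density mX (measurable_mixture alpha dp dq)
  (mixture_ge0 dp dq alpha01) mE); last by apply: measurable_funTS; have [] := bh.
have ip_ := integrable_bdens bh dp; have iq := integrable_bdens bh dq.
rewrite -!RintegralZl // -RintegralD //; last 2 first.
- exact: (integrableZl mX (1 - alpha) ip_).
- exact: (integrableZl mX alpha iq).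
by apply: eq_Rintegral => x _; rewrite /mixture; ring.
Qed.

(** Extended by zero, so that the bounds hold at every point; a sample may leave [X] on a null
    event. *)
Definition phi k : T -> R := feat k \_ X.

Definition ratioX : T -> R := r \_ X.

Let onX (f : T -> R) : {in X, f \_ X =1 f}.
Proof. by move=> x Xx; rewrite patchE Xx. Qed.

Lemma phi_sqsum_le n y : \sum_(i < n) phi i y ^+ 2 <= C ^+ 2.
Proof.
have [Xy|nXy] := pselect (X y).
  have := feat_sqsum_le mX m1 full merc KC C_ge0 L2_psi orth_psi eigenvalue_ge0
    eigen_expansion n Xy.
  by under eq_bigr do rewrite -(onX (feat _)) ?inE //.
rewrite big1 ?sqr_ge0 // => i _; rewrite /phi patchE memNset // expr0n //.
Qed.

Lemma measurable_phi k : measurable_fun setT (phi k).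
Proof.
apply/(measurable_restrictT _ mX).
exact: (L2_feat mX m1 merc KC C_ge0 mu L2_psi k).1.
Qed.

Let C0 := kernel_bound_gt0.

Lemma bmeas_phiX k : bmeas (phi k).
Proof.
split; first exact: measurable_phi.
exists C => y; apply: (@coord_bound R k.+1 C C0 (fun j => phi j y) (phi_sqsum_le k.+1 y) ord_max).
Qed.

Lemma ratioX_bounds y : 0 <= ratioX y <= alpha^-1.
Proof.
have [Xy|nXy] := pselect (X y).
  by rewrite /ratioX onX ?inE //; exact: rel_ratio_bounds dp dq alpha01 _ Xy.
by rewrite /ratioX patchE memNset //= invr_ge0 (ltW a0) lexx.
Qed.

Lemma bmeas_ratioX : bmeas ratioX.
Proof.
split; first by apply/(measurable_restrictT _ mX); exact: L2_ratio.1.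
by exists alpha^-1 => y; have /andP[h0 h1] := ratioX_bounds y; rewrite ger0_norm.
Qed.

Lemma Emix_mul f h : bmeas (f \_ X) -> bmeas (h \_ X) ->
  Emix nu alpha (fun y => (f \_ X) y * (h \_ X) y) = IP f h.
Proof.
move=> bf bh; rewrite EmixE; last exact: bmeasM.
by apply: eq_Rintegral => x Xx; rewrite !onX.
Qed.

Lemma Emix_phi_phi i j : Emix nu alpha (fun y => phi i y * phi j y) = (i == j)%:R * mu i.
Proof.
rewrite Emix_mul; [|exact: bmeas_phiX|exact: bmeas_phiX].
exact: (IP_feat_feat mX m1 merc KC C_ge0 L2_psi orth_psi eigenvalue_ge0 eigen_expansion i j).
Qed.

Lemma Emix_ratio_phi k :
  Emix nu alpha (fun y => ratioX y * phi k y) = Num.sqrt (mu k) * rcoef k.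
Proof. by rewrite Emix_mul ?IP_ratio_feat //; [exact: bmeas_ratioX|exact: bmeas_phiX]. Qed.

Lemma Emix_ratio_sqr n : Emix nu alpha (fun y => ratioX y ^+ 2) =
  \sum_(k < n) rcoef k ^+ 2 + rtail n ^+ 2.
Proof.
rewrite sqr_rtail addrC subrK -Emix_mul; [|exact: bmeas_ratioX|exact: bmeas_ratioX].
by congr (Emix _ _ _); apply/funext => y; rewrite expr2.
Qed.

Lemma change_of_population h : bmeas h ->
  \int[nu]_u h u.2 = Emix nu alpha (fun y => h y * ratioX y).
Proof.
move=> bh; have [mq [q0 q1]] := dq.
rewrite (expect_comp_density mX mq q0 q1 measurable_snd nu_snd bh).
have bhr := bmeasM bh bmeas_ratioX.
rewrite EmixE // (Rintegral_density mX (measurable_mixture alpha dp dq)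
  (mixture_ge0 dp dq alpha01) mE); last by apply: measurable_funTS; have [] := bhr.
apply: eq_Rintegral => x Xx; rewrite /ratioX onX // -mulrA.
by rewrite (rel_ratio_mixture dp dq alpha01) // -inE.
Qed.

Lemma trunc_dist n (v : 'I_n -> R) :
  (\int[lam]_(x in X) ((\sum_(k < n) v k * feat k x - r x) ^+ 2 * w x)%:E =
   (\sum_(k < n) (Num.sqrt (mu k) * v k - rcoef k) ^+ 2 + rtail n ^+ 2)%:E)%E.
Proof.
have bl : bmeas (lin (fun i : 'I_n => phi i) v).
  by apply: bmeas_sum => i; apply: bmeasZ; exact: bmeas_phiX.
have bd : bmeas (fun y => (lin (fun i : 'I_n => phi i) v y - ratioX y) ^+ 2).
  by apply: bmeasX; apply: bmeasB => //; exact: bmeas_ratioX.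
rewrite -(Emix_lin_dist alpha01 C0 (fun i : 'I_n => measurable_phi i) (phi_sqsum_le n)
  bmeas_ratioX (nu := nu) (mu := fun k : 'I_n => mu k) (rr := fun k : 'I_n => rcoef k)
  (tau := rtail n)); last 3 first.
- by move=> i j; exact: Emix_phi_phi.
- by move=> k; exact: Emix_ratio_phi.
- exact: Emix_ratio_sqr.
rewrite EmixE // /Rintegral fineK; last first.
  apply: integrable_fin_num => //; apply: integrableS (bmeas_integrable m bd) => //.
rewrite (integral_mixture mX dp dq alpha01 mE); last by apply: measurable_funTS; have [] := bd.
apply: eq_integral => x Xx; rewrite /ratioX onX // /lin.
by congr (((_ - _) ^+ 2 * _)%:E); apply: eq_bigr => k _; rewrite /phi onX.
Qed.

Section Iterates.
Variables (a t0 : R) (dO : measure_display) (O : measurableType dO) (P : probability O R).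
Variable Z : nat -> O -> T * T.
Hypothesis a4 : 4 <= a.
Hypothesis t0_large : powR (2 + 4 * C ^+ 2 * a) ((2 * beta + 1) / (2 * beta)) <= t0.
Hypothesis iid : iid_seq P Z.
Hypothesis law0 : forall A, measurable A -> nu A = P (Z 0 @^-1` A).

Local Notation eta := (step a t0 beta).
Local Notation lamb := (reg a t0 beta).

Definition trunc_iter n z j : 'I_n -> R :=
  iter (fun i u => phi i u.1) (fun i u => phi i u.2) alpha t0 eta z j.

Definition error_bound (t : nat) (ell : R) : R :=
  2 * t0 / alpha / bt t0 t
  + ((5 * beta + 1) / (beta * (1 + beta)) * l2norm lam X w g * powR a (- beta)
     + 16 * C / alpha * Num.sqrt a * ell) * powR (bt t0 t)^-1 (beta / (2 * beta + 1))
  + (32 * C ^+ 3 / alpha * powR a (5 / 2)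
     + 8 * C ^+ 3 * (10 * C + 3) / alpha * powR a (7 / 2) * Num.sqrt (ln (bt t0 t)))
    * ell ^+ 2 * powR (bt t0 t)^-1 ((4 * beta - 1) / (4 * beta + 2)).

Lemma sqr_l2norm_g : l2norm lam X w g ^+ 2 = IP g g.
Proof.
rewrite /l2norm sqr_sqrtr; last by apply: fine_ge0; apply: integral_ge0 => x Xx;
  rewrite lee_fin mulr_ge0 ?sqr_ge0 // (mixture_ge0 dp dq alpha01).
rewrite -(integral_mixture mX dp dq alpha01 mE) ?(IPffE mX L2_g) //.
by apply: measurable_funX; exact: L2_g.1.
Qed.

Lemma trunc_tail n t delta : 0 < delta < 1 ->
  exists E : set O, [/\ measurable E, ((1 - delta)%:E <= P E)%E &
    forall o, E o -> enorm (fun k : 'I_n =>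
      Num.sqrt (mu k) * trunc_iter (Z ^~ o) t k - rcoef k) <=
      2 * rtail n + error_bound t (ln (2 / delta))].
Proof.
move=> d01; have [mZ indepZ idZ] := iid.
have mp (i : 'I_n) : measurable_fun setT (phi i) := measurable_phi i.
have e2 : forall i j : 'I_n, Emix nu alpha (fun y => phi i y * phi j y) = (i == j)%:R * mu i.
  by move=> i j; exact: Emix_phi_phi.
have er : forall k : 'I_n, Emix nu alpha (fun y => ratioX y * phi k y) = Num.sqrt (mu k) * rcoef k.
  by move=> k; exact: Emix_ratio_phi.
have lawZ i A : measurable A -> P (Z i @^-1` A) = nu A.
  by move=> mA; rewrite idZ // law0.
have gle : \sum_(k < n) IP g (psi k) ^+ 2 <= l2norm lam X w g ^+ 2.
  by rewrite sqr_l2norm_g; exact: (bessel mX m1 L2_psi orth_psi n L2_g).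
have [E [mE' PE hE]] := core_tail (phi1 := fun (i : 'I_n) u => phi i u.1)
  (phi2 := fun (i : 'I_n) u => phi i u.2) (mu := fun k : 'I_n => mu k)
  (rr := fun k : 'I_n => rcoef k) (tau := rtail n) alpha01 C0
  (fun i => measurableT_comp (mp i) measurable_fst)
  (fun i => measurableT_comp (mp i) measurable_snd)
  (fun u => phi_sqsum_le n u.1) (fun u => phi_sqsum_le n u.2)
  (start_ge2 C0 a4 beta01 t0_large) (step_gt0 C0 a4 beta01 t0_large)
  (step_decr C0 a4 beta01 t0_large) (step_bt_incr C0 a4 beta01 t0_large)
  (step_small C0 a4 beta01 t0_large) (fun k : 'I_n => eigenvalue_ge0 k)
  (mix_sum_mu_le alpha01 C0 mp (phi_sqsum_le n) e2)
  (mix_rr_le alpha01 bmeas_ratioX ratioX_bounds change_of_population (Emix_ratio_sqr n))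
  (mix_mean_zeta C0 mp (phi_sqsum_le n) change_of_population e2 er)
  (@mix_var_zeta _ _ _ _ _ _ _ _ _ _ _ _ alpha01 C0 mp (phi_sqsum_le n) bmeas_ratioX
    change_of_population e2 er (Emix_ratio_sqr n))
  (mix_var_zeta1 alpha01 C0 mp (phi_sqsum_le n) bmeas_ratioX ratioX_bounds change_of_population
     e2 er (Emix_ratio_sqr n))
  mZ indepZ lawZ (gam := l2norm lam X w g) (g := fun k : 'I_n => IP g (psi k))
  (pw := fun k : 'I_n => powR (mu k) beta)
  (regpow_gt0 C0 a4 beta01 t0_large) (regpow_decr C0 a4 beta01 t0_large)
  (regpow_step C0 a4 beta01 t0_large) (sqrtr_ge0 _) (sqrtr_ge0 _) gle
  (fun k => erefl) (fun k => powR_ge0 _ _)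
  (fun k i => powR_le_regpow C0 a4 beta01 t0_large i (eigenvalue_ge0 k)) t d01.
exists E; split => // o Eo; apply: (le_trans (hE o Eo)).
apply: (core_bound_le C0 a4 beta01 t0_large alpha01 (sqrtr_ge0 _)).
have /andP[d0 d1] := d01; apply: (le_trans (@ln2_ge R)).
by rewrite ler_ln ?posrE ?divr_gt0 // ler_pdivlMr // ler_piMr // ltW.
Qed.

(** One step is a polynomial in values of the previous iterate and of the kernel; for the truncated
    kernel these converge by induction and by the Mercer expansion. *)
Lemma trunc_cvg z t y : (forall i, (i < t)%N -> X (z i).1 /\ X (z i).2) -> X y ->
  (fun n => \sum_(k < n) trunc_iter (n := n) z t k * feat k y) @ \oo
    --> olre K alpha eta lamb z t y.
Proof.
have merc_lim x y' : X x -> X y' -> (fun n => \sum_(k < n) feat k x * feat k y') @ \oo --> K x y'.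
  exact: (mercer_expansion mX m1 full merc KC C_ge0 L2_psi orth_psi eigenvalue_ge0 eigen_expansion).
elim: t y => [|t IH] y zX Xy.
  rewrite [X in X @ _](_ : _ = fun=> 0) /=; first exact: cvg_cst.
  by apply/funext => n; rewrite big1 // => k _; rewrite mul0r.
have [Xx Xx'] := zX t (ltnSn t).
have IHt y' : X y' -> (fun n => \sum_(k < n) trunc_iter (n := n) z t k * feat k y') @ \oo
    --> olre K alpha eta lamb z t y'.
  by apply: IH => i it; apply: zX; exact: ltnW.
have stepE n : \sum_(k < n) trunc_iter (n := n) z t.+1 k * feat k y =
  (1 - eta t.+1 * lamb t.+1) * (\sum_(k < n) trunc_iter (n := n) z t k * feat k y)
  - eta t.+1 * ((1 - alpha) * (\sum_(k < n) trunc_iter (n := n) z t k * feat k (z t).1)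
                  * (\sum_(k < n) feat k (z t).1 * feat k y)
     + (alpha * (\sum_(k < n) trunc_iter (n := n) z t k * feat k (z t).2) - 1)
                  * (\sum_(k < n) feat k (z t).2 * feat k y)).
  rewrite (step_mul_reg C0 a4 beta01 t0_large).
  have f1 : \sum_(k < n) trunc_iter (n := n) z t k * feat k (z t).1 =
     \sum_(k < n) trunc_iter (n := n) z t k * phi k (z t).1.
    by apply: eq_bigr => k _; rewrite /phi onX ?inE.
  have f2 : \sum_(k < n) trunc_iter (n := n) z t k * feat k (z t).2 =
     \sum_(k < n) trunc_iter (n := n) z t k * phi k (z t).2.
    by apply: eq_bigr => k _; rewrite /phi onX ?inE.
  rewrite f1 f2; set A := \sum_(k < n) _ * phi k (z t).1; set B := \sum_(k < n) _ * phi k (z t).2.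
  move: (erefl A) (erefl B); rewrite {1}/A {1}/B; move: A B => A B eA eB.
  rewrite !mulr_sumr -big_split /= mulr_sumr -sumrB; apply: eq_bigr => k _.
  have p1 : phi k (z t).1 = feat k (z t).1 by rewrite /phi onX ?inE.
  have p2 : phi k (z t).2 = feat k (z t).2 by rewrite /phi onX ?inE.
  rewrite /trunc_iter /= /zeta p1 p2.
  by rewrite -/(trunc_iter z t) eA eB; ring.
under eq_fun do rewrite stepE; rewrite /=.
have hx := IHt _ Xx; have hx' := IHt _ Xx'; have hy := IHt _ Xy.
have kx := merc_lim _ _ Xx Xy; have kx' := merc_lim _ _ Xx' Xy.
apply: cvgB; first by apply: cvgM => //; exact: cvg_cst.
apply: cvgM; first exact: cvg_cst.
apply: cvgD; apply: cvgM => //.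
  by apply: cvgM => //; exact: cvg_cst.
by apply: cvgB; [apply: cvgM => //; exact: cvg_cst|exact: cvg_cst].
Qed.

Lemma samples_in_domain t : exists G : set O, [/\ measurable G, P G = 1%E &
  forall o, G o -> forall i, (i < t)%N -> X (Z i o).1 /\ X (Z i o).2].
Proof.
have [mZ _ idZ] := iid; have [mp [p0 p1]] := dp; have [mq [q0 q1]] := dq.
have mXX : measurable (X `*` X) by exact: measurableX.
have nuXX : nu (X `*` X) = 1%E.
  have -> : X `*` X = (fst @^-1` X) `&` (snd @^-1` X) by [].
  have mf : measurable (fst @^-1` X : set (T * T)).
    by rewrite -[X in measurable X]setTI; exact: measurable_fst.
  have ms : measurable (snd @^-1` X : set (T * T)).
    by rewrite -[X in measurable X]setTI; exact: measurable_snd.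
  have ns : nu (snd @^-1` X) = 1%E by rewrite nu_snd // setIid.
  by rewrite (probability_setI1 mf ms ns) nu_fst // setIid.
elim: t => [|t [G [mG PG hG]]]; first by exists setT; split => //; exact: probability_setT.
exists ((Z t @^-1` (X `*` X)) `&` G).
have mt : measurable (Z t @^-1` (X `*` X)).
  by rewrite -[X in measurable X]setTI; exact: mZ.
split; first exact: measurableI.
  by rewrite (probability_setI1 mt mG PG) idZ // -law0.
move=> o [[h1 h2] Go] i; rewrite ltnS leq_eqVlt => /orP[/eqP->//|]; exact: hG.
Qed.

Theorem estimator_bound t delta : 0 < delta < 1 ->
  exists E : set O, [/\ measurable E, ((1 - delta)%:E <= P E)%E &
    forall o, E o -> l2dist_le lam X w (olre K alpha eta lamb (Z ^~ o) t) r
      (error_bound t (ln (2 / delta)))].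
Proof.
move=> d01; have [En hEn] := choice (fun n => trunc_tail n t d01).
have [G [mG PG hG]] := samples_in_domain t.
have mEn n : measurable (En n) by have [] := hEn n.
have mlim : measurable (lim_sup_set En).
  by apply: bigcap_measurable => // k _; exact: bigcup_measurable.
exists (lim_sup_set En `&` G); split; first exact: measurableI.
  rewrite (probability_setI1 mlim mG PG); apply: lim_sup_set_ge => // n.
  by have [] := hEn n.
move=> o [Elim Go]; set B := error_bound _ _; rewrite /l2dist_le.
(* The slack [e] absorbs the tail of the ratio, which tends to 0 with the truncation level but is
   positive for each fixed one. *)
apply/lee_addgt0Pr => e e0; rewrite -EFinD.
have : (fun n => (2 * rtail n + B) ^+ 2 + rtail n ^+ 2) @ \oo --> B ^+ 2.
  have h := rtail_cvg.
  rewrite -[B ^+ 2]addr0 -(mulr0 0) -[in X in _ --> X](add0r B) -[X in (X + B) ^+ 2](mulr0 2).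
  rewrite !expr2; under eq_fun do rewrite !expr2.
  have h2 : (fun n => 2 * rtail n + B) @ \oo --> 2 * 0 + B.
    by apply: cvgD; [apply: cvgM => //; exact: cvg_cst|exact: cvg_cst].
  by apply: cvgD; exact: cvgM.
move/cvgrPdist_le => /(_ e e0) [N _ hN].
(* For this outcome, truncation levels tending to infinity at which the bound holds; Fatou is
   applied along them. *)
have /choice[s hs] : forall j, exists n, (j <= n)%N /\ (N <= n)%N /\ En n o.
  move=> j; have [n /= jn Enn] := Elim (maxn j N) I.
  by exists n; rewrite (leq_trans _ jn) ?leq_maxl //; split => //; split => //;
    rewrite (leq_trans _ jn) ?leq_maxr.
have s_oo : s @ \oo --> \oo.
  apply/cvgnyPge => A; exists A => // j /= Aj; have [h _] := hs j; exact: leq_trans h.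
apply: (fatou_le mX (u := fun j x => (\sum_(k < s j) trunc_iter (n := s j) (Z ^~ o) t k * feat k x
    - r x) ^+ 2 * w x)).
- move=> j; apply: measurable_funM; last exact: (measurable_mixture alpha dp dq).
  apply: measurable_funX; apply: measurable_funB; last exact: L2_ratio.1.
  apply: measurable_sum => k; apply: measurable_funM => //.
  exact: (L2_feat mX m1 merc KC C_ge0 mu L2_psi k).1.
- by move=> j x Xx; rewrite mulr_ge0 ?sqr_ge0 // (mixture_ge0 dp dq alpha01).
- move=> x Xx; have hc := cvg_comp _ _ s_oo (trunc_cvg (hG o Go) Xx).
  apply: cvgM; last exact: cvg_cst.
  rewrite expr2; under eq_fun do rewrite expr2.
  by apply: cvgM; (apply: cvgB; [exact: hc|exact: cvg_cst]).
- move=> j; have [_ [Nj Ej]] := hs j; rewrite trunc_dist lee_fin.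
  have [_ _ /(_ o Ej) h] := hEn (s j).
  have := hN (s j) Nj => /=; rewrite ler_norml => /andP[h1 _].
  apply: (@le_trans _ _ ((2 * rtail (s j) + B) ^+ 2 + rtail (s j) ^+ 2)); last by lra.
  rewrite lerD2r -sqr_enorm ler_sqr ?nnegrE ?enorm_ge0 //.
  exact: (le_trans (enorm_ge0 _) h).
Qed.

End Iterates.

End Sampling.

End Truncation.

Theorem theorem1
  (R : realType) (d : nat)
  (lam : {measure set (Rd R d) -> \bar R}) (X : set (Rd R d))
  (p q : Rd R d -> R) (alpha : R)
  (K : Rd R d -> Rd R d -> R) (C : R)
  (mu : nat -> R) (psi : nat -> Rd R d -> R)
  (beta : R) (g : Rd R d -> R) (a t0 : R)
  (dO : measure_display) (O : measurableType dO) (P : probability O R)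
  (Z : nat -> O -> Rd R d * Rd R d) :
  let palpha := fun x => (1 - alpha) * p x + alpha * q x in
  let ralpha := fun x => q x / palpha x in
  let tb := fun t : nat => t%:R + t0 in
  let eta := fun t : nat => a * powR (tb t) (- (2 * beta / (2 * beta + 1))) in
  let lamb := fun t : nat => a^-1 * powR (tb t) (- (1 / (2 * beta + 1))) in
  let C1 := 2 * t0 / alpha in
  let C2 := (5 * beta + 1) / (beta * (1 + beta)) * l2norm lam X palpha g in
  let C3 := 16 * C / alpha in
  let C4 := 32 * C ^+ 3 / alpha in
  let C5 := 8 * C ^+ 3 * (10 * C + 3) / alpha in
  is_lebesgue lam ->
  measurable X ->
  is_density lam X p -> is_density lam X q ->
  dsupport lam X q `<=` dsupport lam X p ->
  0 < alpha < 1 ->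
  dsupport lam X palpha = X ->
  mercer_kernel X K ->
  (forall x, X x -> Num.sqrt (K x x) <= C) ->
  eigensystem lam X palpha K mu psi ->
  1 / 2 <= beta <= 1 ->
  inL2 lam X palpha g ->
  is_LK_pow lam X palpha mu psi beta g ralpha ->
  4 <= a ->
  powR (2 + 4 * C ^+ 2 * a) ((2 * beta + 1) / (2 * beta)) <= t0 ->
  iid_seq P Z ->
  (forall A, measurable A ->
     P ((fun o => (Z 0 o).1) @^-1` A) = (\int[lam]_(x in A `&` X) (p x)%:E)%E) ->
  (forall A, measurable A ->
     P ((fun o => (Z 0 o).2) @^-1` A) = (\int[lam]_(x in A `&` X) (q x)%:E)%E) ->
  forall (t : nat) (delta : R), 0 < delta < 1 ->
  exists E : set O, [/\ measurable E, ((1 - delta)%:E <= P E)%E &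
    forall o, E o ->
      l2dist_le lam X palpha (olre K alpha eta lamb (fun s => Z s o) t) ralpha
        (C1 / tb t
         + (C2 * powR a (- beta) + C3 * Num.sqrt a * ln (2 / delta))
           * powR (tb t)^-1 (beta / (2 * beta + 1))
         + (C4 * powR a (5 / 2) + C5 * powR a (7 / 2) * Num.sqrt (ln (tb t)))
           * ln (2 / delta) ^+ 2
           * powR (tb t)^-1 ((4 * beta - 1) / (4 * beta + 2)))].
Proof.
move=> palpha ralpha tb eta lamb C1 C2 C3 C4 C5 _ mX dp dq _ alpha01 sX merc KC eigs beta01
  gL2 gpow a4 t0_large iid law_p law_q t delta d01.
have [mZ _ _] := iid.
(* [nu] is the common law of the pairs, and [m] below is the probability with density [p^alpha]; all
   inner products are taken with respect to [m]. *)
have [nu nuE] := law_exists P (mZ 0%N).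
have [m mE] := density_probability mX (measurable_mixture alpha dp dq)
  (mixture_ge0 dp dq alpha01) (mixture_mass mX dp dq alpha01).
have nu_fst A : measurable A -> nu (fst @^-1` A) = (\int[lam]_(x in A `&` X) (p x)%:E)%E.
  move=> mA; rewrite nuE; first exact: law_p.
  by rewrite -[X in measurable X]setTI; exact: measurable_fst.
have nu_snd A : measurable A -> nu (snd @^-1` A) = (\int[lam]_(x in A `&` X) (q x)%:E)%E.
  move=> mA; rewrite nuE; first exact: law_q.
  by rewrite -[X in measurable X]setTI; exact: measurable_snd.
exact: (estimator_bound mX dp dq alpha01 sX merc KC eigs beta01 gL2 gpow mE nu_fst nu_snd
  a4 t0_large iid nuE t d01).
Qed.
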